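(* Let $d\in\mathbb{N}$ (so $d \geq 1$). For real $H\geq 1$ let $N_d(H)$ denote the number of $\mathbf{a}=(a_1,a_2,a_3)\in\mathbb{Z}^3$ with $|a_i|\leq H$ for $i=1,2,3$ such that the equation $$a_1x_1^d+a_2x_2^d+a_3x_3^d=0$$ has a solution $(x_1,x_2,x_3)\in\mathbb{Q}^3\setminus\{(0,0,0)\}$. Put $$\psi(d):=\frac{3}{\phi(d)}\Big(1-\frac1d\Big),$$ where $\phi$ is Euler's totient function. Then there exists a constant $c(d)>0$, depending only on $d$, such that for all real $H>1$, $$N_d(H)\leq c(d)\,\frac{H^3}{(\log H)^{\psi(d)}}.$$
   Context: The coefficient vectors counted by $N_d(H)$ are arbitrary integer vectors in the box $|a_i|\le H$; some or all coefficients may be zero. The condition on $\mathbf{a}$ is that the locus $a_1x_1^d+a_2x_2^d+a_3x_3^d=0$ in $\mathbb{P}^2$ has at least one $\mathbb{Q}$-rational point. *)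

(* Defs.v *)
From HB Require Import structures.
From mathcomp Require Import all_boot all_order all_algebra.
From mathcomp Require Import finmap.
From mathcomp Require Import all_classical all_reals all_analysis.

Set Implicit Arguments.
Unset Strict Implicit.
Unset Printing Implicit Defensive.

Import Order.TTheory GRing.Theory Num.Theory.
Local Open Scope classical_set_scope.
Local Open Scope ring_scope.

Definition diag_soluble (d : nat) (a : 'rV[int]_3) : Prop :=
  exists2 x : 'rV[rat]_3,
    x != 0 & \sum_(i < 3) (a 0 i)%:~R * x 0 i ^+ d = 0.

Definition int_box (R : realType) (H : R) : set 'rV[int]_3 :=
  [set a | forall i, `|(a 0 i)%:~R| <= H].

Definition soluble_in_box (R : realType) (d : nat) (H : R) : set 'rV[int]_3 :=
  [set a | int_box H a /\ diag_soluble d a].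

Lemma finite_int_box (R : realType) (H : R) : finite_set (int_box H).
Proof.
pose n := Num.truncn H.
pose f (u : 'rV['I_(n + n).+1]_3) : 'rV[int]_3 :=
  map_mx (fun k : 'I_(n + n).+1 => k%:Z - n%:Z) u.
apply: (@sub_finite_set _ _ (f @` [set: _])); last first.
  exact: finite_image finite_finset.
move=> a aH; exists (\row_i inord (absz (a 0 i + n%:Z))) => //.
apply/rowP => i; rewrite !mxE.
have an : (absz (a ord0 i) <= n)%N.
  rewrite /n truncn_ge_nat; last exact: le_trans (aH i).
  by rewrite natr_absz intr_norm aH.
have := an; rewrite -lez_nat abszE ler_norml => /andP[lo hi].
have ge0 : 0 <= a 0 i + n%:Z by rewrite -lerBlDr sub0r.
rewrite inordK; first by rewrite gez0_abs// addrK.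
by rewrite ltnS -lez_nat gez0_abs// PoszD lerD2r.
Qed.

(* [fset_set] returns the empty set on an infinite argument; the count below
   is meaningful because of this lemma. *)
Lemma finite_soluble_in_box (R : realType) (d : nat) (H : R) :
  finite_set (soluble_in_box d H).
Proof. by apply: sub_finite_set (finite_int_box H) => a []. Qed.

Definition Nsol (R : realType) (d : nat) (H : R) : nat :=
  #|` fset_set (soluble_in_box d H)|%fset.

Definition psi (R : realType) (d : nat) : R :=
  3%:R / (totient d)%:R * (1 - d%:R^-1).

(* Main.v *)
Require Import Defs.
From mathcomp Require Import all_boot all_order all_algebra.
From mathcomp Require Import all_fingroup all_solvable all_field.
From mathcomp Require Import all_classical all_reals all_analysis.
From mathcomp Require Import finmap zify ring lra.
From mathcomp Require Import fintype finset.

(** The statement reduces to a prime exponent.  If the form with exponent [d]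
    has a nontrivial zero [x], then the powers of the coordinates of [x] give
    a zero of the form with exponent [l], for every divisor [l] of [d]
    ([soluble_prime_factor]).  For [l] the least prime factor of [d] one has
    [psi d <= psi l = 3 / l] ([psi_le]), so a bound with exponent [3 / l] for
    the forms of degree [l] is enough ([soluble_count_prime]).

    Let [l] be prime and let [p] be a prime with [p = 1] modulo [l].  If [p]
    divides exactly one coefficient, to the first power, and if the quotient
    of the two others is not minus an [l]-th power modulo [p], then reduction
    modulo [p] and then modulo [p ^ 2] shows that the form has no nontrivial
    zero ([obstructed_insoluble]).  The triples modulo [p ^ 2] excluded in
    this way have density [3 (1 - 1/l) / p + O(1 / p^2)] ([density_ge]).  A
    sieve of Selberg type over the squarefree products of such primes below a
    small power [z] of [N] bounds the number of surviving triples in a cube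
    of side [N] by [4 N^3 / L] ([sieve_bound]), and Rankin's trick shows that
    [L] is at least a constant times the exponential of the sum of the
    densities ([rankin_lower_bound]).  That exponential is of order
    [(log N) ^ (3 / l)] as soon as the sum of [1 / p] over the primes
    [p = 1] modulo [l] up to [z] is at least
    [log (log z) / (l - 1) - C] ([sum_inv_primes]).

    This last estimate is obtained without L-functions, by Chebyshev's method
    for [n!] transported to the ring of integers of the [l]-th cyclotomic
    field ([mertens]).  Put [n = l - 1] and identify the ring with [Z^n]; the
    norm is the determinant of a multiplication matrix.  On a box of [X ^ n]
    points placed so that all conjugates have size about [X], the sum of the
    logarithms of the norms is [n X^n log X + O(X^n)].  It is also the sum
    over primes [p] of [log p] times the total [p]-adic valuation of the
    norms.  If [p = 1] modulo [l], the norm splits over the [p]-adic integers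
    into [n] evaluations at roots of unity ([split_count]), so that the
    valuation is counted by the ideals which are the kernels of evaluation
    modulo [p ^ k].  If [p] is another prime, the points whose norm is
    divisible by [p] lie in few ideals of index at least [p ^ 2]
    ([nonsplit_count]), and their total contribution is [O(X^n)].  The number
    of points of an ideal in a box is controlled with the right main term
    because an ideal of index [q] contains an element of size [q ^ (1/n)],
    and dividing by that element with remainder gives representatives of that
    size for all cosets ([kernel_count]).  With Chebyshev's upper bound for
    the number of primes the error terms add up to [O(X^n)], which leaves
    [sum of log p / p >= log X - C]. *)

Set Implicit Arguments.
Unset Strict Implicit.
Unset Printing Implicit Defensive.

Import Order.TTheory GRing.Theory Num.Theory.
Local Open Scope ring_scope.

(** * The ring generated by a root of unity, as integer vectors *)

Lemma absz_sum_le (T : finType) (F : T -> int) :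
  (`|(\sum_i F i)%R| <= \sum_i `|F i|)%N.
Proof.
rewrite -lez_nat abszE; apply: (le_trans (ler_norm_sum _ _ _)).
by rewrite -natz natr_sum; apply: ler_sum => k _; rewrite natz abszE.
Qed.

Section RegularRepresentation.
Variable m : nat.
Local Notation n := m.+1.

(** Companion matrix of [1 + X + ... + X^n]: with [zeta] a root, row [i] holds
    the coordinates of [zeta * zeta^i] in the basis [1, zeta, ..., zeta^m]. *)
Definition zeta_mx : 'M[int]_n :=
  \matrix_(i, j) if i == ord_max then -1 else (i.+1 == j)%:R.

Definition regular_mx (a : 'rV[int]_n) : 'M[int]_n := \sum_(i < n) a 0 i *: zeta_mx ^+ i.

Definition cyclo_norm (a : 'rV[int]_n) : int := \det (regular_mx a).

Definition zeta_eval (S : comNzRingType) (w : S) (a : 'rV[int]_n) : S :=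
  \sum_(i < n) (a 0 i)%:~R * w ^+ i.

Definition phi_root (S : comNzRingType) (w : S) := \sum_(i < m.+2) w ^+ i = 0.

Section Eval.
Variables (S : comNzRingType) (w : S).
Hypothesis w0 : phi_root w.
Let vw : 'cV[S]_n := \col_i w ^+ i.

(** Every root [w] of the cyclotomic polynomial, in any commutative ring, makes
    [(1, w, ..., w^m)] an eigenvector.  This is what transports the norm to
    complex numbers, to finite fields and to residue rings with one proof. *)
Lemma zeta_mx_eigen : map_mx intr zeta_mx *m vw = w *: vw.
Proof.
apply/colP => i; rewrite !mxE -exprS.
case: (eqVneq i ord_max) => [->|ni].
  rewrite (eq_bigr (fun j : 'I_n => - w ^+ j)); last first.
    by move=> j _; rewrite !mxE eqxx rmorphN1 mulN1r.
  rewrite sumrN; apply/eqP; rewrite eq_sym -addr_eq0 addrC.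
  by have := w0; rewrite /phi_root big_ord_recr /= => ->.
have im : (i.+1 < n)%N.
  by have := ltn_ord i; rewrite ltnS leq_eqVlt => /orP[/eqP e|//]; case/eqP: ni; exact: val_inj.
rewrite (bigD1 (Ordinal im)) //= big1 ?addr0.
  by rewrite !mxE (negPf ni) eqxx rmorph1 mul1r.
move=> j nj; rewrite !mxE (negPf ni).
case: eqP => [e|_]; last by rewrite rmorph0 mul0r.
by case/eqP: nj; apply: val_inj; rewrite /= e.
Qed.

Lemma zeta_mxX_eigen i : map_mx intr (zeta_mx ^+ i) *m vw = w ^+ i *: vw.
Proof.
elim: i => [|i IH]; first by rewrite !expr0 scale1r map_mx1 mul1mx.
by rewrite exprSr map_mxM -mulmxA zeta_mx_eigen -scalemxAr IH scalerA exprS.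
Qed.

Lemma regular_mx_eigen a : map_mx intr (regular_mx a) *m vw = zeta_eval w a *: vw.
Proof.
rewrite /regular_mx /zeta_eval map_mx_sum mulmx_suml scaler_suml.
apply: eq_bigr => i _.
have -> : map_mx (intr : int -> S) (a 0 i *: zeta_mx ^+ i)
        = (a 0 i)%:~R *: map_mx intr (zeta_mx ^+ i).
  by apply/matrixP => p q; rewrite !mxE rmorphM.
by rewrite -scalemxAl zeta_mxX_eigen scalerA.
Qed.

Lemma zeta_evalE a : zeta_eval w a = (map_mx intr a *m vw) 0 0.
Proof. by rewrite mxE; apply: eq_bigr => i _; rewrite !mxE. Qed.

Lemma zeta_evalM a b : zeta_eval w (b *m regular_mx a) = zeta_eval w b * zeta_eval w a.
Proof.
by rewrite zeta_evalE map_mxM -mulmxA regular_mx_eigen -scalemxAr mxE -zeta_evalE mulrC.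
Qed.

Lemma zeta_evalB a b : zeta_eval w (a - b) = zeta_eval w a - zeta_eval w b.
Proof. by rewrite /zeta_eval -sumrB; apply: eq_bigr => i _; rewrite !mxE rmorphB mulrBl. Qed.

Lemma zeta_evalD a b : zeta_eval w (a + b) = zeta_eval w a + zeta_eval w b.
Proof. by rewrite /zeta_eval -big_split /=; apply: eq_bigr => i _; rewrite !mxE rmorphD mulrDl. Qed.

End Eval.

(** The eigenvector equations for [n] roots at once read [M V = V D], with [V] a
    Vandermonde matrix and [D] diagonal; the determinant of [V] is kept as a
    factor because it may be a zero divisor. *)
Lemma cyclo_norm_prod (S : comNzRingType) (s : 'I_n -> S) a :
  (forall j, phi_root (s j)) ->
  (cyclo_norm a)%:~R * \det (Vandermonde n (\row_j s j)) =
  (\prod_j zeta_eval (s j) a) * \det (Vandermonde n (\row_j s j)).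
Proof.
move=> hs; set V := Vandermonde _ _.
have <- : \det (diag_mx (\row_j zeta_eval (s j) a)) = \prod_j zeta_eval (s j) a.
  by rewrite det_diag; apply: eq_bigr => j _; rewrite mxE.
rewrite mulrC /cyclo_norm -det_map_mx -!det_mulmx det_mulmx mulrC -det_mulmx.
rewrite [RHS]det_mulmx mulrC -det_mulmx; congr (\det _).
apply/matrixP => i j.
have /colP/(_ i) := regular_mx_eigen (hs j) a.
rewrite !mxE => e.
transitivity (\sum_j0 map_mx intr (regular_mx a) i j0 * (\col_i0 s j ^+ i0) j0 0).
  by apply: eq_bigr => k _; rewrite !mxE.
rewrite e (bigD1 j) //= big1 ?addr0; last first.
  by move=> k nk; rewrite !mxE (negPf nk) mulr0n mulr0.
by rewrite !mxE eqxx mulr1n mulrC.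
Qed.

Lemma cyclo_norm_prod_unit (S : comUnitRingType) (s : 'I_n -> S) a :
  (forall j, phi_root (s j)) ->
  (forall i j : 'I_n, (i < j)%N -> s j - s i \is a GRing.unit) ->
  (cyclo_norm a)%:~R = \prod_j zeta_eval (s j) a.
Proof.
move=> hs hu; apply: (mulIr _ (cyclo_norm_prod a hs)).
rewrite det_Vandermonde; apply: rpred_prod => i _; apply: rpred_prod => j ij.
by rewrite !mxE; exact: hu.
Qed.

Lemma phi_root_of_power (S : comUnitRingType) (y : S) :
  y ^+ m.+2 = 1 -> y - 1 \is a GRing.unit -> phi_root y.
Proof.
move=> y1 yu; apply: (mulrI yu).
by rewrite mulr0 -subrX1 y1 subrr.
Qed.

(** Bounds the entries of a multiplication matrix by those of the vector. *)
Definition regular_mx_const : nat := \sum_(i < n) \sum_(p < n) \sum_(q < n) `|(zeta_mx ^+ i) p q|%N.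

Lemma regular_mx_bound (a : 'rV[int]_n) A i j :
  (forall k, (`|a 0%R k| <= A)%N) -> (`|regular_mx a i j| <= regular_mx_const * A)%N.
Proof.
move=> ha; rewrite /regular_mx summxE.
apply: (leq_trans (absz_sum_le _)).
rewrite /regular_mx_const big_distrl /=; apply: leq_sum => k _.
rewrite mxE abszM mulnC; apply: leq_mul => //.
by rewrite (bigD1 i) //= (bigD1 j) //= -addnA leq_addr.
Qed.

End RegularRepresentation.

(** * Principal roots of unity *)

(** Raising to the power [p] improves a congruence to [1] by one power of [p]:
    [x^p - 1] is [x - 1] times a sum of [p] terms congruent to [1] modulo
    [p]. *)
Lemma expr_1Dp (S : comNzRingType) (p k : nat) (y : S) : (0 < k)%N ->
  exists y', (1 + (p ^ k)%:R * y) ^+ p = 1 + (p ^ k.+1)%:R * y'.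
Proof.
case: k => // k _; set x := 1 + _.
have hx j : exists z, x ^+ j = 1 + p%:R * z.
  elim: j => [|j [z IH]]; first by exists 0; rewrite expr0 mulr0 addr0.
  exists (z + (p ^ k)%:R * y * (1 + p%:R * z)).
  rewrite exprSr IH /x expnS natrM; ring.
have [z hz] : exists z, \sum_(i < p) x ^+ i = p%:R * z.
  suff [z hz] : exists z, \sum_(i < p) (x ^+ i - 1) = p%:R * z.
    exists (1 + z); rewrite mulrDr mulr1 -hz sumrB sumr_const card_ord; ring.
  elim/big_ind: _ => [|u v [a ->] [b ->]|i _].
  - by exists 0; rewrite mulr0.
  - by exists (a + b); rewrite mulrDr.
  - by have [z ->] := hx i; exists z; rewrite addrC addKr.
exists (y * z); apply/eqP; rewrite [1 + _]addrC -subr_eq subrX1 hz; apply/eqP.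
rewrite {1}/x [1 + _]addrC addrK [(p ^ k.+2)%N]expnS natrM.
ring.
Qed.

Lemma expr_1Dp_iter (S : comNzRingType) (p k : nat) (y : S) :
  exists y', (1 + p%:R * y) ^+ (p ^ k) = 1 + (p ^ k.+1)%:R * y'.
Proof.
elim: k => [|k [z IH]]; first by exists y; rewrite expr1 expn1.
by rewrite expnSr exprM IH; exact: expr_1Dp.
Qed.

Section PrincipalRoots.
Variable m : nat.
Local Notation n := m.+1.
Local Notation l := m.+2.

(** Asking the differences to be units, and not merely nonzero, makes the
    Vandermonde determinant of the powers of [w] invertible; this matters in
    the residue rings modulo [p^k]. *)
Definition principal_root (S : comUnitRingType) (w : S) :=
  w ^+ l = 1 /\ forall k, (0 < k < l)%N -> w ^+ k - 1 \is a GRing.unit.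

Lemma principal_root_phi (S : comUnitRingType) (w : S) : principal_root w ->
  forall j : 'I_n, phi_root m (w ^+ j.+1).
Proof.
move=> [w1 wu] j; apply: phi_root_of_power; first by rewrite exprAC w1 expr1n.
by apply: wu; rewrite /= ltnS ltn_ord.
Qed.

Lemma cyclo_norm_principal (S : comUnitRingType) (w : S) (a : 'rV[int]_n) : principal_root w ->
  (cyclo_norm a)%:~R = \prod_(j < n) zeta_eval (w ^+ j.+1) a.
Proof.
move=> hw; have hg := principal_root_phi hw; have [w1 wu] := hw.
apply: (cyclo_norm_prod_unit (s := fun j : 'I_n => w ^+ j.+1)) => // i j ij.
have -> : w ^+ j.+1 - w ^+ i.+1 = w ^+ i.+1 * (w ^+ (j - i) - 1).
  rewrite mulrBr mulr1 -exprD; congr (w ^+ _ - _); lia.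
rewrite unitrM wu; last by have := ltn_ord j; lia.
by rewrite andbT unitrX // -(unitrX_pos _ (isT : (0 < l)%N)) w1 unitr1.
Qed.

Lemma principal_root_algC : exists z : algC, [/\ l.-primitive_root z, principal_root z & `|z| = 1].
Proof.
have [z zp] := C_prim_root_exists (isT : (0 < l)%N).
exists z; split=> //; last first.
  by apply/eqP; rewrite -(@pexpr_eq1 _ _ l) // -normrX prim_expr_order // normr1.
split; first exact: prim_expr_order.
move=> k /andP[k0 kl]; rewrite unitfE subr_eq0 -(expr0 z) (eq_prim_root_expr zp).
by rewrite !modn_small // gtn_eqF.
Qed.

Lemma principal_root_field (F : finFieldType) : prime l -> (l %| #|F|.-1)%N ->
  exists w : F, principal_root w.
Proof.
move=> lpr; rewrite -card_finField_unit => /(Cauchy lpr)[x _ xl].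
exists (FinRing.uval x); split; first by rewrite -FinRing.val_unitX -xl expg_order.
move=> k /andP[k0 kl]; rewrite unitfE subr_eq0 -FinRing.val_unitX.
rewrite (_ : 1 = FinRing.uval (1%g : {unit F})) // (inj_eq val_inj) -order_dvdn xl.
by rewrite gtnNdvd.
Qed.

(** Cauchy's theorem gives a unit of order [l].  A power of it congruent to [1]
    modulo [p] would have an order that is a power of [p], by
    [expr_1Dp_iter], whereas [l] is prime and smaller than [p]. *)
Lemma principal_root_Zp p K : prime l -> prime p -> (l %| p.-1)%N -> (0 < K)%N ->
  exists w : 'Z_(p ^ K), principal_root w.
Proof.
move=> lpr ppr lp K0; set q := (p ^ K)%N.
have q1 : (1 < q)%N by rewrite -(expn0 p) ltn_exp2l ?prime_gt1.
have lG : (l %| #|units_Zp q|)%N.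
  by rewrite card_units_Zp ?expn_gt0 ?prime_gt0 // totient_pfactor // dvdn_mulr.
have [x _ xl] := Cauchy lpr lG.
exists (FinRing.uval x); split; first by rewrite -FinRing.val_unitX -xl expg_order.
move=> k /andP[k0 kl]; apply/negPn/negP => nu.
set u : 'Z_q := FinRing.uval x ^+ k - 1 in nu.
(* A non-unit modulo a power of [p] is divisible by [p]. *)
have pu : (p %| u)%N.
  move: nu; rewrite -(natr_Zp u) unitZpE // coprime_pexpl // prime_coprime //.
  by rewrite negbK natr_Zp.
have [y hy] : exists y, FinRing.uval x ^+ k = 1 + p%:R * y.
  exists ((u %/ p)%N%:R); rewrite -natrM mulnC divnK // natr_Zp /u; ring.
have [z hz] := expr_1Dp_iter p K.-1 y.
have : (x ^+ k ^+ (p ^ K.-1))%g = 1%g.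
  apply: val_inj; rewrite /= !FinRing.val_unitX hy hz prednK // -/q.
  by rewrite pchar_Zp // mul0r addr0.
move/eqP; rewrite -expgM -order_dvdn xl Euclid_dvdM // gtnNdvd //=.
rewrite Euclid_dvdX // => /andP[].
rewrite dvdn_prime2 // => /eqP e; move: lp; rewrite e gtnNdvd //.
  by have := prime_gt1 ppr; lia.
by rewrite prednK ?prime_gt0.
Qed.

(** One integer serves for all the moduli [p^k], so that divisibility by the
    successive powers of [p] concerns the same evaluation. *)
Lemma principal_root_int p K : prime l -> prime p -> (l %| p.-1)%N -> (0 < K)%N ->
  exists w : int, forall k, (0 < k <= K)%N -> principal_root (w%:~R : 'Z_(p ^ k)).
Proof.
move=> lpr ppr lp K0; have [w [w1 wu]] := principal_root_Zp lpr ppr lp K0.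
exists (w : nat)%:Z => k /andP[k0 kK].
have q1 j : (0 < j)%N -> (1 < p ^ j)%N by move=> j0; rewrite -(expn0 p) ltn_exp2l ?prime_gt1.
have eqK (j a b : nat) : (0 < j)%N -> (a%:R == b%:R :> 'Z_(p ^ j)) = (a == b %[mod p ^ j]).
  by move=> j0; rewrite -val_eqE /= !val_Zp_nat ?q1.
have wn : w = (w : nat)%:R by rewrite natr_Zp.
split.
  have -> : (((w : nat)%:Z)%:~R : 'Z_(p ^ k)) ^+ l = (w ^ l)%N%:R by rewrite natrX pmulrn.
  apply/eqP; rewrite (eqK k (w ^ l)%N 1%N k0).
  have /eqP h : w ^ l == 1 %[mod p ^ K] by rewrite -eqK // natrX -wn w1.
  rewrite -(modn_dvdm (w ^ l) (dvdn_exp2l p kK)) h modn_dvdm //.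
  exact: dvdn_exp2l.
move=> i hi; have := wu i hi.
have w0 : (0 < w)%N.
  rewrite lt0n; apply/negP => /eqP w0; move: w1; rewrite wn w0 expr0n /=.
  by move=> /esym/eqP; rewrite oner_eq0.
have un (j : nat) : (0 < j)%N -> ((w : nat)%:R ^+ i - 1 : 'Z_(p ^ j)) \is a GRing.unit = ~~ (p %| w ^ i - 1)%N.
  move=> j0; rewrite -(natrX _ w i) -[X in _ - X]/(1%:R) -natrB ?expn_gt0 ?w0 // unitZpE ?q1 //.
  by rewrite coprime_pexpl // prime_coprime.
by rewrite {1}wn un // => h; rewrite -pmulrn (un k).
Qed.

(** The complex evaluation points are primitive roots of unity, whose minimal
    polynomial has degree [n]; a nonzero vector of length [n] cannot vanish
    there. *)
Lemma cyclo_norm_neq0 (a : 'rV[int]_n) : prime l -> a != 0 -> cyclo_norm a != 0.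
Proof.
move=> lpr; apply: contraNneq => N0.
have [z [zp hz _]] := principal_root_algC.
have : \prod_(j < n) zeta_eval (z ^+ j.+1) a == 0 by rewrite -cyclo_norm_principal // N0.
rewrite prodf_seq_eq0 => /hasP[j _ /=]; set y := z ^+ j.+1 => ey.
have yp : l.-primitive_root y.
  rewrite prim_root_exp_coprime // coprime_sym prime_coprime //.
  by rewrite gtnNdvd // ltnS ltn_ord.
pose p : {poly rat} := \poly_(i < n) (a 0 (inord i))%:~R.
have pj (k : 'I_n) : p`_k = (a 0 k)%:~R by rewrite coef_poly ltn_ord inord_val.
have rp : root (map_poly ratr p) y.
  rewrite /root (@horner_coef_wide _ n) ?size_map_poly ?size_poly //.
  apply/eqP; rewrite -[RHS](eqP ey); apply: eq_bigr => k _.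
  by rewrite coef_map /= pj ratr_int.
have [q [qe qm qd]] := minCpolyP y.
have sq : size q = n.+1.
  have := minCpoly_cyclotomic yp; rewrite qe => /(congr1 (size : {poly _} -> nat)).
  by rewrite size_map_poly size_cyclotomic totient_prime.
move: rp; rewrite qd => qp.
have p0 : p = 0.
  apply/eqP/contraT => p0; have := dvdp_leq p0 qp.
  by rewrite sq leqNgt ltnS size_poly.
apply/eqP/rowP => k; apply/eqP; rewrite mxE -(intr_eq0 rat).
by rewrite -pj p0 coef0.
Qed.

End PrincipalRoots.

(** * Points of an ideal in a box *)

Section Ideals.
Variable m : nat.
Local Notation n := m.+1.

Lemma card_row_box (U : finType) (f : U -> 'rV[int]_n) (lo : 'I_n -> int) Y :
  injective f -> (forall u i, lo i <= f u 0 i < lo i + Y%:Z) -> (#|U| <= Y ^ n)%N.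
Proof.
move=> finj fb.
have [u0|U0] := posnP #|U|; first by rewrite u0.
have Y0 : (0 < Y)%N.
  by move/card_gt0P : U0 => [u _]; have := fb u ord0; lia.
pose g u : {ffun 'I_n -> 'I_Y.-1.+1} := [ffun i => inord `|(f u 0 i - lo i)%R|%N].
have ginj : injective g.
  move=> u v /ffunP e; apply: finj; apply/rowP => i.
  have := e i; rewrite !ffunE => /(congr1 val) /=.
  have := fb u i; have := fb v i => hv hu.
  rewrite !inordK; lia.
by have := leq_card g ginj; rewrite card_ffun !card_ord prednK.
Qed.

(** Division with remainder by [c]: writing [b = q c + r / N * c] with
    [N] the norm of [c] and the coordinates of [r] between [0] and [N], the
    remainder term has the size of [c]. *)
Lemma short_coset_rep (S : comNzRingType) (w : S) (c : 'rV[int]_n) A :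
  phi_root m w -> zeta_eval w c = 0 -> cyclo_norm c != 0 -> (forall k, (`|c 0%R k| <= A)%N) ->
  forall b : 'rV[int]_n, exists2 b' : 'rV[int]_n, zeta_eval w b' = zeta_eval w b &
     forall k, (`|b' 0%R k| <= n * (regular_mx_const m * A))%N.
Proof.
move=> hw c0 N0 cA b.
pose N := cyclo_norm c; pose e := b *m \adj (regular_mx c).
pose q : 'rV[int]_n := \row_i ((e ord0 i) %/ N)%Z.
pose r : 'rV[int]_n := \row_i ((e ord0 i) %% N)%Z.
exists (b - q *m regular_mx c); first by rewrite zeta_evalB zeta_evalM // c0 mulr0 subr0.
move=> k.
(* The adjugate times the matrix is [N], so [e] is [N] times the quotient of [b] by [c]. *)
have eqr : N *: (b - q *m regular_mx c) = r *m regular_mx c.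
  rewrite scalerBr; apply/eqP; rewrite subr_eq; apply/eqP.
  rewrite scalemxAl -mulmxDl.
  have -> : r + N *: q = e.
    by apply/rowP => i; rewrite !mxE addrC mulrC -divz_eq.
  by rewrite /e -mulmxA mul_adj_mx -scalemx1 -scalemxAr mulmx1.
have /rowP/(_ k) := eqr; rewrite [LHS]mxE => /(congr1 absz); rewrite abszM => E.
have Npos : (0 < `|N|)%N by rewrite absz_gt0.
rewrite -(leq_pmul2l Npos) E mxE.
apply: (leq_trans (absz_sum_le _)).
apply: (@leq_trans (\sum_(j < n) (`|N| * (regular_mx_const m * A)))%N).
  apply: leq_sum => j _; rewrite abszM; apply: leq_mul; last exact: regular_mx_bound.
  rewrite mxE. have := ltz_mod (e 0 j) N0; have := modz_ge0 (e 0 j) N0; lia.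
by rewrite sum_nat_const card_ord mulnCA.
Qed.

(** The first coordinate is shifted by [l X] so that it dominates the others and
    all conjugates of the element have size about [X]. *)
Definition box_elt X (u : 'I_X * {ffun 'I_m -> 'I_X}) : 'rV[int]_n :=
  \row_i (if unlift ord0 i is Some j then (u.2 j)%:Z else (u.1 + m.+2 * X)%:Z).

Lemma box_elt_inj X : injective (box_elt (X := X)).
Proof.
move=> [t v] [t' v'] /rowP e; congr pair.
  by have := e ord0; rewrite !mxE unlift_none /=; move=> [] /eqP; rewrite eqn_add2r => /eqP/val_inj.
apply/ffunP => j; have := e (lift ord0 j); rewrite !mxE liftK /=.
by move=> [] /val_inj.
Qed.

Definition box_corner X (i : 'I_n) : int := if unlift ord0 i is Some j then 0 else (m.+2 * X)%:Z.

Lemma box_elt_bounds X (u : 'I_X * {ffun 'I_m -> 'I_X}) (i : 'I_n) : box_corner X i <= box_elt u 0 i < box_corner X i + X%:Z.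
Proof.
rewrite /box_corner mxE; case: (unlift ord0 i) => [j|].
  by have := ltn_ord (u.2 j); lia.
by have := ltn_ord u.1; lia.
Qed.

Lemma box_elt_neq0 X (u : 'I_X * {ffun 'I_m -> 'I_X}) : (0 < X)%N -> box_elt u != 0.
Proof.
move=> X0; apply/eqP => /rowP/(_ ord0); rewrite !mxE unlift_none; lia.
Qed.

Section Kernel.
Hypothesis lpr : prime m.+2.
Variables (S : finComNzRingType) (w : S) (I : {set S}).
Hypothesis hw : phi_root m w.
Hypothesis hI1 : forall a : 'rV[int]_n, zeta_eval w a \in I.
Hypothesis hI2 : forall s, s \in I -> exists a : 'rV[int]_n, zeta_eval w a = s.

Lemma short_coset_reps (c : 'rV[int]_n) A : c != 0 -> zeta_eval w c = 0 ->
  (forall k, (`|c 0%R k| <= A)%N) ->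
  exists rep : {x | x \in I} -> 'rV[int]_n, forall s,
    zeta_eval w (rep s) = val s /\ forall k, (`|rep s 0%R k| <= n * (regular_mx_const m * A))%N.
Proof.
move=> c0 ec cA.
have H (s : {x | x \in I}) : exists b : 'rV[int]_n, (zeta_eval w b == val s) &&
    [forall k, (`|b 0%R k| <= n * (regular_mx_const m * A))%N].
  have [b hb] := hI2 (valP s).
  have [b' e h] := short_coset_rep hw ec (cyclo_norm_neq0 lpr c0) cA b.
  by exists b'; rewrite e hb eqxx /=; apply/forallP.
exists (fun s => xchoose (H s)) => s.
by have /andP[/eqP e /forallP h] := xchooseP (H s).
Qed.

(** The short coset representatives are pairwise distinct vectors in a cube, so
    an ideal with a short element has small index. *)
Lemma index_le (c : 'rV[int]_n) A : c != 0 -> zeta_eval w c = 0 ->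
  (forall k, (`|c 0%R k| <= A)%N) -> (#|I| <= (2 * (n * (regular_mx_const m * A)) + 1) ^ n)%N.
Proof.
move=> c0 ec cA; have [rep hrep] := short_coset_reps c0 ec cA.
set B := (n * (regular_mx_const m * A))%N in hrep *.
have := @card_row_box _ rep (fun=> - B%:Z) (2 * B + 1)%N.
rewrite card_sig; apply.
  by move=> s t e; apply: val_inj; rewrite -(hrep s).1 -(hrep t).1 e.
by move=> s i; have := (hrep s).2 i; lia.
Qed.

(** Minkowski's argument by pigeonhole: two vectors of a cube have the same value. *)
Lemma short_kernel_elt r : (#|I| < r ^ n)%N ->
  exists c : 'rV[int]_n, [/\ c != 0, zeta_eval w c = 0 & forall k, (`|c 0%R k| <= r)%N].
Proof.
move=> Ir; pose g (u : {ffun 'I_n -> 'I_r}) : 'rV[int]_n := \row_i (u i)%:Z.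
pose f (u : {ffun 'I_n -> 'I_r}) := zeta_eval w (g u).
have : ~~ injectiveb f.
  apply/negP => /injectiveP finj.
  have : (#|{ffun 'I_n -> 'I_r}| <= #|I|)%N.
    rewrite -(card_codom finj); apply: subset_leq_card.
    by apply/subsetP => x /codomP[u ->]; exact: hI1.
  by rewrite card_ffun !card_ord leqNgt Ir.
move/injectivePn => [u [v uv e]].
exists (g u - g v); split.
- apply: contra uv; rewrite subr_eq0 => /eqP/rowP h; apply/eqP/ffunP => i.
  by have := h i; rewrite !mxE => -[] /val_inj.
- by rewrite zeta_evalB -/(f u) -/(f v) e subrr.
- move=> k; rewrite !mxE; have := ltn_ord (u k); have := ltn_ord (v k).
  by move: (u k) (v k) => [a ?] [b ?] /=; lia.
Qed.

(** Adding the short representatives of the [#|I|] cosets to the points of the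
    ideal in the box gives distinct points of a slightly larger box.  The
    constant of the main term [X ^ n] is therefore exactly [1]. *)
Lemma kernel_count r X : (#|I| < r ^ n)%N ->
  (#|[set u : 'I_X * {ffun 'I_m -> 'I_X} | zeta_eval w (box_elt u) == 0%R]| * #|I|
    <= (X + 2 * (n * (regular_mx_const m * r))) ^ n)%N.
Proof.
move=> /short_kernel_elt [c [c0 ec cr]].
have [rep hrep] := short_coset_reps c0 ec cr.
set B := (n * (regular_mx_const m * r))%N in hrep *.
set L := [set u | _].
have := @card_row_box {: {x | x \in L} * {x | x \in I}}
  (fun z => box_elt (val z.1) + rep z.2) (fun i => box_corner X i - B%:Z) (X + 2 * B)%N.
rewrite card_prod !card_sig; apply.
  move=> [u s] [u' s'] /= e.
  have := congr1 (zeta_eval w) e; rewrite !zeta_evalD (hrep s).1 (hrep s').1.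
  have := valP u; have := valP u'; rewrite /= !inE => /eqP-> /eqP->.
  rewrite !add0r => /val_inj es; subst s'.
  by congr pair; move: e => /addIr /box_elt_inj /val_inj.
move=> [u s] i /=; have := (hrep s).2 i; have := box_elt_bounds (val u) i.
have -> : (box_elt (sval u) + rep s) 0 i = box_elt (sval u) 0 i + rep s 0 i by rewrite mxE.
by move: (box_elt (sval u) 0 i) (rep s 0 i) => x y; lia.
Qed.

End Kernel.
End Ideals.

(** * Valuations of norms on a box *)

Lemma sum_leq_min K L : (\sum_(1 <= k < K.+1) (k <= L) = minn K L)%N.
Proof.
elim: K => [|K IH]; first by rewrite big_nil min0n.
by rewrite big_nat_recr //= IH; case: leqP => h; rewrite /=; lia.
Qed.

Lemma logn_sum p K x : prime p -> (0 < x)%N -> (logn p x <= K)%N ->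
  logn p x = (\sum_(1 <= k < K.+1) (p ^ k %| x))%N.
Proof.
move=> pp x0 xK; rewrite (eq_bigr (fun k => (k <= logn p x)%N : nat)).
  by rewrite sum_leq_min; apply/esym/minn_idPr.
by move=> k _; rewrite pfactor_dvdn.
Qed.

Lemma logn_prod (T : finType) (F : T -> nat) p : (forall i, 0 < F i)%N ->
  logn p (\prod_i F i) = (\sum_i logn p (F i))%N.
Proof.
move=> F0.
suff [] : (logn p (\prod_i F i) = \sum_i logn p (F i))%N /\ (0 < \prod_i F i)%N by [].
elim/big_rec2: _ => [|i a b _ [<- b0]]; first by rewrite logn1.
by rewrite lognM // muln_gt0 F0 b0.
Qed.

Section BoxCounts.
Variable m : nat.
Local Notation n := m.+1.
Local Notation l := m.+2.
Local Notation box X := ('I_X * {ffun 'I_m -> 'I_X})%type.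
Hypothesis lpr : prime l.

Definition index_const : nat := 2 * (n * (regular_mx_const m * m.+3)) + 1.

Definition ideal_const : nat := 1 + 2 * (n * (regular_mx_const m * index_const.+1)).

Lemma card_box X : #|{: box X}| = (X ^ n)%N.
Proof. by rewrite card_prod card_ffun !card_ord expnS. Qed.

Lemma box_elt_le X (u : box X) k : (`|box_elt u 0%R k| <= m.+3 * X)%N.
Proof.
have := box_elt_bounds u k; rewrite /box_corner; case: (unlift _ _) => [j|]; lia.
Qed.

Section KernelBox.
Variables (S : finComNzRingType) (w : S) (I : {set S}).
Hypothesis hw : phi_root m w.
Hypothesis hI1 : forall a : 'rV[int]_n, zeta_eval w a \in I.
Hypothesis hI2 : forall s, s \in I -> exists a : 'rV[int]_n, zeta_eval w a = s.

Lemma box_index_le X (u : box X) : (0 < X)%N -> zeta_eval w (box_elt u) = 0 ->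
  (#|I| <= (index_const * X) ^ n)%N.
Proof.
move=> X0 e; apply: leq_trans (index_le lpr hw hI2 (box_elt_neq0 u X0) e (box_elt_le u)) _.
rewrite leq_exp2r // /index_const; move: (regular_mx_const m) => z; nia.
Qed.

(** Either no point of the box lies in the ideal, or the index is so small that
    [kernel_count] applies with [r] of order [X]. *)
Lemma box_kernel_count X : (0 < X)%N ->
  (#|[set u : box X | zeta_eval w (box_elt u) == 0%R]| * #|I| <= (ideal_const * X) ^ n)%N.
Proof.
move=> X0; have [->|] := set_0Vmem [set u : box X | zeta_eval w (box_elt u) == 0].
  by rewrite cards0.
move=> [u]; rewrite inE => /eqP /(box_index_le X0) hI.
have Ir : (#|I| < (index_const * X).+1 ^ n)%N by apply: leq_ltn_trans hI _; rewrite ltn_exp2r.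
apply: leq_trans (kernel_count lpr hw hI1 hI2 X Ir) _.
rewrite leq_exp2r // /ideal_const; move: (regular_mx_const m) index_const => z c; nia.
Qed.

End KernelBox.

Lemma zeta_eval_intr (S : comNzRingType) (w : int) (a : 'rV[int]_n) :
  (zeta_eval w a)%:~R = zeta_eval (w%:~R : S) a.
Proof.
rewrite /zeta_eval rmorph_sum /=; apply: eq_bigr => i _.
by rewrite rmorphM rmorphXn /= intz.
Qed.

Lemma Zp_intr0 q (x : int) : (1 < q)%N -> ((x%:~R : 'Z_q) == 0) = (q %| `|x|)%N.
Proof.
move=> q1; have aux (k : nat) : ((k%:R : 'Z_q) == 0) = (q %| k)%N.
  by rewrite -val_eqE /= val_Zp_nat.
case: (intP x) => [|k|k]; first by rewrite mulr0z eqxx dvdn0.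
  by rewrite -pmulrn aux.
by rewrite mulrNz oppr_eq0 -pmulrn aux abszN.
Qed.

(** Modulo [p^K] the norm is the product of the [n] evaluations at the powers of
    a principal root of unity, and [p^K] exceeds every power of [p] that
    divides a norm, so the valuation of the norm is the sum of those of the
    evaluations.  [cnt j k] counts the points whose [j]-th evaluation is
    divisible by [p^k]; these form an ideal of index [p^k]. *)
Lemma split_count p K X : prime p -> (l %| p.-1)%N -> (0 < X)%N ->
  (forall u : box X, (logn p `|cyclo_norm (box_elt u)| < K)%N) ->
  exists cnt : 'I_n -> nat -> nat,
   [/\ (\sum_(u : box X) logn p `|cyclo_norm (box_elt u)| <= \sum_(j < n) \sum_(1 <= k < K.+1) cnt j k)%N,
   (forall j k, (0 < k <= K)%N -> (cnt j k * p ^ k <= (ideal_const * X) ^ n)%N) &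
   (forall j k r, (0 < k <= K)%N -> (p ^ k < r ^ n)%N ->
      (cnt j k * p ^ k <= (X + 2 * (n * (regular_mx_const m * r))) ^ n)%N)].
Proof.
move=> pp lp X0 vK.
have K0 : (0 < K)%N.
  by apply: leq_ltn_trans (vK (Ordinal X0, [ffun=> Ordinal X0])).
have [w hw] := principal_root_int lpr pp lp K0.
have q1 j : (0 < j)%N -> (1 < p ^ j)%N by move=> j0; rewrite -(expn0 p) ltn_exp2l ?prime_gt1.
pose E (j : 'I_n) (u : box X) : nat := `|(zeta_eval (w ^+ j.+1) (box_elt u))%R|%N.
pose cnt (j : 'I_n) k := #|[set u : box X | (p ^ k %| E j u)%N]|.
have cntE j k : (0 < k <= K)%N ->
    cnt j k = #|[set u : box X | zeta_eval ((w%:~R : 'Z_(p ^ k)) ^+ j.+1) (box_elt u) == 0]|.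
  move=> /[dup] hk /andP[k0 _]; apply: eq_card => u; rewrite !inE.
  by rewrite -rmorphXn -zeta_eval_intr Zp_intr0 ?q1.
have geo (j : 'I_n) k : (0 < k <= K)%N -> phi_root m ((w%:~R : 'Z_(p ^ k)) ^+ j.+1).
  by move=> hk; exact: principal_root_phi (hw k hk) j.
have hI1 k (x : 'Z_(p ^ k)) (a : 'rV[int]_n) : zeta_eval x a \in [set: 'Z_(p ^ k)] by rewrite inE.
(* Evaluation is onto already on the constants, so the kernel has index [p ^ k]. *)
have hI2 k (x s : 'Z_(p ^ k)) : s \in [set: 'Z_(p ^ k)] -> exists a : 'rV[int]_n, zeta_eval x a = s.
  move=> _; exists (\row_i (if i == ord0 then (s : nat)%:Z else 0)).
  rewrite /zeta_eval big_ord_recl /= big1 ?addr0 => [|i _]; last by rewrite mxE mul0r.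
  by rewrite mxE eqxx mulr1 -pmulrn natr_Zp.
have cI k : (0 < k)%N -> #|[set: 'Z_(p ^ k)]| = (p ^ k)%N.
  by move=> k0; rewrite cardsT card_ord Zp_cast ?q1.
exists cnt; split.
- have pt (u : box X) : logn p `|cyclo_norm (box_elt u)| =
     (\sum_(j < n) \sum_(1 <= k < K.+1) (p ^ k %| E j u))%N.
    have N0 : (0 < `|cyclo_norm (box_elt u)|)%N by rewrite absz_gt0 cyclo_norm_neq0 // box_elt_neq0.
    pose P := (\prod_(j < n) E j u)%N.
    have PE : P = `|(\prod_(j < n) zeta_eval (w ^+ j.+1) (box_elt u))%R|%N.
      by rewrite /P; elim/big_rec2: _ => // j a b _ ->; rewrite abszM.
    have dv k : (k <= K)%N -> (p ^ k %| `|cyclo_norm (box_elt u)|)%N = (p ^ k %| P)%N.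
      case: k => [|k] kK; first by rewrite !dvd1n.
      rewrite PE -!Zp_intr0 ?q1 // (cyclo_norm_principal _ (hw k.+1 kK)) rmorph_prod /=.
      congr (_ == 0); apply: eq_bigr => j _.
      by rewrite zeta_eval_intr rmorphXn.
    have P0 : (0 < P)%N.
      rewrite lt0n; apply/eqP => P0; have := dv K (leqnn K).
      by rewrite P0 dvdn0 pfactor_dvdn // leqNgt vK.
    (* [P] and the norm agree modulo [p ^ K] only, hence the appeal to [vK]. *)
    have lP : logn p P = logn p `|cyclo_norm (box_elt u)|.
      apply/eqP; rewrite eqn_leq -!pfactor_dvdn //; apply/andP; split; last first.
        by rewrite -dv ?pfactor_dvdn // ltnW.
      have [lPK|KP] := leqP (logn p P) K; first by rewrite dv ?pfactor_dvdn.
      have : (p ^ K %| P)%N by rewrite pfactor_dvdn // ltnW.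
      by rewrite -dv // pfactor_dvdn // leqNgt vK.
    have Ej0 j : (0 < E j u)%N.
      rewrite lt0n; apply: contraTneq P0 => e.
      by rewrite /P (bigD1 j) //= e mul0n.
    rewrite -lP /P logn_prod //; apply: eq_bigr => j _.
    apply: logn_sum => //; apply: leq_trans (ltnW (vK u)); rewrite -lP.
    by apply: dvdn_leq_log => //; rewrite /P (bigD1 j) //= dvdn_mulr.
  rewrite (eq_bigr _ (fun u _ => pt u)) exchange_big /=; apply: leq_sum => j _.
  rewrite exchange_big /=; apply: leq_sum => k _.
  by rewrite /cnt -sum1dep_card [X in (_ <= X)%N]big_mkcond; apply: leq_sum => u _; case: ifP.
- move=> j k hk; rewrite cntE //.
  have := box_kernel_count (geo j k hk) (hI1 k _) (@hI2 k _) X0.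
  by rewrite (cI k (andP hk).1).
- move=> j k r hk hr; rewrite cntE //.
  have := @kernel_count m lpr _ _ _ (geo j k hk) (hI1 k _) (@hI2 k _) r X.
  by rewrite (cI k (andP hk).1) => /(_ hr).
Qed.

End BoxCounts.

Section NonsplitCounts.
Variable m : nat.
Local Notation n := m.+1.
Local Notation l := m.+2.
Local Notation box X := ('I_X * {ffun 'I_m -> 'I_X})%type.
Hypothesis lpr : prime l.

(** An equality [a + b x = a' + b' x] with [b] different from [b'] puts [x] in
    the prime field, hence [x ^ (p - 1) = 1]; as [x] has prime order [l], this
    forces [p = 1] modulo [l]. *)
Lemma not_in_prime_field (F : finFieldType) p (x : F) (a b a' b' : nat) :
  p \in [pchar F] -> (p %% l != 1)%N -> x ^+ l = 1 -> x - 1 \is a GRing.unit ->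
  a%:R + b%:R * x = a'%:R + b'%:R * x -> b%:R = b'%:R :> F.
Proof.
move=> pF pl xl; rewrite unitfE subr_eq0 => x1 e; have pp := pcharf_prime pF.
apply/eqP; rewrite -subr_eq0; apply: contraNT x1 => bn0.
have frob (c : nat) : (c%:R : F) ^+ p = c%:R.
  by rewrite -(pFrobenius_autE pF) rmorph_nat.
have xp : x ^+ p = x.
  apply: (mulfI bn0); have e2 : (b%:R - b'%:R) * x = a'%:R - a%:R.
    transitivity (a%:R + b%:R * x - a%:R - b'%:R * x); first by ring.
    by rewrite e; ring.
  have : ((b%:R - b'%:R) * x) ^+ p = (a'%:R - a%:R) ^+ p by rewrite e2.
  by rewrite exprMn -!(pFrobenius_autE pF) !rmorphB !rmorph_nat /= e2.
have xu : x != 0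
  by apply/eqP => x0; move/eqP: xl; rewrite x0 expr0n eq_sym oner_eq0.
have xp1 : x ^+ p.-1 = 1.
  by apply: (mulfI xu); rewrite mulr1 -exprS prednK ?prime_gt0.
have cop : coprime p.-1 l.
  rewrite coprime_sym prime_coprime //; apply: contra pl => /dvdnP[k pk].
  by rewrite -(prednK (prime_gt0 pp)) pk -addn1 modnMDl modn_small.
have p10 : (0 < p.-1)%N by have := prime_gt1 pp; lia.
have [[u v] /= uv] := coprimeP l p10 cop.
have : x ^+ (u * p.-1) = x ^+ (v * l).+1.
  by congr (x ^+ _); lia.
by rewrite mulnC exprM xp1 expr1n exprS mulnC exprM xl expr1n mulr1 eq_sym => <-.
Qed.

Definition inert_const : nat := n * ideal_const m ^ n + l ^ 2.

(** Over the field with [p ^ n] elements the norm is a product of evaluations at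
    roots of unity which are outside the prime field, so each evaluation takes
    at least [p ^ 2] values.  The remaining prime [p = l] is absorbed by the
    constant. *)
Lemma nonsplit_count p X : prime p -> (p %% l != 1)%N -> (0 < X)%N ->
  (#|[set u : box X | (p %| `|cyclo_norm (box_elt u)|)%N]| * p ^ 2 <= inert_const * X ^ n)%N.
Proof.
move=> pp pl X0; set D := [set u | _].
have [pe|npl] := eqVneq p l.
  rewrite pe [X in (X <= _)%N]mulnC /inert_const mulnDl; apply: leq_trans (leq_addl _ _).
  by apply: leq_mul => //; apply: leq_trans (max_card _) _; rewrite card_box.
(* By Fermat, [l] divides [p ^ n - 1], so this field has the [l]-th roots of unity. *)
have [F pF cF] := pPrimePowerField pp (isT : (0 < n)%N).
have lF : (l %| #|F|.-1)%N.
  rewrite cF -subn1 -eqn_mod_dvd ?expn_gt0 ?prime_gt0 //; apply/eqP.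
  have := Euler_exp_totient (a := p) (n := l); rewrite totient_prime //.
  apply; rewrite prime_coprime // dvdn_prime2 //; exact/eqP.
have [w hw] := principal_root_field lpr lF.
pose g (v : {ffun 'I_n -> 'I_p}) : 'rV[int]_n := \row_i (v i)%:Z.
pose I (j : 'I_n) : {set F} := [set zeta_eval (w ^+ j.+1) (g v) | v in {: {ffun 'I_n -> 'I_p}}].
have hI1 (j : 'I_n) (a : 'rV[int]_n) : zeta_eval (w ^+ j.+1) a \in I j.
  have p0 : p%:R = 0 :> F by rewrite pcharf0.
  have hv i : (`|(a ord0 i %% p)%Z| < p)%N.
    by have := @ltz_pmod (a ord0 i) p (prime_gt0 pp);
       have := modz_ge0 (a ord0 i) (lt0r_neq0 (prime_gt0 pp : 0 < p%:Z)); lia.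
  apply/imsetP; exists [ffun i => Ordinal (hv i)] => //.
  apply: eq_bigr => i _; rewrite !mxE ffunE /=; congr (_ * _).
  rewrite gez0_abs ?modz_ge0 // ?lt0r_neq0 //; last exact: prime_gt0.
  by rewrite {1}(divz_eq (a 0 i) p) rmorphD rmorphM /= -pmulrn p0 mulr0 add0r.
have hI2 (j : 'I_n) s : s \in I j -> exists a : 'rV[int]_n, zeta_eval (w ^+ j.+1) a = s.
  by move=> /imsetP[v _ ->]; exists (g v).
(* For [l = 2] every odd prime is [1] modulo [l], so [l] is odd here. *)
have m0 : (0 < m)%N.
  case: (m) lpr pl npl => // _; case: (even_prime pp) => [->//|]; rewrite modn2 => ->//.
(* The values [a + b x] with [a], [b] below [p] are already [p ^ 2] in number. *)
have cI (j : 'I_n) : (p ^ 2 <= #|I j|)%N.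
  pose f (z : 'I_p * 'I_p) := (z.1%:R + z.2%:R * w ^+ j.+1 : F).
  have xl : (w ^+ j.+1) ^+ l = 1 by rewrite exprAC (proj1 hw) expr1n.
  have xu : w ^+ j.+1 - 1 \is a GRing.unit by apply: (proj2 hw); rewrite /= ltnS ltn_ord.
  have natI (a b : 'I_p) : a%:R = b%:R :> F -> a = b.
    have lt (c d : 'I_p) : (c < d)%N -> c%:R = d%:R :> F -> False.
      move=> cd /eqP; rewrite eq_sym -subr_eq0 -natrB ?(ltnW cd) // -(dvdn_pcharf pF).
      by move/dvdn_leq => h; have := ltn_ord d; lia.
    case: (ltngtP a b) => [h e|h e|/val_inj //]; first by case: (lt _ _ h e).
    by case: (lt _ _ h (esym e)).
  have finj : injective f.
    move=> [a b] [a' b'] /= e.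
    have eb := not_in_prime_field pF pl xl xu e.
    move: e; rewrite /f /= eb => /addIr /natI /= ->.
    by congr pair; exact: natI eb.
  have <- : #|{: 'I_p * 'I_p}| = (p ^ 2)%N by rewrite card_prod card_ord.
  rewrite -(card_codom finj); apply: subset_leq_card; apply/subsetP => x /codomP[[a b] ->].
  pose i1 : 'I_n := Ordinal (m0 : (1 < n)%N).
  pose v : 'rV[int]_n := \row_i (if i == ord0 then (a : nat)%:Z else if i == i1 then (b : nat)%:Z else 0).
  suff -> : f (a, b) = zeta_eval (w ^+ j.+1) v by [].
  rewrite /zeta_eval (bigD1 ord0) //= (bigD1 i1) //= big1 ?addr0; last first.
    by move=> i /andP[/negPf h0 /negPf h1]; rewrite mxE h0 h1 mul0r.
  by rewrite !mxE /= -!pmulrn mulr1.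
have sub : (#|D| <= \sum_(j < n) #|[set u : box X | zeta_eval (w ^+ j.+1) (box_elt u) == 0%R]|)%N.
  have DE (u : box X) : (u \in D) = [exists j : 'I_n, zeta_eval (w ^+ j.+1) (box_elt u) == 0].
    rewrite inE; transitivity ((cyclo_norm (box_elt u))%:~R == 0 :> F).
      case: (intP (cyclo_norm (box_elt u))) => [|k|k]; first by rewrite dvdn0 eqxx.
        by rewrite -pmulrn -(dvdn_pcharf pF).
      by rewrite mulrNz oppr_eq0 -pmulrn abszN -(dvdn_pcharf pF).
    rewrite (cyclo_norm_principal _ hw); apply/idP/existsP => [|[j hj]].
      by rewrite prodf_seq_eq0 => /hasP[j _ hj]; exists j.
    by rewrite (bigD1 j) //= (eqP hj) mul0r.
  rewrite -sum1_card big_mkcond /=.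
  rewrite [X in (_ <= X)%N](eq_bigr (fun j : 'I_n => \sum_(u : box X)
    ((zeta_eval (w ^+ j.+1) (box_elt u) == 0)%R : nat))%N); last first.
    by move=> j _; rewrite -sum1dep_card big_mkcond /=; apply: eq_bigr => u _; case: eqP.
  rewrite exchange_big /=.
  apply: leq_sum => u _; rewrite DE; case: existsP => // -[j hj].
  by rewrite (bigD1 j) //= hj.
apply: (@leq_trans (\sum_(j < n) (ideal_const m * X) ^ n)%N); last first.
  by rewrite sum_nat_const card_ord expnMn mulnA /inert_const mulnDl leq_addr.
apply: leq_trans (leq_mul sub (leqnn _)) _; rewrite big_distrl /=.
apply: leq_sum => j _.
apply: leq_trans (box_kernel_count lpr (principal_root_phi hw j) (hI1 j) (hI2 j) X0).
by rewrite leq_mul2l cI orbT.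
Qed.

End NonsplitCounts.

(** The [p]-adic valuation capped at [K]; unlike [logn], it is large, and not
    zero, at [0]. *)
Definition vtrunc p K (x : int) : nat := (\sum_(1 <= k < K.+1) (p ^ k %| `|x|))%N.

Lemma vtruncE p K x : prime p -> x != 0 -> vtrunc p K x = minn K (logn p `|x|).
Proof.
move=> pp x0; rewrite /vtrunc -sum_leq_min; apply: eq_bigr => k _.
by rewrite pfactor_dvdn // absz_gt0.
Qed.

Lemma vtrunc0 p K : vtrunc p K 0 = K.
Proof.
rewrite /vtrunc (eq_bigr (fun=> 1%N)) => [|k _]; last by rewrite dvdn0.
by rewrite sum_nat_const_nat muln1 subSS subn0.
Qed.

Lemma vtrunc_dvd p K x k : prime p -> (k <= K)%N -> (p ^ k %| `|x|)%N = (k <= vtrunc p K x)%N.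
Proof.
move=> pp kK; have [->|x0] := eqVneq x 0; first by rewrite vtrunc0 kK dvdn0.
by rewrite vtruncE // leq_min kK pfactor_dvdn // absz_gt0.
Qed.

Lemma vtruncM p K x y : prime p -> (vtrunc p K (x * y) <= vtrunc p K x + vtrunc p K y)%N.
Proof.
move=> pp; have [->|x0] := eqVneq x 0; first by rewrite mul0r vtrunc0 leq_addr.
have [->|y0] := eqVneq y 0; first by rewrite mulr0 vtrunc0 leq_addl.
rewrite !vtruncE ?mulf_neq0 // abszM lognM ?absz_gt0 //; lia.
Qed.

Lemma max_on_seq (T : eqType) (s : seq T) (F : T -> nat) : s != [::] ->
  exists2 x, x \in s & forall y, y \in s -> (F y <= F x)%N.
Proof.
elim: s => // x [|y s] IH _; first by exists x; rewrite ?inE // => z; rewrite inE => /eqP->.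
have [z zs hz] := IH isT; have [h|h] := leqP (F x) (F z).
  by exists z; rewrite ?inE ?(orbC (z == x)) -?in_cons ?zs // => t; rewrite inE => /orP[/eqP->//|/hz].
exists x; first by rewrite inE eqxx.
by move=> t; rewrite inE => /orP[/eqP->//|/hz h2]; exact: leq_trans h2 (ltnW h).
Qed.

(** A substitute for the [p]-adic factorization of [f]: the points of [T] at
    which [f] is [p]-adically smallest play the role of its roots.  If [t0] is
    the worst point then [f t - f t0 = (t - t0) g t] is at least as divisible
    as [f t], and induction applies to [g]. *)
Lemma vtrunc_poly p K (T : seq int) d (f : {poly int}) : prime p -> T != [::] ->
  f \is monic -> size f = d.+1 ->
  exists c : seq int, [/\ size c = d, {subset c <= T} &
    forall t, t \in T -> (vtrunc p K f.[t] <= \sum_(s <- c) vtrunc p K (t - s))%N].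
Proof.
move=> pp T0; elim: d f => [|d IH] f fm sf.
  exists [::]; split=> // t _; rewrite big_nil.
  move: fm; rewrite monicE lead_coefE sf /= => /eqP f1.
  have -> : f = 1 by rewrite [f]size1_polyC ?sf // f1.
  rewrite hornerC vtruncE // logn1 minn0 //.
have [t0 t0T ht0] := max_on_seq (fun t => vtrunc p K f.[t]) T0.
have [g hg] : exists g, f - f.[t0]%:P = g * ('X - t0%:P).
  by apply/factor_theorem; rewrite /root !hornerE subrr.
have sc : (size (- f.[t0]%:P)%R < size f)%N.
  by rewrite size_polyN sf (leq_ltn_trans (size_polyC_leq1 _)).
have gm : g \is monic.
  rewrite -(monicMr _ (monicXsubC t0)) -hg monicE lead_coefDl // -monicE //.
have sg : size g = d.+1.
  have := congr1 (size : {poly _} -> nat) hg.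
  by rewrite size_polyDl // sf size_Mmonic ?monicXsubC ?monic_neq0 // size_XsubC addn2 => -[].
have [c [szc cT hc]] := IH g gm sg.
exists (t0 :: c); split; first by rewrite /= szc.
  by move=> x; rewrite inE => /orP[/eqP->//|/cT].
move=> t tT; rewrite big_cons.
apply: (@leq_trans (vtrunc p K (f.[t] - f.[t0]))).
  set a := vtrunc p K f.[t].
  have aK : (a <= K)%N.
    rewrite /a /vtrunc; apply: (@leq_trans (\sum_(1 <= k < K.+1) 1)%N).
      by apply: leq_sum => k _; case: (_ %| _)%N.
    by rewrite sum_nat_const_nat muln1 subSS subn0.
  rewrite -vtrunc_dvd //.
  have h1 : (p ^ a %| `|f.[t]|)%N by rewrite (@vtrunc_dvd p K).
  have h2 : (p ^ a %| `|f.[t0]|)%N by rewrite (@vtrunc_dvd p K) // ht0.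
  have : ((p ^ a)%N%:Z %| f.[t] - f.[t0])%Z by rewrite rpredB.
  by [].
have -> : f.[t] - f.[t0] = (t - t0) * g.[t].
  by have /(congr1 (fun h : {poly int} => h.[t])) := hg; rewrite !hornerE mulrC.
by apply: leq_trans (vtruncM _ _ _ pp) _; rewrite leq_add2l hc.
Qed.

Lemma count_dvd_near X t0 q : (t0 < X)%N -> (0 < q)%N ->
  (\sum_(t < X | (t != t0 :> nat)) (q %| `|t%:Z - t0%:Z|) <= 2 * (X %/ q))%N.
Proof.
move=> tX q0.
rewrite -(big_mkord (fun t => t != t0) (fun t => (q %| `|t%:Z - t0%:Z|)%N : nat)).
rewrite (big_cat_nat (n := t0)) ?(ltnW tX) //= [X in (_ + X)%N]big_ltn_cond // eqxx /=.
rewrite mul2n -addnn; apply: leq_add.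
  apply: (@leq_trans (t0 %/ q)); last by rewrite leq_div2r // ltnW.
  rewrite divn_count_dvd big_add1 /= [X in (_ <= X)%N]big_nat_rev /= add0n.
  rewrite big_nat_cond [X in (_ <= X)%N]big_nat_cond.
  rewrite [X in (X <= _)%N](eq_bigl (fun i => (0 <= i < t0)%N && true)).
    apply: leq_sum => i /andP[/andP[_ it] _].
    rewrite (_ : `|i%:Z - t0%:Z|%N = (t0 - i.+1).+1)%N //; lia.
  by move=> i /=; case: ltnP => //= it; rewrite ?andbT; apply/eqP; lia.
apply: (@leq_trans ((X - t0.+1) %/ q)); last by rewrite leq_div2r // leq_subr.
rewrite divn_count_dvd [X in (_ <= X)%N]big_add1 /= -{1}(add0n t0.+1) big_addn.
rewrite big_mkcond /= big_nat [X in (_ <= X)%N]big_nat; apply: leq_sum => i _.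
case: ifP => // _.
by rewrite (_ : `|(i + t0.+1)%N%:Z - t0%:Z|%N = i.+1)%N //; lia.
Qed.

Lemma sum_div2 K Y : (\sum_(i < K) Y %/ 2 ^ i <= 2 * Y)%N.
Proof.
elim: K Y => [|K IH] Y; first by rewrite big_ord0.
rewrite big_ord_recl expn0 divn1.
apply: (@leq_trans (Y + 2 * (Y %/ 2))%N); last by lia.
rewrite leq_add2l; apply: leq_trans (IH _).
by apply: leq_sum => i _; rewrite -divnMA -expnS.
Qed.

(** One unit is subtracted from each valuation, so only divisibility by [p ^ 2]
    and higher powers counts. *)
Lemma sum_vtrunc_near p K X t0 : prime p -> (t0 < X)%N ->
  (\sum_(t < X) (vtrunc p K (t%:Z - t0%:Z) - 1) <= K + 4 * (X %/ p ^ 2))%N.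
Proof.
move=> pp tX; rewrite (bigD1 (Ordinal tX)) //= subrr vtrunc0.
apply: leq_add; first exact: leq_subr.
apply: (@leq_trans (\sum_(t < X | (t != t0 :> nat)) \sum_(i < K) (p ^ i.+2 %| `|t%:Z - t0%:Z|))%N).
  apply: leq_sum => t _; rewrite /vtrunc.
  case: K => [|K]; first by rewrite big_nil.
  rewrite big_add1 /= big_nat_recl // leq_subLR; apply: leq_add; first by case: (_ %| _)%N.
  by rewrite big_mkord big_ord_recr /= leq_addr.
rewrite exchange_big /=.
apply: (@leq_trans (\sum_(i < K) 2 * (X %/ p ^ 2 %/ 2 ^ i))%N).
  apply: leq_sum => i _; apply: leq_trans (count_dvd_near tX _) _; first by rewrite expn_gt0 prime_gt0.
  rewrite leq_mul2l /= -divnMA leq_div2l ?muln_gt0 ?expn_gt0 ?prime_gt0 //.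
  rewrite (_ : i.+2 = 2 + i)%N // expnD leq_mul //.
  by case: (i : nat) => // j; rewrite leq_exp2r ?prime_gt1.
rewrite -big_distrr /= -[4%N]/(2 * 2)%N -mulnA leq_mul2l /=; exact: sum_div2.
Qed.

Section NormOnBox.
Variable m : nat.
Local Notation n := m.+1.
Local Notation l := m.+2.
Local Notation box X := ('I_X * {ffun 'I_m -> 'I_X})%type.

(** The first coordinate adds a scalar matrix, so the norm is a characteristic
    polynomial in it. *)
Lemma cyclo_norm_poly X (v : {ffun 'I_m -> 'I_X}) : exists f : {poly int},
  [/\ f \is monic, size f = n.+1 & forall t : 'I_X, cyclo_norm (box_elt (t, v)) = f.[(t + l * X)%N%:Z]].
Proof.
pose a : 'rV[int]_n := \row_i (if unlift ord0 i is Some j then (v j)%:Z else 0).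
exists (char_poly (- regular_mx a)); split; rewrite ?char_poly_monic ?size_char_poly //.
move=> t; rewrite /cyclo_norm /char_poly -horner_evalE -det_map_mx /=; congr (\det _).
have -> : regular_mx (box_elt (t, v)) = (t + l * X)%N%:Z%:M + regular_mx a.
  rewrite /regular_mx !big_ord_recl /= !mxE unlift_none /= scale0r add0r.
  congr (_ + _); first by rewrite expr0 scalemx1.
  by apply: eq_bigr => i _; rewrite !mxE !liftK.
apply/matrixP => i j; rewrite !mxE /= /horner_eval !hornerE hornerMn hornerX.
by rewrite opprK.
Qed.

(** A valuation exceeding [n] is paid for by the [n] approximate roots of
    [vtrunc_poly]: the excess is at most the sum of the excesses over [1] of
    the valuations of the distances to these roots.  This gives convergence
    in [p] as soon as the number of norms divisible by [p] is
    [O(X^n / p^2)]. *)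
Lemma sum_logn_norm_le p K X : prime p -> (0 < X)%N -> prime l ->
  (forall u : box X, (logn p `|cyclo_norm (box_elt u)| <= K)%N) ->
  (\sum_(u : box X) logn p `|cyclo_norm (box_elt u)| <=
     n * #|[set u : box X | (p %| `|cyclo_norm (box_elt u)|)%N]|
     + X ^ m * (n * (K + 4 * (X %/ p ^ 2))))%N.
Proof.
move=> pp X0 lpr hK.
apply: (@leq_trans (\sum_(u : box X) (n * (p %| `|cyclo_norm (box_elt u)|)%N + (logn p `|cyclo_norm (box_elt u)| - n)))%N).
  apply: leq_sum => u _; have [d|nd] := boolP (p %| _)%N.
    by rewrite muln1; lia.
  by rewrite lognE (negPf nd) !andbF.
rewrite big_split /=; apply: leq_add.
  by rewrite -big_distrr leq_mul2l -sum1dep_card [X in (_ <= X)%N]big_mkcond /= leq_sum // => u _; case: (_ %| _)%N.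
rewrite -(pair_bigA _ (fun t v => (logn p `|cyclo_norm (box_elt (t, v))| - n)%N)) exchange_big /=.
apply: (@leq_trans (\sum_(v : {ffun 'I_m -> 'I_X}) n * (K + 4 * (X %/ p ^ 2)))%N); last first.
  by rewrite sum_nat_const card_ffun !card_ord.
apply: leq_sum => v _.
have [f [fm sf hf]] := cyclo_norm_poly v.
pose tau (t : nat) : int := (t + l * X)%N%:Z.
pose T : seq int := [seq tau t | t <- iota 0 X].
have T0 : T != [::] by rewrite -size_eq0 size_map size_iota -lt0n.
have [c [sc cT hc]] := vtrunc_poly K pp T0 fm sf.
apply: (@leq_trans (\sum_(t < X) \sum_(s <- c) (vtrunc p K (tau t - s) - 1))%N).
  apply: leq_sum => t _.
  have N0 : cyclo_norm (box_elt (t, v)) != 0 by rewrite cyclo_norm_neq0 // box_elt_neq0.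
  have -> : logn p `|cyclo_norm (box_elt (t, v))| = vtrunc p K f.[tau t].
    by rewrite -hf vtruncE //; apply/esym/minn_idPr.
  have tT : tau t \in T by apply: map_f; rewrite mem_iota /= add0n.
  apply: leq_trans (leq_sub2r _ (hc _ tT)) _; rewrite -sc leq_subLR.
  by rewrite -sum1_size -big_split /=; apply: leq_sum => s _; lia.
rewrite exchange_big /= -sc -sum1_size big_distrl /= big_seq [X in (_ <= X)%N]big_seq.
apply: leq_sum => s /cT /mapP[t0]; rewrite mem_iota /= add0n => t0X ->.
rewrite mul1n; apply: leq_trans (sum_vtrunc_near K pp t0X).
apply: leq_sum => t _; rewrite /tau.
by rewrite (_ : (t + l * X)%N%:Z - (t0 + l * X)%N%:Z = t%:Z - t0%:Z) //; lia.
Qed.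

Lemma cyclo_norm_box X (u : box X) : (0 < X)%N ->
  (X ^ n <= `|cyclo_norm (box_elt u)| <= (2 * l * X) ^ n)%N.
Proof.
move=> X0; have [z [_ hz z1]] := principal_root_algC m.
have nE : (`|cyclo_norm (box_elt u)|%N)%:R = \prod_(j < n) `|zeta_eval (z ^+ j.+1) (box_elt u)| :> algC.
  by rewrite -normr_prod -(cyclo_norm_principal _ hz) -intr_norm -abszE -pmulrn.
have e0 (j : 'I_n) : zeta_eval (z ^+ j.+1) (box_elt u) = (u.1 + l * X)%N%:R +
    \sum_(i < m) (u.2 i)%:R * (z ^+ j.+1) ^+ i.+1.
  rewrite /zeta_eval big_ord_recl mxE unlift_none mulr1 -pmulrn; congr (_ + _).
  by apply: eq_bigr => i _; rewrite mxE liftK -pmulrn.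
have s0 (j : 'I_n) : `|\sum_(i < m) (u.2 i)%:R * (z ^+ j.+1) ^+ i.+1| <= (m * X)%N%:R.
  apply: le_trans (ler_norm_sum _ _ _) _.
  apply: le_trans (_ : \sum_(i < m) X%:R <= _); last by rewrite sumr_const card_ord mulnC natrM mulr_natr.
  apply: ler_sum => i _; rewrite normrM !normrX z1 !expr1n mulr1 normr_nat ler_nat.
  exact: ltnW.
rewrite -!(ler_nat algC) nE !natrX; apply/andP; split.
  rewrite -[X in _ ^+ X]card_ord -prodr_const; apply: ler_prod => j _; rewrite ler0n /= e0.
  rewrite -[X in _ <= `|_ + X|]opprK; apply: le_trans (lerB_dist _ _).
  rewrite normrN normr_nat lerBrDr; apply: le_trans (lerD (lexx _) (s0 j)) _.
  by rewrite -natrD ler_nat; nia.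
rewrite -[X in _ <= _ ^+ X]card_ord -prodr_const; apply: ler_prod => j _; rewrite normr_ge0 /= e0.
apply: le_trans (ler_normD _ _) _; apply: le_trans (lerD (lexx _) (s0 j)) _.
by rewrite normr_nat -natrD ler_nat; have := ltn_ord u.1; nia.
Qed.

End NormOnBox.

(** * Chebyshev's bound on dyadic blocks *)

Lemma prod_primes_dvd (s : seq nat) N :
  uniq s -> all prime s -> (forall p, p \in s -> (p %| N)%N) -> (\prod_(p <- s) p %| N)%N.
Proof.
elim: s => [|p s IH] /=; first by rewrite big_nil dvd1n.
move=> /andP[ps us] /andP[pp sp] h; rewrite big_cons Gauss_dvd.
  by rewrite h ?inE ?eqxx // IH // => q qs; rewrite h // inE qs orbT.
rewrite prime_coprime // Euclid_dvd_prod // big_has; apply/hasPn => q qs.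
rewrite dvdn_prime2 //; last exact: (allP sp).
by apply: contraNneq ps => ->.
Qed.

Lemma bin_le_exp2 a b : ('C(a, b) <= 2 ^ a)%N.
Proof.
elim: a b => [|a IH] [|b]; rewrite ?bin0 ?expn_gt0 //.
by rewrite binS expnS mul2n -addnn leq_add.
Qed.

(** The primes in question all divide the central binomial coefficient. *)
Lemma prod_primes_double a : (0 < a)%N ->
  (\prod_(a.+1 <= p < (2 * a).+1 | prime p) p <= 2 ^ (2 * a))%N.
Proof.
move=> a0; apply: leq_trans (bin_le_exp2 (2 * a) a).
rewrite -big_filter; apply: dvdn_leq; first by rewrite bin_gt0; lia.
apply: prod_primes_dvd; first by rewrite filter_uniq // iota_uniq.
  by apply/allP => p; rewrite mem_filter => /andP[].
move=> p; rewrite mem_filter mem_index_iota => /andP[pp /andP[ap pa]].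
have nf : ~~ (p %| a`!)%N.
  rewrite fact_prod Euclid_dvd_prod // big_has; apply/hasPn => i; rewrite mem_index_iota => /andP[i0 ia].
  by rewrite gtnNdvd //; lia.
have : (p %| (2 * a)`!)%N by rewrite dvdn_fact //; lia.
rewrite -(bin_fact (m := a) (n := 2 * a)); last by lia.
rewrite (_ : (2 * a - a = a)%N); last by lia.
by rewrite !Euclid_dvdM // (negPf nf) !orbF.
Qed.

Section Chebyshev.
Variable R : realType.

Lemma ln_exp2n j : ln (2 ^ j)%N%:R = j%:R * ln 2 :> R.
Proof. by rewrite natrX lnXn ?ltr0n // mulr_natl. Qed.

Lemma sum_ln_block k :
  \sum_(2 ^ k <= p < 2 ^ k.+1 | prime p) ln p%:R <= 2 ^+ k * (4 * ln 2) :> R.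
Proof.
have ln2 : 0 <= ln 2 :> R by rewrite ln_ge0 // ler1n.
have [->|k0] := posnP k.
  rewrite expn0 expn1 big_nat_cond big1 => [|p /andP[/andP[_ p2] /prime_gt1]]; last by lia.
  by rewrite expr0 mul1r mulr_ge0.
have k1 : (1 < 2 ^ k)%N by rewrite -(expn0 2) ltn_exp2l.
rewrite expnS.
have -> : \sum_(2 ^ k <= p < 2 * 2 ^ k | prime p) ln p%:R
   = \sum_(2 ^ k <= p < (2 * 2 ^ k).+1 | prime p) ln p%:R :> R.
  rewrite [LHS]big_mkcond [RHS]big_mkcond /= [RHS]big_nat_recr /=; last by lia.
  case: ifP; last by rewrite addr0.
  by move=> /primeP[_ /(_ 2%N)]; rewrite dvdn_mulr // => /(_ isT)/orP[//|/eqP]; lia.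
have -> : \sum_(2 ^ k <= p < (2 * 2 ^ k).+1 | prime p) ln p%:R
   = \sum_((2 ^ k).+1 <= p < (2 * 2 ^ k).+1 | prime p) ln p%:R + (if prime (2 ^ k) then ln (2 ^ k)%:R else 0) :> R.
  rewrite big_ltn_cond; last by lia.
  by case: ifP => _; rewrite ?addr0 // addrC.
have -> : \sum_((2 ^ k).+1 <= p < (2 * 2 ^ k).+1 | prime p) ln p%:R =
   ln (\prod_((2 ^ k).+1 <= p < (2 * 2 ^ k).+1 | prime p) p)%N%:R :> R.
  have [//] : (0 < \prod_((2 ^ k).+1 <= p < (2 * 2 ^ k).+1 | prime p) p)%N /\
   \sum_((2 ^ k).+1 <= p < (2 * 2 ^ k).+1 | prime p) ln p%:R =
   ln (\prod_((2 ^ k).+1 <= p < (2 * 2 ^ k).+1 | prime p) p)%N%:R :> R.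
  elim/big_rec2: _ => [|i a b pi [a0 ->]]; first by rewrite ln1.
  rewrite muln_gt0 a0 prime_gt0 //; split=> //.
  by rewrite natrM lnM // posrE ltr0n // prime_gt0.
apply: (@le_trans _ _ (ln (2 ^ (2 * 2 ^ k))%N%:R + ln (2 ^ k)%:R)).
  apply: lerD; last by case: ifP => // _; rewrite ln_ge0 // ler1n expn_gt0.
  rewrite ler_ln ?posrE ?ltr0n ?expn_gt0 //; last by apply: prodn_cond_gt0 => i /prime_gt0.
  by rewrite ler_nat prod_primes_double // ltnW.
rewrite !ln_exp2n natrM natrX.
have hk : k%:R <= 2 ^+ k :> R by rewrite -natrX ler_nat ltnW // ltn_expl.
have x0 : 0 <= 2 ^+ k :> R by rewrite exprn_ge0.
move: (2 ^+ k) (k%:R) (ln 2) hk ln2 x0 => x y z hk z0 x0.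
have := ler_wpM2r z0 hk; have := mulr_ge0 x0 z0; lra.
Qed.

Lemma big_blocks (F : nat -> R) M :
  \sum_(1 <= p < 2 ^ M | prime p) F p = \sum_(k < M) \sum_(2 ^ k <= p < 2 ^ k.+1 | prime p) F p.
Proof.
elim: M => [|M IH]; first by rewrite big_ord0 expn0 big_geq.
rewrite big_ord_recr /= -IH (big_cat_nat (n := (2 ^ M)%N)) // ?expn_gt0 //.
by rewrite leq_exp2l.
Qed.

Lemma ln_logn (N B : nat) : (0 < N < B)%N ->
  ln N%:R = \sum_(1 <= p < B | prime p) (logn p N)%:R * ln p%:R :> R.
Proof.
move=> /andP[N0 NB].
have {1}-> : N = (\prod_(1 <= p < B | prime p) p ^ logn p N)%N.
  have := partnT N0; rewrite (widen_partn _ (_ : N <= B.-1)%N) ?prednK //; try lia.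
  move=> {1}<-; rewrite big_ltn ?(leq_trans _ NB) //.
  rewrite (lognE 0) /= expn0 mul1n.
  rewrite big_mkcond [RHS]big_mkcond /=; apply: eq_bigr => p _.
  by rewrite lognE; case: (prime p) => //=; rewrite expn0.
have [] : (0 < \prod_(1 <= p < B | prime p) p ^ logn p N)%N /\
  \sum_(1 <= p < B | prime p) (logn p N)%:R * ln p%:R = ln (\prod_(1 <= p < B | prime p) p ^ logn p N)%N%:R :> R; last by move=> _ ->.
elim/big_rec2: _ => [|i a b pi [a0 ->]]; first by rewrite ln1.
have i0 := prime_gt0 pi.
rewrite muln_gt0 a0 expn_gt0 i0; split=> //.
rewrite natrM lnM ?posrE ?ltr0n // ?expn_gt0 ?i0 // natrX lnXn ?ltr0n //.
by rewrite mulr_natl.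
Qed.

End Chebyshev.

(** * Logarithms of norms, prime by prime *)

(** The bound of [kernel_count] with its main term [X^n] separated, valid while
    the shift is of order at most [X]. *)
Lemma shifted_pow_le e c m : exists C, forall X Y, (Y <= c * X)%N ->
  ((X + e * Y) ^ m.+1 <= X ^ m.+1 + C * X ^ m * Y)%N.
Proof.
elim: m => [|m [C hC]]; first by exists e => X Y _; rewrite !expn1 expn0 muln1.
exists (e + C + C * e * c)%N => X Y hY.
rewrite expnS (leq_trans (leq_mul (leqnn _) (hC X Y hY))) //.
rewrite [(X ^ m.+2)%N]expnS [(X ^ m.+1)%N in X in (_ <= X)%N]expnS.
rewrite [(X ^ m.+1)%N]expnS.
have h : (C * X ^ m * Y * (e * Y) <= C * X ^ m * Y * (e * (c * X)))%N.
  by rewrite !leq_mul2l hY !orbT.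
move: (X ^ m)%N h => x h; nia.
Qed.

Lemma sqr_le_exp2 s : (s ^ 2 <= 2 * 2 ^ s)%N.
Proof.
elim: s => [//|s IH]; case: s IH => [//|[//|[//|s]]].
by rewrite [(2 ^ s.+4)%N]expnS -!mulnn; move: (2 ^ s.+3)%N => y; nia.
Qed.

Lemma sum_exp2_div n T : (\sum_(k < n.+1 * T) 2 ^ (k %/ n.+1) <= n.+1 * 2 ^ T)%N.
Proof.
elim: T => [|T IH]; first by rewrite muln0 big_ord0.
rewrite mulnSr -(big_mkord xpredT (fun k => 2 ^ (k %/ n.+1)))%N.
rewrite (big_cat_nat (n := (n.+1 * T)%N)) ?leq_addr //= big_mkord.
rewrite [(2 ^ T.+1)%N]expnS mul2n -addnn mulnDr; apply: leq_add => //.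
rewrite big_nat (eq_bigr (fun=> 2 ^ T)%N) => [|k /andP[h1 h2]].
  by rewrite -big_nat sum_nat_const_nat addKn.
congr (2 ^ _)%N; apply/eqP; rewrite eqn_leq -ltnS ltn_divLR // leq_divRL //.
by rewrite mulSn ![(T * _)%N]mulnC h1 addnC h2.
Qed.

Lemma sum_exp2_lt s : (\sum_(k < s) 2 ^ k <= 2 ^ s)%N.
Proof.
elim: s => [|s IH]; first by rewrite big_ord0.
by rewrite big_ord_recr /= expnS mul2n -addnn leq_add2r.
Qed.

Section BoxLogarithms.
Variable R : realType.

Lemma geom_le2 (q : R) N : 0 <= q <= 2^-1 -> \sum_(i < N) q ^+ i <= 2.
Proof.
move=> /andP[q0 q1]; have := subrX1 q N; set S := \sum_(i < N) _ => h.
have : 0 <= q ^+ N by rewrite exprn_ge0.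
have S0 : 0 <= S by apply: sumr_ge0 => i _; rewrite exprn_ge0.
have : q * S <= 2^-1 * S by rewrite ler_wpM2r.
by move: h; rewrite mulrBl mul1r; lra.
Qed.

Section Degree.
Variable m : nat.
Local Notation n := m.+1.
Local Notation l := m.+2.
Local Notation box X := ('I_X * {ffun 'I_m -> 'I_X})%type.
Hypothesis lpr : prime l.

Definition box_valuation p X := (\sum_(u : box X) logn p `|cyclo_norm (box_elt u)|)%N.

(** The side of the box is [X = 4 ^ s], so that its square root is [2 ^ s], and
    [2 ^ (n T)] is a power of two above all the norms. *)
Section FixedSide.
Variables (a s : nat).
Hypothesis ha : (2 * l < 2 ^ a)%N.
Let T := (a + 2 * s)%N.
Let X := (2 ^ (2 * s))%N.
Let K := (n * T).+1.

Let X0 : (0 < X)%N. Proof. by rewrite expn_gt0. Qed.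

Lemma norm_lt (u : box X) : (0 < `|cyclo_norm (box_elt u)| < 2 ^ (n * T))%N.
Proof.
have /andP[h1 h2] := cyclo_norm_box u X0; apply/andP; split.
  by apply: leq_trans h1; rewrite expn_gt0 X0.
apply: leq_ltn_trans h2 _; rewrite [(n * T)%N]mulnC expnM ltn_exp2r // /T expnD -/X.
by rewrite ltn_pmul2r.
Qed.

Lemma logn_norm_lt p (u : box X) : (logn p `|cyclo_norm (box_elt u)| < K)%N.
Proof.
rewrite ltnS; have /andP[h1 h2] := norm_lt u.
have [pp|np] := boolP (prime p); last by rewrite lognE (negPf np).
rewrite -(leq_exp2l (m := 2)) //; apply: leq_trans (ltnW h2).
apply: leq_trans (dvdn_leq h1 (pfactor_dvdnn p _)).
by case: (logn p _) => // k; rewrite leq_exp2r ?prime_gt1.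
Qed.

Lemma log_sum_box : (X ^ n)%:R * (n%:R * ((2 * s)%:R * ln 2)) <=
  \sum_(1 <= p < 2 ^ (n * T) | prime p) (box_valuation p X)%:R * ln p%:R :> R.
Proof.
have -> : \sum_(1 <= p < 2 ^ (n * T) | prime p) (box_valuation p X)%:R * ln p%:R =
   \sum_(u : box X) ln `|cyclo_norm (box_elt u)|%:R :> R.
  under [RHS]eq_bigr do rewrite (ln_logn R (norm_lt _)).
  rewrite exchange_big /=; apply: eq_bigr => p _.
  by rewrite /box_valuation natr_sum mulr_suml.
rewrite -card_box -sum1_card natr_sum mulr_suml; apply: ler_sum => u _.
rewrite mul1r -ln_exp2n -/X.
have -> : n%:R * ln X%:R = ln (X ^ n)%N%:R :> R.
  by rewrite natrX lnXn ?ltr0n // mulr_natl.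
have /andP[h1 h2] := cyclo_norm_box u X0; have /andP[h3 _] := norm_lt u.
by rewrite ler_ln ?posrE ?ltr0n ?expn_gt0 ?X0 // ler_nat.
Qed.

(** For the first power of [p], which lies in the block of [2 ^ k], a cube of
    side [2 ^ (k / n + 1)] has more than [p] points, so [kernel_count] gives
    the main term [X^n / p]; for the higher powers the crude count is
    summable. *)
Lemma box_valuation_split c5 p k : (forall Y, (Y <= 2 ^ a * X)%N ->
    ((X + 4 * (n * regular_mx_const m) * Y) ^ n <= X ^ n + c5 * X ^ m * Y)%N) ->
  prime p -> (p %% l == 1)%N -> (2 ^ k <= p < 2 ^ k.+1)%N -> (k < n * T)%N ->
  (box_valuation p X)%:R <= n%:R * ((X ^ n)%:R / p%:R + (c5 * X ^ m)%:R * (2 ^+ (k %/ n) / 2 ^+ k)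
     + 2 * (ideal_const m ^ n * X ^ n)%:R / 4 ^+ k) :> R.
Proof.
move=> hc5 pp pl /andP[kp pk] kT.
have lp : (l %| p.-1)%N.
  by rewrite -subn1 -eqn_mod_dvd ?prime_gt0 // (eqP pl) modn_small.
have [cnt [h1 h3 h4]] := split_count lpr pp lp X0 (logn_norm_lt p).
have p0 : 0 < p%:R :> R by rewrite ltr0n prime_gt0.
have k2 : 0 < 2 ^+ k :> R by rewrite exprn_gt0.
have kpR : 2 ^+ k <= p%:R :> R by rewrite -natrX ler_nat.
apply: (@le_trans _ _ (\sum_(j < n) \sum_(1 <= k < K.+1) (cnt j k)%:R)).
  rewrite (le_trans (_ : _ <= (\sum_(j < n) \sum_(1 <= k < K.+1) cnt j k)%N%:R)) ?ler_nat //.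
  by rewrite natr_sum; apply: ler_sum => j _; rewrite natr_sum.
rewrite -[n in n%:R]card_ord -sum1_card natr_sum mulr_suml; apply: ler_sum => j _.
rewrite mul1r big_ltn //; apply: lerD.
  have kn : (k %/ n < T)%N by rewrite ltn_divLR // mulnC.
  have Yb : (2 ^ (k %/ n) <= 2 ^ a * X)%N.
    by rewrite /X -expnD leq_exp2l // -/T ltnW.
  (* The cube of side [2 ^ (k / n + 1)] has at least [2 ^ (k + 1) > p] points. *)
  have hr : (p ^ 1 < (2 ^ (k %/ n).+1) ^ n)%N.
    rewrite expn1 (leq_trans pk) // -expnM leq_exp2l // mulnC.
    by have := ltn_ceil k (isT : (0 < n)%N); rewrite mulnC.
  have := h4 j 1%N _ isT hr; rewrite expn1 => hh.
  have := leq_trans hh (_ : _ <= X ^ n + c5 * X ^ m * 2 ^ (k %/ n))%N.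
  have -> : (X + 2 * (n * (regular_mx_const m * 2 ^ (k %/ n).+1)) = X + 4 * (n * regular_mx_const m) * 2 ^ (k %/ n))%N.
    by rewrite expnS; ring.
  move=> /(_ (hc5 _ Yb)); rewrite -(ler_nat R) natrM natrD natrM (natrX _ 2 (k %/ n)) => h.
  apply: (@le_trans _ _ (((X ^ n)%:R + (c5 * X ^ m)%:R * 2 ^+ (k %/ n)) / p%:R)).
    by rewrite ler_pdivlMr.
  rewrite mulrDl lerD2l mulrA ler_wpM2l ?mulr_ge0 ?exprn_ge0 //.
  by rewrite lef_pV2 ?posrE.
set Q := (ideal_const m ^ n * X ^ n)%N.
have cb i : (1 < i <= K)%N -> (cnt j i)%:R <= Q%:R / p%:R ^+ i :> R.
  move=> /andP[i1 iK]; rewrite ler_pdivlMr ?exprn_gt0 // -natrX -natrM ler_nat /Q -expnMn.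
  by apply: h3; rewrite iK (ltnW i1).
apply: (@le_trans _ _ (\sum_(2 <= i < K.+1) Q%:R / p%:R ^+ i)).
  by rewrite big_nat [leRHS]big_nat; apply: ler_sum => i /cb.
rewrite -mulr_sumr [2 * Q%:R]mulrC -mulrA ler_wpM2l //.
rewrite -{1}(add0n 2%N) big_addn big_mkord.
under eq_bigr do rewrite exprD invfM.
rewrite -mulr_suml; under eq_bigr do rewrite -exprVn.
apply: ler_pM.
- by apply: sumr_ge0 => i _; rewrite exprn_ge0 // invr_ge0 ltW.
- by rewrite invr_ge0 exprn_ge0 // ltW.
- apply: geom_le2; rewrite invr_ge0 ltW //= lef_pV2 ?posrE //.
  by rewrite (ler_nat R 2) prime_gt1.
- rewrite lef_pV2 ?posrE ?exprn_gt0 // -[4]/(2 * 2)%N%:R natrM -expr2 -exprM mulnC exprM.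
  by rewrite lerXn2r ?nnegrE // ltW.
Qed.

Lemma nonsplit_count_block p k : prime p -> (p %% l != 1)%N -> (2 ^ k <= p)%N ->
  (#|[set u : box X | (p %| `|cyclo_norm (box_elt u)|)%N]|)%:R <= (inert_const m * X ^ n)%:R / 4 ^+ k :> R.
Proof.
move=> pp pl kp; rewrite ler_pdivlMr ?exprn_gt0 //.
rewrite -[4]/(4%N%:R) -natrX -natrM ler_nat.
apply: leq_trans (nonsplit_count lpr pp pl X0); rewrite leq_mul2l.
by rewrite -[4%N]/(2 ^ 2)%N -expnM mulnC expnM leq_exp2r // kp orbT.
Qed.

Lemma box_valuation_nonsplit_small p k : prime p -> (p %% l != 1)%N -> (2 ^ k <= p)%N ->
  (box_valuation p X)%:R <= n%:R * ((inert_const m).+4 * X ^ n)%:R / 4 ^+ k + (X ^ m * n * K)%:R :> R.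
Proof.
move=> pp pl kp; have D := nonsplit_count_block pp pl kp.
have hK (u : box X) : (logn p `|cyclo_norm (box_elt u)| <= K)%N by rewrite ltnW // logn_norm_lt.
have := sum_logn_norm_le pp X0 lpr hK.
rewrite -/(box_valuation p X) -(ler_nat R) => h; apply: le_trans h _.
have Xp : (X %/ p ^ 2)%:R <= X%:R / 4 ^+ k :> R.
  rewrite ler_pdivlMr ?exprn_gt0 // -[4]/(4%N%:R) -natrX -natrM ler_nat.
  apply: (@leq_trans (X %/ p ^ 2 * p ^ 2)%N); last exact: leq_divM.
  by rewrite leq_mul2l -[4%N]/(2 ^ 2)%N -expnM mulnC expnM leq_exp2r // kp orbT.
have q0 : 0 <= (4 ^+ k)^-1 :> R by rewrite invr_ge0 exprn_ge0.
rewrite natrD natrM.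
have -> : n%:R * ((inert_const m).+4 * X ^ n)%:R / 4 ^+ k =
   n%:R * ((inert_const m * X ^ n)%:R / 4 ^+ k) + (X ^ m)%:R * (n%:R * (4 * (X%:R / 4 ^+ k))) :> R.
  by rewrite expnS -addn4 !natrM natrD; ring.
rewrite -addrA; apply: lerD; first by rewrite ler_wpM2l.
rewrite !natrM natrD natrM.
have -> : (X ^ m)%:R * (n%:R * (4 * (X%:R / 4 ^+ k))) + (X ^ m)%:R * n%:R * K%:R =
  (X ^ m)%:R * (n%:R * (K%:R + 4 * (X%:R / 4 ^+ k))) :> R by ring.
by rewrite !ler_wpM2l // lerD2l ler_wpM2l.
Qed.

(** The contribution of [p] to the logarithm of a norm is at most the logarithm
    of the norm; this is efficient for large [p], where few norms are
    divisible by [p]. *)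
Lemma box_valuation_nonsplit_large p k : prime p -> (p %% l != 1)%N -> (2 ^ k <= p)%N ->
  (box_valuation p X)%:R * ln p%:R <= (inert_const m * X ^ n)%:R / 4 ^+ k * (n * T)%:R * ln p%:R :> R.
Proof.
move=> pp pl kp; have D := nonsplit_count_block pp pl kp.
have lp0 : 0 <= ln p%:R :> R by rewrite ln_ge0 // ler1n prime_gt0.
have l20 : 0 <= ln 2 :> R by rewrite ln_ge0 // ler1n.
have l2p : ln 2 <= ln p%:R :> R.
  by rewrite ler_ln ?posrE ?ltr0n ?prime_gt0 // (ler_nat R 2) prime_gt1.
apply: (@le_trans _ _ ((#|[set u : box X | (p %| `|cyclo_norm (box_elt u)|)%N]|)%:R * ((n * T)%:R * ln 2))); last first.
  rewrite -[leRHS]mulrA; apply: ler_pM => //; first by rewrite mulr_ge0.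
  by rewrite ler_wpM2l.
rewrite -sum1dep_card /box_valuation !natr_sum !mulr_suml [leRHS]big_mkcond; apply: ler_sum => u _ /=.
have /andP[h1 h2] := norm_lt u.
case: ifP => [pN|/negbT pN]; last by rewrite lognE (negPf pN) !andbF mul0r.
rewrite mul1r -ln_exp2n.
have -> : (logn p `|cyclo_norm (box_elt u)|)%:R * ln p%:R = ln (p ^ logn p `|cyclo_norm (box_elt u)|)%N%:R :> R.
  by rewrite natrX lnXn ?ltr0n ?prime_gt0 // mulr_natl.
rewrite ler_ln ?posrE ?ltr0n ?expn_gt0 ?prime_gt0 // ler_nat.
by apply: leq_trans (ltnW h2); apply: dvdn_leq => //; exact: pfactor_dvdnn.
Qed.

End FixedSide.
End Degree.
End BoxLogarithms.

Section MertensCore.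
Variable R : realType.
Variable m : nat.
Local Notation n := m.+1.
Local Notation l := m.+2.
Hypothesis lpr : prime l.

Definition mertens_block k : R :=
  \sum_(2 ^ k <= p < 2 ^ k.+1 | prime p && (p %% l == 1)%N) ln p%:R / p%:R.

Lemma mertens_block_ge0 k : 0 <= mertens_block k.
Proof.
apply: sumr_ge0 => p /andP[pp _].
by rewrite divr_ge0 // ln_ge0 // ler1n prime_gt0.
Qed.

(** Summation over all primes.  Every prime of the block of [2 ^ k] contributes
    its main term, if it splits, and at most [log p * G k]; Chebyshev's bound
    turns the latter into [2 ^ k * G k], and these add up to [O(X^n)].  The
    primes that do not split are divided at [2 ^ s], the square root of the
    side, to balance the two estimates for them. *)
Lemma mertens_core a c5 : (2 * l < 2 ^ a)%N ->
  (forall X Y, (Y <= 2 ^ a * X)%N ->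
    ((X + 4 * (n * regular_mx_const m) * Y) ^ n <= X ^ n + c5 * X ^ m * Y)%N) ->
  exists C : R, forall s, (2 * s)%:R * ln 2 - C <= \sum_(k < n * (a + 2 * s)) mertens_block k.
Proof.
move=> ha hc5.
pose c6 : nat := (n * (inert_const m).+4 + 2 * n * ideal_const m ^ n + n * c5 + inert_const m)%N.
pose c7 : nat := (2 * a ^ 2 + 16)%N.
pose E : R := (2 * c6%:R + (c6 * n * 2 ^ a)%:R + (n * (n ^ 2 * c7 + 1))%:R + (c6 * n ^ 2 * c7)%:R).
exists (4 * ln 2 * E) => s.
set T := (a + 2 * s)%N; pose X := (2 ^ (2 * s))%N; pose K := (n * T).+1.
have X0 : (0 < X)%N by rewrite expn_gt0.
have ln20 : 0 <= ln 2 :> R by rewrite ln_ge0 // ler1n.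
(* The three terms: higher powers of [p] and small non-split primes; error for
   split primes; the bound for non-split primes, by [k < s] or not. *)
pose G k : R := c6%:R * (X ^ n)%:R / 4 ^+ k + c6%:R * (X ^ m)%:R * (2 ^+ (k %/ n) / 2 ^+ k)
   + (if (k < s)%N then (X ^ m * n * K)%:R else c6%:R * (X ^ n)%:R * (n * T)%:R / 4 ^+ k).
have q4 k : 0 <= (4 ^+ k)^-1 :> R by rewrite invr_ge0 exprn_ge0.
have q2 k : 0 <= 2 ^+ (k %/ n) / 2 ^+ k :> R by rewrite divr_ge0 ?exprn_ge0.
have g1 k : 0 <= c6%:R * (X ^ n)%:R / 4 ^+ k :> R by rewrite !mulr_ge0.
have g2 k : 0 <= c6%:R * (X ^ m)%:R * (2 ^+ (k %/ n) / 2 ^+ k) :> R.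
  by rewrite mulr_ge0 ?q2 // mulr_ge0.
have g3 k : 0 <= c6%:R * (X ^ n)%:R * (n * T)%:R / 4 ^+ k :> R by rewrite !mulr_ge0.
have G3 k : 0 <= (if (k < s)%N then (X ^ m * n * K)%:R else c6%:R * (X ^ n)%:R * (n * T)%:R / 4 ^+ k) :> R.
  by case: ifP => _; rewrite ?g3.
have pt k p : (k < n * T)%N -> prime p -> (2 ^ k <= p < 2 ^ k.+1)%N ->
  (box_valuation m p X)%:R * ln p%:R <= (if (p %% l == 1)%N then n%:R * (X ^ n)%:R * (ln p%:R / p%:R) else 0)
      + ln p%:R * G k.
  move=> kT pp hp; have /andP[kp _] := hp.
  have lp0 : 0 <= ln p%:R :> R by rewrite ln_ge0 // ler1n prime_gt0.
  have [pl|pl] := boolP (p %% l == 1)%N.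
    have h := box_valuation_split R lpr ha (hc5 _) pp pl hp kT.
    apply: le_trans (ler_wpM2r lp0 h) _.
    have -> : n%:R * (X ^ n)%:R * (ln p%:R / p%:R) + ln p%:R * G k =
       (n%:R * ((X ^ n)%:R / p%:R) + G k) * ln p%:R by ring.
    rewrite ler_wpM2r // mulrDr mulrDr -addrA lerD2l /G -[leRHS]addrA.
    have -> : n%:R * (2 * (ideal_const m ^ n * X ^ n)%:R / 4 ^+ k) =
        (2 * n * ideal_const m ^ n)%:R * (X ^ n)%:R / 4 ^+ k :> R by rewrite !natrM; ring.
    have -> : n%:R * ((c5 * X ^ m)%:R * (2 ^+ (k %/ n) / 2 ^+ k)) =
        (n * c5)%:R * (X ^ m)%:R * (2 ^+ (k %/ n) / 2 ^+ k) :> R by rewrite !natrM; ring.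
    rewrite addrC; apply: lerD.
      rewrite !ler_wpM2r // ler_nat /c6; lia.
    apply: (@le_trans _ _ (c6%:R * (X ^ m)%:R * (2 ^+ (k %/ n) / 2 ^+ k))); last by rewrite lerDl.
    rewrite ler_wpM2r // ler_wpM2r // ler_nat /c6; lia.
  rewrite add0r /G; case: ltnP => ks.
    have h := box_valuation_nonsplit_small R lpr s ha pp pl kp.
    rewrite mulrC; apply: le_trans (ler_wpM2l lp0 h) _; rewrite ler_wpM2l // lerD2r.
    apply: (@le_trans _ _ (c6%:R * (X ^ n)%:R / 4 ^+ k)); last by rewrite lerDl.
    have -> : n%:R * ((inert_const m).+4 * X ^ n)%:R / 4 ^+ k = (n * (inert_const m).+4)%:R * (X ^ n)%:R / 4 ^+ k :> R.
      by rewrite !natrM; ring.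
    rewrite !ler_wpM2r // ler_nat /c6; lia.
  have h := box_valuation_nonsplit_large R lpr s ha pp pl kp.
  apply: le_trans h _; rewrite mulrC ler_wpM2l //.
  apply: (@le_trans _ _ (c6%:R * (X ^ n)%:R * (n * T)%:R / 4 ^+ k)); last by rewrite lerDr addr_ge0.
  have -> : (inert_const m * X ^ n)%:R / 4 ^+ k * (n * T)%:R = (inert_const m)%:R * (X ^ n)%:R * (n * T)%:R / 4 ^+ k :> R.
    by rewrite !natrM; ring.
  rewrite !ler_wpM2r // ler_nat /c6; lia.
have G0 k : 0 <= G k by rewrite !addr_ge0.
have tot : (X ^ n)%:R * (n%:R * ((2 * s)%:R * ln 2)) <=
    n%:R * (X ^ n)%:R * \sum_(k < n * T) mertens_block k
    + \sum_(k < n * T) 2 ^+ k * (4 * ln 2) * G k.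
  apply: le_trans (log_sum_box R s ha) _; rewrite -/X -/T big_blocks.
  rewrite mulr_sumr -big_split; apply: ler_sum => k _ /=.
  apply: (@le_trans _ _ (\sum_(2 ^ k <= p < 2 ^ k.+1 | prime p)
     ((if (p %% l == 1)%N then n%:R * (X ^ n)%:R * (ln p%:R / p%:R) else 0) + ln p%:R * G k))).
    rewrite big_nat_cond [leRHS]big_nat_cond; apply: ler_sum => p /andP[hp pp].
    exact: pt.
  rewrite big_split /=; apply: lerD.
    by rewrite -big_mkcondr -mulr_sumr /mertens_block.
  by rewrite -mulr_suml ler_wpM2r // sum_ln_block.
(* Chebyshev's factor [2 ^ k] against the bound [1 / 4 ^ k] leaves a geometric series. *)
have c42 (k : nat) : 2 ^+ k / 4 ^+ k = (2^-1) ^+ k :> R.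
  by rewrite exprVn -[4]/(2 * 2)%N%:R natrM exprMn invfM mulrA divff ?mul1r // expf_neq0 // pnatr_eq0.
have hsum : \sum_(k < n * T) 2 ^+ k * G k <= (X ^ n)%:R * E.
  under eq_bigr do rewrite /G !mulrDr.
  rewrite !big_split /= /E.
  have XE : (X ^ n)%:R = (X ^ m)%:R * (2 ^+ s) * (2 ^+ s) :> R.
    rewrite -!natrX -!natrM expnSr /X mul2n -addnn expnD mulnA //.
  have xm : 0 <= (X ^ m)%:R :> R by [].
  have s2 : 0 < 2 ^+ s :> R by rewrite exprn_gt0.
  (* Logarithmic powers are absorbed by [2 ^ s], the square root of the side [X]. *)
  have T2 : T%:R ^+ 2 <= c7%:R * 2 ^+ s :> R.
    rewrite -!natrX -natrM ler_nat /T /c7.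
    have := sqr_le_exp2 s; have : (0 < 2 ^ s)%N by rewrite expn_gt0.
    move: (2 ^ s)%N => y; rewrite -!mulnn => y0 hs.
    have : (a * a <= a * a * y)%N by rewrite leq_pmulr.
    have : (0 <= (a%:Z - 2 * s%:Z) ^+ 2)%R by rewrite sqr_ge0.
    nia.
  have b1 : \sum_(k < n * T) 2 ^+ k * (c6%:R * (X ^ n)%:R / 4 ^+ k) <= (X ^ n)%:R * (2 * c6%:R) :> R.
    under eq_bigr do rewrite mulrCA c42.
    rewrite -mulr_sumr.
    have := @geom_le2 R 2^-1 (n * T); rewrite invr_ge0 lexx ler0n => /(_ isT) h.
    have h2 : 0 <= c6%:R * (X ^ n)%:R :> R by rewrite mulr_ge0.
    have := ler_wpM2r h2 h; lra.
  have b2 : \sum_(k < n * T) 2 ^+ k * (c6%:R * (X ^ m)%:R * (2 ^+ (k %/ n) / 2 ^+ k))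
      <= (X ^ n)%:R * (c6 * n * 2 ^ a)%:R :> R.
    have e1 (k : 'I_(n * T)) : true -> 2 ^+ k * (c6%:R * (X ^ m)%:R * (2 ^+ (k %/ n) / 2 ^+ k)) =
       c6%:R * (X ^ m)%:R * (2 ^ (k %/ n))%N%:R :> R.
      move=> _; rewrite (natrX _ 2 (k %/ n)); have : 2 ^+ k != 0 :> R by rewrite expf_neq0 // pnatr_eq0.
      move: (c6%:R : R) ((X ^ m)%:R : R) (2 ^+ k) (2 ^+ (k %/ n)) => u v x y x0. field; exact: x0.
    rewrite (eq_bigr _ e1) -mulr_sumr -natr_sum.
    apply: (@le_trans _ _ (c6%:R * (X ^ m)%:R * (n * 2 ^ T)%:R)).
      by rewrite ler_wpM2l ?mulr_ge0 // ler_nat sum_exp2_div.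
    by rewrite -!natrM ler_nat /T expnD -/X expnSr; apply/eq_leq; ring.
  have b3 : \sum_(k < n * T) 2 ^+ k * (if (k < s)%N then (X ^ m * n * K)%:R else c6%:R * (X ^ n)%:R * (n * T)%:R / 4 ^+ k)
     <= (X ^ n)%:R * ((n * (n ^ 2 * c7 + 1))%:R + (c6 * n ^ 2 * c7)%:R) :> R.
    have b3a : \sum_(k < n * T) (if (k < s)%N then 2 ^+ k * (X ^ m * n * K)%:R else 0) <=
       (X ^ n)%:R * (n * (n ^ 2 * c7 + 1))%:R :> R.
      apply: (@le_trans _ _ (2 ^+ s * (X ^ m * n * K)%:R)).
        have sT : (s <= n * T)%N by rewrite /T; nia.
        rewrite -big_mkcond /= -(big_mkord (fun k => (k < s)%N) (fun k => 2 ^+ k * (X ^ m * n * K)%:R)).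
        rewrite (big_cat_nat (n := s)) //= [X in _ + X]big_nat_cond [X in _ + X]big1 ?addr0; last first.
          by move=> k /andP[/andP[sk _]]; rewrite ltnNge sk.
        rewrite big_nat_cond (eq_bigl (fun k => (0 <= k < s)%N && true)); last first.
          by move=> k /=; case: (k < s)%N.
        rewrite -big_nat_cond big_mkord -mulr_suml ler_wpM2r //.
        under eq_bigr do rewrite -natrX.
        by rewrite -natr_sum -natrX ler_nat sum_exp2_lt.
      rewrite XE !natrM.
      have KT : K%:R <= (n ^ 2 * c7 + 1)%:R * 2 ^+ s :> R.
        have : K%:R <= (n ^ 2)%:R * T%:R ^+ 2 + 1 :> R.
          by rewrite -natrX -natrM natr1 ler_nat /K ltnS -expnMn -mulnn; nia.
        have s21 : 1 <= 2 ^+ s :> R by rewrite exprn_ege1 // ler1n.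
        have : (n ^ 2)%:R * T%:R ^+ 2 <= (n ^ 2)%:R * (c7%:R * 2 ^+ s) :> R by rewrite ler_wpM2l.
        rewrite natrD natrM; lra.
      have := ler_wpM2l (_ : 0 <= 2 ^+ s * (X ^ m)%:R * n%:R :> R) KT.
      by rewrite !mulr_ge0 ?(ltW s2) // => /(_ isT); lra.
    have b3b : \sum_(k < n * T) (if (k < s)%N then 0 else 2 ^+ k * (c6%:R * (X ^ n)%:R * (n * T)%:R / 4 ^+ k))
       <= (X ^ n)%:R * (c6 * n ^ 2 * c7)%:R :> R.
      apply: (@le_trans _ _ (\sum_(k < n * T) (c6%:R * (X ^ n)%:R * (n * T)%:R / 2 ^+ s))).
        apply: ler_sum => k _; case: ltnP => ks; first by rewrite !mulr_ge0 // invr_ge0 ltW.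
        rewrite mulrCA c42 -exprVn !ler_wpM2l ?mulr_ge0 //.
        by rewrite ler_wiXn2l // ?invr_ge0 ?ler0n // invf_le1 // ler1n.
      rewrite sumr_const card_ord -[_ *+ (n * T)]mulr_natr.
      have n20 : 0 <= c6%:R * (X ^ n)%:R * n%:R ^+ 2 / 2 ^+ s :> R.
        by rewrite !mulr_ge0 ?invr_ge0 ?(ltW s2).
      have := ler_wpM2l n20 T2; rewrite [(c6 * n ^ 2 * c7)%:R]natrM [(c6 * n ^ 2)%:R]natrM [(n ^ 2)%:R]natrX [(n * T)%:R]natrM.
      move: (2 ^+ s) (lt0r_neq0 s2) (c6%:R : R) ((X ^ n)%:R : R) (n%:R : R) (c7%:R : R) (T%:R : R).
      move=> y y0 u v w x t.
      have -> : u * v * w ^+ 2 / y * (x * y) = v * (u * w ^+ 2 * x) by field; exact: y0.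
      by have -> : u * v * (w * t) / y * (w * t) = u * v * w ^+ 2 / y * t ^+ 2 by ring.
    rewrite mulrDr; apply: le_trans (lerD b3a b3b); rewrite -big_split; apply: ler_sum => k _ /=.
    by case: ifP => _; rewrite ?addr0 ?add0r.
  by have := lerD (lerD b1 b2) b3; rewrite !mulrDr !addrA.
have XnR : 0 < n%:R * (X ^ n)%:R :> R by rewrite mulr_gt0 // ltr0n ?expn_gt0 ?X0.
have E0 : 0 <= E by rewrite /E !addr_ge0 ?mulr_ge0.
have tot2 : \sum_(k < n * T) 2 ^+ k * (4 * ln 2) * G k <= n%:R * (X ^ n)%:R * (4 * ln 2 * E).
  under eq_bigr do rewrite mulrAC.
  rewrite -mulr_suml.
  have h4 : 0 <= 4 * ln 2 :> R by rewrite mulr_ge0.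
  apply: le_trans (ler_wpM2r h4 hsum) _.
  have x0 : 0 <= (X ^ n)%:R * (4 * ln 2 * E) :> R by rewrite !mulr_ge0.
  have : 1 <= n%:R :> R by rewrite ler1n.
  move=> /(ler_wpM2r x0); lra.
have := le_trans tot (lerD (lexx _) tot2).
have -> : (X ^ n)%:R * (n%:R * ((2 * s)%:R * ln 2)) = n%:R * (X ^ n)%:R * ((2 * s)%:R * ln 2) :> R by ring.
by rewrite -mulrDr ler_pM2l // -lerBlDr.
Qed.

End MertensCore.

(** * Reciprocals of the primes congruent to 1 modulo a prime *)

Section Mertens.
Variable R : realType.

(** Summation by parts: the weights [1 / (k + 1)] decrease, so partial sums
    bounded below stay bounded below by the same constant. *)
Lemma abel_harmonic (t : nat -> R) C : (forall J, - C <= \sum_(k < J) t k) ->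
  forall J, - C <= \sum_(k < J) t k / k.+1%:R.
Proof.
move=> h [|J]; first by have := h 0%N; rewrite !big_ord0.
have hJ : (\sum_(k < J.+1) t k) / J.+1%:R - C * (1 - J.+1%:R^-1) <= \sum_(k < J.+1) t k / k.+1%:R.
  elim: J => [|J IH]; first by rewrite !big_ord1 !invr1 subrr mulr0 subr0.
  rewrite big_ord_recr [leRHS]big_ord_recr /= mulrDl.
  set S := \sum_(k < J.+1) t k in IH *; have hS := h J.+1; rewrite -/S in hS.
  set a : R := J.+1%:R^-1 in IH *; set b : R := J.+2%:R^-1 in IH *.
  have ab : b <= a by rewrite /a /b lef_pV2 ?posrE // ler_nat.
  have : 0 <= (S + C) * (a - b) by rewrite mulr_ge0 ?subr_ge0 //; lra.
  rewrite /= in IH *; move: (\sum_(k < J.+1) _) IH => Z IH; lra.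
apply: le_trans hJ.
have : 0 <= (\sum_(k < J.+1) t k + C) * J.+1%:R^-1.
  by rewrite mulr_ge0 ?invr_ge0 //; have := h J.+1; lra.
by move: (J.+1%:R^-1) (\sum_(k < J.+1) t k) => x y; lra.
Qed.

Lemma ln_le_harmonic J : ln J.+1%:R <= \sum_(k < J) k.+1%:R^-1 :> R.
Proof.
elim: J => [|J IH]; first by rewrite ln1 big_ord0.
rewrite big_ord_recr /=; apply: le_trans (lerD IH (lexx _)).
have -> : J.+2%:R = J.+1%:R * (1 + J.+1%:R^-1) :> R.
  by rewrite mulrDr mulr1 mulfV ?pnatr_eq0 // natr1.
have b0 : 0 < J.+1%:R^-1 :> R by rewrite invr_gt0 ltr0n.
rewrite lnM ?posrE ?ltr0n ?addr_gt0 //.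
rewrite lerD2l; apply: le_ln1Dx; by apply: lt_trans b0; rewrite ltrN10.
Qed.

Section Degree.
Variable m : nat.
Local Notation n := m.+1.
Local Notation l := m.+2.
Hypothesis lpr : prime l.

(** Interpolates [mertens_core] between the exponents of the form
    [n (a + 2 s)]. *)
Lemma mertens : exists C : R, forall J, - C <= \sum_(k < J) (mertens_block R m k - ln 2 / n%:R).
Proof.
have [a ha] : exists a, (2 * l < 2 ^ a)%N by exists (2 * l)%N; rewrite ltn_expl.
have [c5 hc5] := shifted_pow_le (4 * (n * regular_mx_const m)) (2 ^ a) m.
have [C hC] := mertens_core R lpr ha hc5.
have ln20 : 0 <= ln 2 :> R by rewrite ln_ge0 // ler1n.
exists (`|C| + a.+2%:R * ln 2) => J.
rewrite sumrB sumr_const card_ord.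
have Jn : J%:R / n%:R <= (J %/ n)%:R + 1 :> R.
  by rewrite ler_pdivrMr ?ltr0n // natr1 -natrM ler_nat ltnW // ltn_ceil.
have Jn2 : ln 2 / n%:R *+ J = ln 2 * (J%:R / n%:R) :> R by rewrite -mulr_natr; ring.
have S0 : 0 <= \sum_(k < J) mertens_block R m k by apply: sumr_ge0 => k _; exact: mertens_block_ge0.
have h1 := ler_wpM2l ln20 Jn.
have C0 : C <= `|C| by rewrite ler_norm.
have C00 : 0 <= `|C| by [].
rewrite Jn2 -addn2 natrD.
move: (J%:R / n%:R) h1 => x h1.
have [aJ|Ja] := leqP a (J %/ n); last first.
  have : (J %/ n)%:R <= a%:R :> R by rewrite ler_nat ltnW.
  move=> /(ler_wpM2l ln20) h2.
  move: (ln 2) ln20 h1 h2 => y ln20 h1 h2. lra.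
(* The largest [s] with [n (a + 2 s) <= J]; the blocks omitted are nonnegative. *)
pose s := ((J %/ n - a) %/ 2)%N.
have sle : (n * (a + 2 * s) <= J)%N.
  apply: leq_trans (leq_divM J n); rewrite mulnC leq_mul2r /=.
  by rewrite /s; lia.
have : (J %/ n)%:R <= (2 * s)%:R + a%:R + 1 :> R by rewrite -natrD natr1 ler_nat /s; lia.
move=> /(ler_wpM2l ln20) h2.
have h3 : \sum_(k < n * (a + 2 * s)) mertens_block R m k <= \sum_(k < J) mertens_block R m k.
  rewrite -!(big_mkord xpredT (mertens_block R m)) [leRHS](big_cat_nat (n := (n * (a + 2 * s))%N)) //=.
  by rewrite lerDl sumr_ge0 // => k _; exact: mertens_block_ge0.
have := hC s; lra.
Qed.

Definition inv_block k : R :=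
  \sum_(2 ^ k <= p < 2 ^ k.+1 | prime p && (p %% l == 1)%N) p%:R^-1.

(** On the block of [2 ^ k] the logarithm of a prime is at most
    [(k + 1) log 2].  Replacing it by this value costs nothing in a lower
    bound, and the dyadic form of Mertens' estimate is summed against
    [1 / (k + 1)]. *)
Lemma sum_inv_primes : exists C : R, forall J,
  ln J.+1%:R / n%:R - C <= \sum_(k < J.+1) inv_block k.
Proof.
have [C hC] := mertens.
have l2 : 0 < ln 2 :> R by rewrite ln_gt0 // ltr1n.
exists (C / ln 2) => J; have h := @abel_harmonic (fun k => mertens_block R m k - ln 2 / n%:R) C hC J.+1.
have h1 : \sum_(k < J.+1) mertens_block R m k / k.+1%:R <= ln 2 * \sum_(k < J.+1) inv_block k.
  rewrite mulr_sumr; apply: ler_sum => k _.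
  rewrite /mertens_block /inv_block mulr_suml mulr_sumr big_nat_cond [leRHS]big_nat_cond.
  apply: ler_sum => p /andP[/andP[_ pk] /andP[pp _]].
  rewrite mulrAC ler_wpM2r ?invr_ge0 // ler_pdivrMr // mulrC -ln_exp2n.
  by rewrite ler_ln ?posrE ?ltr0n ?expn_gt0 ?prime_gt0 // ler_nat ltnW.
have h2 : \sum_(k < J.+1) (mertens_block R m k - ln 2 / n%:R) / k.+1%:R =
   \sum_(k < J.+1) mertens_block R m k / k.+1%:R - ln 2 / n%:R * \sum_(k < J.+1) k.+1%:R^-1.
  by rewrite mulr_sumr -sumrB; apply: eq_bigr => k _; rewrite mulrBl.
rewrite h2 in h.
have h3 : ln 2 / n%:R * ln J.+1%:R <= ln 2 / n%:R * \sum_(k < J.+1) k.+1%:R^-1 :> R.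
  by rewrite ler_wpM2l ?divr_ge0 ?(ltW l2) //; apply: le_trans (ln_le_harmonic _) _; rewrite [leRHS]big_ord_recr lerDl invr_ge0.
rewrite -(ler_pM2l l2) mulrBr [ln 2 * (C / _)]mulrC divfK ?gt_eqF //.
rewrite [ln 2 * (_ / _)]mulrA mulrAC in h3 *.
move: (ln 2 / n%:R * \sum_(k < J.+1) k.+1%:R^-1) h h3 => M h h3.
move: (ln 2 * ln J.+1%:R / n%:R) h3 => A h3; lra.
Qed.

End Degree.
End Mertens.

(** * Sums over a cube of functions of residues *)

Section Cube.
Variable R : realFieldType.
Implicit Types (f g : nat -> R) (F G : nat -> nat -> nat -> R).

Lemma sum_crt a b f g : coprime a b -> (0 < a)%N -> (0 < b)%N ->
  (forall x, f (x %% a)%N = f x) -> (forall x, g (x %% b)%N = g x) ->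
  \sum_(x < a * b) f x * g x = (\sum_(x < a) f x) * (\sum_(x < b) g x).
Proof.
move=> cab a0 b0 hf hg.
pose h (x : 'I_(a * b)) : 'I_a * 'I_b :=
  (Ordinal (ltn_pmod x a0), Ordinal (ltn_pmod x b0)).
have hinj : injective h.
  move=> x y [/eqP ea /eqP eb]; apply: val_inj => /=.
  have : x == y %[mod a * b] by rewrite chinese_remainder // ea.
  by rewrite !modn_small // => /eqP.
have hb : bijective h by apply: inj_card_bij => //; rewrite card_prod !card_ord.
rewrite big_distrlr pair_big /= (reindex h); last exact: onW_bij.
by apply: eq_bigr => x _; rewrite /= hf hg.
Qed.

Lemma sum_periodic a k f : (forall x, f (x %% a)%N = f x) ->
  \sum_(x < k * a) f x = k%:R * \sum_(x < a) f x.
Proof.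
move=> hf; elim: k => [|k IH]; first by rewrite mul0n big_ord0 mul0r.
rewrite mulSn addnC big_split_ord /= IH -natr1 mulrDl mul1r; congr (_ + _).
by apply: eq_bigr => i _; rewrite -hf modnMDl hf.
Qed.

Lemma sum_shift q (f : int -> R) (h : nat) : (forall a, f (a + q%:Z) = f a) ->
  \sum_(x < q) f (x%:Z - h%:Z) = \sum_(x < q) f x.
Proof.
elim: h f => [|h IH] f hf; first by apply: eq_bigr => x _; rewrite subr0.
have -> : \sum_(x < q) f (x%:Z - h.+1%:Z) = \sum_(x < q) f (x%:Z - h%:Z - 1).
  by apply: eq_bigr => x _; congr f; lia.
rewrite (IH (fun a => f (a - 1))); last by move=> a; rewrite -(hf (a - 1)); congr f; lia.
case: q hf {IH} => [|q] hf; first by rewrite !big_ord0.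
rewrite big_ord_recl [RHS]big_ord_recr /= [LHS]addrC; congr (_ + _).
  by apply: eq_bigr => i _; congr f; rewrite /bump /=; lia.
by rewrite -hf; congr f; lia.
Qed.

Lemma sum_eq0n (q : nat) : (0 < q)%N -> \sum_(x < q) ((x : nat) == 0%N)%:R = 1 :> R.
Proof.
case: q => // q _; rewrite big_ord_recl big1 ?addr0 // => i _.
Qed.

Definition boxsum a b c F : R := \sum_(x < a) \sum_(y < b) \sum_(z < c) F x y z.

Lemma eq_boxsum F G a b c : (forall x y z, F x y z = G x y z) ->
  boxsum a b c F = boxsum a b c G.
Proof. by move=> e; do 3!apply: eq_bigr => ? _. Qed.

Definition periodic3 a F := forall x y z,
  [/\ F (x %% a)%N y z = F x y z, F x (y %% a)%N z = F x y z & F x y (z %% a)%N = F x y z].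

Lemma periodic3M a b F G : periodic3 a F -> periodic3 b G ->
  periodic3 (a * b) (fun x y z => F x y z * G x y z).
Proof.
move=> hF hG x y z.
have md c d u : (d %| c)%N -> (u %% c %% d = u %% d)%N by move=> dc; rewrite modn_dvdm.
have da : (a %| a * b)%N by rewrite dvdn_mulr.
have db : (b %| a * b)%N by rewrite dvdn_mull.
split.
- have [<- _ _] := hF (x %% (a * b))%N y z; have [<- _ _] := hG (x %% (a * b))%N y z.
  by rewrite !md //; have [-> _ _] := hF x y z; have [-> _ _] := hG x y z.
- have [_ <- _] := hF x (y %% (a * b))%N z; have [_ <- _] := hG x (y %% (a * b))%N z.
  by rewrite !md //; have [_ -> _] := hF x y z; have [_ -> _] := hG x y z.
- have [_ _ <-] := hF x y (z %% (a * b))%N; have [_ _ <-] := hG x y (z %% (a * b))%N.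
  by rewrite !md //; have [_ _ ->] := hF x y z; have [_ _ ->] := hG x y z.
Qed.

Lemma boxsum_crt a b F G : coprime a b -> (0 < a)%N -> (0 < b)%N ->
  periodic3 a F -> periodic3 b G ->
  boxsum (a * b) (a * b) (a * b) (fun x y z => F x y z * G x y z) =
  boxsum a a a F * boxsum b b b G.
Proof.
move=> cab a0 b0 hF hG; rewrite /boxsum.
under eq_bigr => x _.
  under eq_bigr => y _.
    rewrite (@sum_crt a b (F x y) (G x y)) //; last first.
    - by move=> z; have [_ _ ->] := hG x y z.
    - by move=> z; have [_ _ ->] := hF x y z.
    over.
  rewrite (@sum_crt a b (fun y => \sum_(z < a) F x y z) (fun y => \sum_(z < b) G x y z)) //; last first.
  - by move=> y; apply: eq_bigr => z _; have [_ -> _] := hG x y z.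
  - by move=> y; apply: eq_bigr => z _; have [_ -> _] := hF x y z.
  over.
rewrite (@sum_crt a b (fun x => \sum_(y < a) \sum_(z < a) F x y z)
  (fun x => \sum_(y < b) \sum_(z < b) G x y z)) //.
- by move=> x; apply: eq_bigr => y _; apply: eq_bigr => z _; have [-> _ _] := hF x y z.
- by move=> x; apply: eq_bigr => y _; apply: eq_bigr => z _; have [-> _ _] := hG x y z.
Qed.

Lemma boxsum_periodic a k F : periodic3 a F ->
  boxsum (k * a) (k * a) (k * a) F = k%:R ^+ 3 * boxsum a a a F.
Proof.
move=> hF; rewrite /boxsum.
under eq_bigr => x _.
  under eq_bigr => y _.
    rewrite (@sum_periodic a k (F x y)); last by move=> z; have [_ _ ->] := hF x y z.
    over.
  rewrite -mulr_sumr (@sum_periodic a k (fun y => \sum_(z < a) F x y z)); last first.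
    by move=> y; apply: eq_bigr => z _; have [_ -> _] := hF x y z.
  over.
rewrite -!mulr_sumr (@sum_periodic a k (fun x => \sum_(y < a) \sum_(z < a) F x y z)).
  by rewrite !exprS expr0; ring.
by move=> x; apply: eq_bigr => y _; apply: eq_bigr => z _; have [-> _ _] := hF x y z.
Qed.

Lemma sum_trunc_le f (B : R) N N' : (N' <= N)%N -> (forall x, `|f x| <= B) ->
  `|\sum_(x < N) f x - \sum_(x < N') f x| <= (N - N')%:R * B.
Proof.
move=> NN hf; rewrite -!(big_mkord xpredT f) (big_cat_nat (n := N')) //= addrAC subrr add0r.
apply: le_trans (ler_norm_sum _ _ _) _.
apply: le_trans (_ : \sum_(N' <= i < N) B <= _); first exact: ler_sum.
by rewrite sumr_const_nat mulr_natl.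
Qed.

Lemma sum_bound f (B : R) N : (forall x, `|f x| <= B) -> `|\sum_(x < N) f x| <= N%:R * B.
Proof.
move=> hf; have := sum_trunc_le (leq0n N) hf; by rewrite big_ord0 subr0 subn0.
Qed.

(** The largest cube whose side is a multiple of [M] is summed exactly; the
    three slabs left over have at most [N^2 M] points each. *)
Lemma boxsum_approx N M F : (0 < M)%N -> periodic3 M F ->
  (forall x y z, `|F x y z| <= 1) ->
  boxsum N N N F <= (N %/ M)%:R ^+ 3 * boxsum M M M F + 3 * N%:R ^+ 2 * M%:R.
Proof.
move=> M0 pF hF; rewrite -boxsum_periodic //; set N' := (N %/ M * M)%N.
have NN : (N' <= N)%N by apply: leq_divM.
have dN : (N - N')%:R <= M%:R :> R.
  by rewrite ler_nat /N'; have := divn_eq N M; have := ltn_pmod N M0; lia.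
have N0 : 0 <= N%:R :> R by [].
have N'N : N'%:R <= N%:R :> R by rewrite ler_nat.
have e1 : `|boxsum N N N F - boxsum N' N N F| <= (N - N')%:R * (N%:R * (N%:R * 1)).
  by apply: (@sum_trunc_le (fun x => \sum_(y < N) \sum_(z < N) F x y z)) => // x; apply: (@sum_bound (fun y => \sum_(z < N) F x y z)) => y; exact: (@sum_bound (F x y)).
have e2 : `|boxsum N' N N F - boxsum N' N' N F| <= N'%:R * ((N - N')%:R * (N%:R * 1)).
  rewrite /boxsum -sumrB; apply: (@sum_bound (fun x => \sum_(y < N) \sum_(z < N) F x y z - \sum_(y < N') \sum_(z < N) F x y z)) => x.
  by apply: (@sum_trunc_le (fun y => \sum_(z < N) F x y z)) => // y; exact: (@sum_bound (F x y)).
have e3 : `|boxsum N' N' N F - boxsum N' N' N' F| <= N'%:R * (N'%:R * ((N - N')%:R * 1)).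
  rewrite /boxsum -sumrB; under eq_bigr do rewrite -sumrB.
  apply: (@sum_bound (fun x => \sum_(y < N') (\sum_(z < N) F x y z - \sum_(z < N') F x y z))) => x.
  apply: (@sum_bound (fun y => (\sum_(z < N) F x y z - \sum_(z < N') F x y z))) => y.
  by apply: (@sum_trunc_le (fun z => F x y z)) => // z.
move: e1 e2 e3; rewrite !mulr1 !ler_norml => /andP[_ e1] /andP[_ e2] /andP[_ e3].
have M0R : 0 <= M%:R :> R by [].
have N'0 : 0 <= N'%:R :> R by [].
have d0 : 0 <= (N - N')%:R :> R by [].
have b1 : (N - N')%:R * (N%:R * N%:R) <= N%:R ^+ 2 * M%:R :> R.
  by rewrite mulrC expr2 ler_wpM2l // mulr_ge0.
have b2 : N'%:R * ((N - N')%:R * N%:R) <= N%:R ^+ 2 * M%:R :> R.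
  by rewrite expr2 -mulrA ler_pM // ?mulr_ge0 // mulrC ler_wpM2l.
have b3 : N'%:R * (N'%:R * (N - N')%:R) <= N%:R ^+ 2 * M%:R :> R.
  by rewrite expr2 -mulrA ler_pM // ?mulr_ge0 // ler_pM.
lra.
Qed.

Lemma boxsum_sum (T : finType) (P : pred T) (F : T -> nat -> nat -> nat -> R) a b c :
  boxsum a b c (fun x y z => \sum_(t | P t) F t x y z) = \sum_(t | P t) boxsum a b c (F t).
Proof.
rewrite /boxsum [RHS]exchange_big /=; apply: eq_bigr => x _.
rewrite [RHS]exchange_big /=; apply: eq_bigr => y _.
by rewrite [RHS]exchange_big.
Qed.

Lemma boxsum_if q (b : nat -> nat -> nat -> bool) (u w : R) :
  boxsum q q q (fun x y z => if b x y z then u else w) =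
  w * q%:R ^+ 3 + (u - w) * boxsum q q q (fun x y z => (b x y z)%:R).
Proof.
have -> : boxsum q q q (fun x y z => if b x y z then u else w) =
   boxsum q q q (fun x y z => w + (u - w) * (b x y z)%:R).
  by apply: eq_boxsum => x y z; case: (b x y z); rewrite ?mulr1 ?mulr0 ?addr0 // addrC subrK.
rewrite /boxsum; under eq_bigr do under eq_bigr do rewrite big_split /= -mulr_sumr sumr_const card_ord.
under eq_bigr do rewrite big_split /= -mulr_sumr sumr_const card_ord.
rewrite big_split /= -mulr_sumr sumr_const card_ord; congr (_ + _).
rewrite -!mulrnA -[LHS]mulr_natr !natrM; ring.
Qed.

Lemma boxsum_le_cube (N : nat) (b : nat -> nat -> nat -> bool) :
  boxsum N N N (fun x y z => (b x y z)%:R) <= N%:R ^+ 3 :> R.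
Proof.
apply: (@le_trans _ _ (boxsum N N N (fun x y z => 1))).
  by do 3!apply: ler_sum => ? _; rewrite lern1 leq_b1.
rewrite /boxsum !sumr_const !card_ord -!mulrnA -natrX.
by rewrite ler_nat !expnS expn0 muln1 ?mulnA.
Qed.

End Cube.

(** * The sieve *)

Section Sieve.
Variable R : realFieldType.
Variables (I : finType) (pr : I -> nat).
Hypothesis pr_inj : injective pr.
Hypothesis pr_prime : forall i, prime (pr i).

Lemma boxsum_prod (s : seq I) (F : I -> nat -> nat -> nat -> R) :
  uniq s -> (forall i, periodic3 (pr i ^ 2) (F i)) ->
  let M := (\prod_(i <- s) pr i ^ 2)%N in
  periodic3 M (fun x y z => \prod_(i <- s) F i x y z) /\
  boxsum M M M (fun x y z => \prod_(i <- s) F i x y z) =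
  \prod_(i <- s) boxsum (pr i ^ 2) (pr i ^ 2) (pr i ^ 2) (F i).
Proof.
move=> us hF /=; elim: s us => [|i s IH] /=.
  move=> _; split; first by move=> x y z; rewrite !big_nil.
  by rewrite /boxsum !big_nil !big_ord1 big_nil.
move=> /andP[is_ us]; have [hp hb] := IH us.
have E x y z : \prod_(j <- i :: s) F j x y z = F i x y z * \prod_(j <- s) F j x y z by rewrite big_cons.
split; first by rewrite big_cons => x y z; rewrite !E; have [] := periodic3M (hF i) hp x y z.
rewrite !big_cons (eq_boxsum _ _ _ E) boxsum_crt ?hb //.
- rewrite coprime_sym coprime_pexpr // coprime_sym prime_coprime // Euclid_dvd_prod // big_has.
  apply/hasPn => j js; rewrite Euclid_dvdX // andbT dvdn_prime2 //.
  by apply: (contraNN _ is_) => /eqP/pr_inj ->.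
- by rewrite expn_gt0 prime_gt0.
- by apply: prodn_gt0 => j; rewrite expn_gt0 prime_gt0.
Qed.

(** [v i] is a centred version of the indicator function of the classes excluded
    at the [i]-th prime: it is constant, equal to [g i], on the classes that
    are kept, and it has mean zero. *)
Variables (v : I -> nat -> nat -> nat -> R) (g : I -> R).
Hypothesis v_per : forall i, periodic3 (pr i ^ 2) (v i).
Hypothesis v_le1 : forall i x y z, `|v i x y z| <= 1.
Hypothesis v_mean : forall i, boxsum (pr i ^ 2) (pr i ^ 2) (pr i ^ 2) (v i) = 0.
Hypothesis v_sqr : forall i,
  boxsum (pr i ^ 2) (pr i ^ 2) (pr i ^ 2) (fun x y z => v i x y z ^+ 2) = (pr i ^ 6)%:R * g i.
Hypothesis g_ge0 : forall i, 0 <= g i.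

Definition modulus (A : {set I}) := (\prod_(i in A) pr i)%N.

Lemma modulus_gt0 A : (0 < modulus A)%N.
Proof. by apply: prodn_cond_gt0 => i _; exact: prime_gt0. Qed.

Lemma modulus_inj : injective modulus.
Proof.
move=> A B e; apply/setP => i.
have mem (C : {set I}) : (i \in C) = (pr i %| modulus C)%N.
  rewrite /modulus Euclid_dvd_prod //; apply/idP/idP => [iC|].
    by rewrite (bigD1 i) //= dvdnn.
  rewrite big_has_cond => /hasP[j _ /andP[jC]].
  by rewrite dvdn_prime2 // => /eqP/pr_inj ->.
by rewrite !mem e.
Qed.

(** The products of the [v i] over distinct sets of primes are orthogonal over a
    full period, by the Chinese remainder theorem and [v_mean]. *)
Lemma cross_term N Q (A B : {set I}) : (modulus A <= Q)%N -> (modulus B <= Q)%N ->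
  boxsum N N N (fun x y z => (\prod_(i in A) v i x y z) * (\prod_(i in B) v i x y z)) <=
  (if A == B then N%:R ^+ 3 * \prod_(i in A) g i else 0) + 3 * N%:R ^+ 2 * Q%:R ^+ 4.
Proof.
move=> AQ BQ; pose w i x y z : R :=
  (if i \in A then v i x y z else 1) * (if i \in B then v i x y z else 1).
pose C := A :|: B; pose s := enum C.
have wper i : periodic3 (pr i ^ 2) (w i).
  by move=> x y z; rewrite /w; have [-> -> ->] := v_per i x y z.
have [hp hb] := boxsum_prod (enum_uniq C) wper.
set M := (\prod_(i <- _) _)%N in hp hb.
have ME : M = (modulus C ^ 2)%N.
  by rewrite /M big_enum /= /modulus -mulnn -big_split; apply: eq_bigr => i _; rewrite -mulnn.
have prodC (S : comPzSemiRingType) (D : {set I}) (f : I -> S) : D \subset C ->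
    \prod_(i <- s) (if i \in D then f i else 1) = \prod_(i in D) f i.
  move=> /subsetP DC; rewrite big_enum -big_mkcondr /=; apply: eq_bigl => i.
  by rewrite andbC; case: (boolP (i \in D)) => //= /DC.
have sA : A \subset C by apply: subsetUl.
have sB : B \subset C by apply: subsetUr.
have Fw x y z : (\prod_(i in A) v i x y z) * (\prod_(i in B) v i x y z) = \prod_(i <- s) w i x y z.
  by rewrite -(prodC _ A (fun i => v i x y z)) // -(prodC _ B (fun i => v i x y z)) // -big_split.
have MQ : (M <= Q ^ 4)%N.
  rewrite ME -[4%N]/(2 * 2)%N expnM leq_exp2r //.
  apply: (@leq_trans (modulus A * modulus B)); last by rewrite -mulnn leq_mul.
  have := prodC _ A pr sA; have := prodC _ B pr sB; rewrite -/(modulus A) -/(modulus B) => <- <-.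
  rewrite -big_split /= /s big_enum /=; apply: leq_prod => i; rewrite inE.
  have p0 := prime_gt0 (pr_prime i).
  by case: (i \in A); case: (i \in B) => //= _; rewrite ?muln1 ?mul1n // leq_pmulr.
have M0 : (0 < M)%N by rewrite ME expn_gt0 modulus_gt0.
have W1 x y z : `|\prod_(i <- s) w i x y z| <= 1.
  rewrite normr_prod; apply: prodr_ile1 => i _; rewrite normr_ge0 /= /w normrM.
  by rewrite mulr_ile1 //; case: ifP => _; rewrite ?normr1.
rewrite (eq_boxsum _ _ _ Fw); have := boxsum_approx N M0 hp W1; rewrite hb => /le_trans; apply; apply: lerD; last first.
  by rewrite ler_wpM2l ?mulr_ge0 ?exprn_ge0 // -natrX ler_nat.
have [AB|AB] := eqVneq A B.
  have -> : \prod_(i <- s) boxsum (pr i ^ 2) (pr i ^ 2) (pr i ^ 2) (w i) = M%:R ^+ 3 * \prod_(i in A) g i.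
    rewrite /s big_enum /= /C -AB setUid /M /s big_enum /= /C -AB setUid.
    rewrite natr_prod -prodrXl -big_split /=; apply: eq_bigr => i iA.
    rewrite -natrX -expnM -v_sqr /w -AB iA; apply: eq_boxsum => x y z.
    by rewrite expr2.
  rewrite mulrA -exprMn ler_wpM2r ?prodr_ge0 // lerXn2r ?nnegrE ?mulr_ge0 //.
  by rewrite -natrM ler_nat leq_divM.
(* A prime in exactly one of the two sets contributes a factor of mean zero. *)
have [i hi] : exists i, (i \in A) != (i \in B).
  apply/existsP; apply: contraNT AB => /existsPn h; apply/eqP/setP => i.
  by apply/eqP; rewrite -[_ == _]negbK h.
have iC : i \in C by rewrite inE; case: (i \in A) hi; case: (i \in B).
rewrite /s big_enum (bigD1 i) //=.
have -> : boxsum (pr i ^ 2) (pr i ^ 2) (pr i ^ 2) (w i) = 0.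
  rewrite -(v_mean i) /w; apply: eq_boxsum => x y z.
  by case: (i \in A) hi; case: (i \in B) => //= _; rewrite ?mulr1 ?mul1r.
by rewrite mul0r mulr0.
Qed.

(** The function [T], the sum over the admissible sets [A] of the product of the
    [v i] for [i] in [A], equals [L] on the triples that survive.  Its mean
    square is close to [L] by orthogonality, so the survivors number at most
    about [N^3 L / L^2].  The bound on [Q] makes the error of [cross_term]
    harmless, as there are at most [Q ^ 2] pairs of sets. *)
Theorem sieve_bound (sol : nat -> nat -> nat -> bool) N Q :
  (forall x y z i, sol x y z -> v i x y z = g i) ->
  (0 < Q)%N -> (Q ^ 6 <= N)%N ->
  boxsum N N N (fun x y z => (sol x y z)%:R) *
    (\sum_(A : {set I} | (modulus A <= Q)%N) \prod_(i in A) g i) <= 4 * N%:R ^+ 3.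
Proof.
move=> hsol Q0 QN; set L := \sum_(A | _) _.
pose adm (A : {set I}) := (modulus A <= Q)%N.
pose T x y z := \sum_(A | adm A) \prod_(i in A) v i x y z.
have L1 : 1 <= L.
  rewrite /L (bigD1 set0) /= ?big_set0 ?lerDl; last by rewrite /modulus big_set0.
  by apply: sumr_ge0 => A _; apply: prodr_ge0.
(* An admissible set is determined by its modulus, which lies between [1] and [Q]. *)
have cadm : (#|adm| <= Q)%N.
  pose h (A : {set I}) : 'I_Q.-1.+1 := inord (modulus A).-1.
  have -> : Q = #|'I_Q.-1.+1| by rewrite card_ord prednK.
  apply: (@leq_card_in _ _ h adm) => A B hA0 hB0.
  have hA : (modulus A <= Q)%N := hA0; have hB : (modulus B <= Q)%N := hB0.
  move=> /(congr1 val) /=; rewrite !inordK; first last.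
  - by rewrite prednK // ; have := modulus_gt0 A; move: hA; lia.
  - by rewrite prednK // ; have := modulus_gt0 B; move: hB; lia.
  move=> e; apply: modulus_inj; have := modulus_gt0 A; have := modulus_gt0 B; lia.
have T2 : boxsum N N N (fun x y z => T x y z ^+ 2) <= N%:R ^+ 3 * L + 3 * N%:R ^+ 2 * Q%:R ^+ 6.
  have -> : boxsum N N N (fun x y z => T x y z ^+ 2) =
     \sum_(A | adm A) \sum_(B | adm B) boxsum N N N
       (fun x y z => (\prod_(i in A) v i x y z) * (\prod_(i in B) v i x y z)).
    under eq_bigr do rewrite -boxsum_sum.
    rewrite -boxsum_sum; apply: eq_boxsum => x y z.
    by rewrite expr2 /T big_distrlr.
  apply: (@le_trans _ _ (\sum_(A | adm A) \sum_(B | adm B)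
     ((if A == B then N%:R ^+ 3 * \prod_(i in A) g i else 0) + 3 * N%:R ^+ 2 * Q%:R ^+ 4))).
    by apply: ler_sum => A hA; apply: ler_sum => B hB; exact: cross_term.
  under eq_bigr do rewrite big_split /=.
  rewrite big_split /=; apply: lerD.
    rewrite mulr_sumr; apply: ler_sum => A hA.
    rewrite (bigD1 A) //= eqxx [X in _ + X]big1 ?addr0 // => B /andP[_ BA].
    by rewrite eq_sym (negPf BA).
  under eq_bigr do rewrite sumr_const -[_ *+ _]mulr_natr.
  rewrite sumr_const -[_ *+ _]mulr_natr -2!mulrA ler_wpM2l ?mulr_ge0 ?exprn_ge0 //.
  rewrite (exprD _ 4 2) mulrA -mulrA ler_wpM2l ?exprn_ge0 // expr2 -!natrM ler_nat.
  by apply: leq_mul; exact: cadm.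
(* [T] equals [L] at every surviving triple. *)
have sT : boxsum N N N (fun x y z => (sol x y z)%:R) * L ^+ 2 <= boxsum N N N (fun x y z => T x y z ^+ 2).
  rewrite /boxsum; do 3!(rewrite mulr_suml; apply: ler_sum => ? _).
  set b := sol _ _ _; case: (boolP b) => hb; last by rewrite mul0r sqr_ge0.
  rewrite mul1r /T /L le_eqVlt; apply/orP; left; apply/eqP.
  by congr (_ ^+ 2); apply: eq_bigr => A _; apply: eq_bigr => i _; rewrite (hsol _ _ _ i hb).
have N0 : 0 <= N%:R :> R by [].
have Q6 : Q%:R ^+ 6 <= N%:R :> R by rewrite -natrX ler_nat.
have L0 : 0 < L by apply: lt_le_trans L1.
rewrite -(ler_pM2r L0) -mulrA -expr2; apply: le_trans sT _; apply: le_trans T2 _.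
have h1 : 3 * N%:R ^+ 2 * Q%:R ^+ 6 <= 3 * N%:R ^+ 2 * N%:R :> R.
  by rewrite ler_wpM2l // mulr_ge0 ?exprn_ge0.
have h2 : N%:R ^+ 3 <= N%:R ^+ 3 * L by rewrite ler_peMr ?exprn_ge0.
move: h1 h2; lra.
Qed.

End Sieve.

Section Rankin.
Variable R : realType.

Lemma expR1_bounds : 2 <= expR (1 : R) <= 4.
Proof.
apply/andP; split; first by have := expR_ge1Dx (1 : R); lra.
have h : expR (- 2^-1) >= 2^-1 :> R by have := expR_ge1Dx (- 2^-1 : R); lra.
have -> : 1 = 2^-1 + 2^-1 :> R by lra.
have e0 : 0 < expR 2^-1 :> R := expR_gt0 _.
have : expR 2^-1 <= 2 :> R.
  have := ler_wpM2l (ltW e0) h; rewrite -expRD subrr expR0; lra.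
rewrite expRD; nra.
Qed.

Lemma expR_le_lin (x : R) : 0 <= x <= 1 -> expR x <= 1 + 4 * x.
Proof.
move=> /andP[x0 x1]; have := expR_ge1Dx (- x).
have e0 : 0 < expR x := expR_gt0 _.
move=> /(ler_wpM2l (ltW e0)); rewrite -expRD subrr expR0.
have /andP[_ e4] := expR1_bounds.
have : expR x <= 4 by apply: le_trans e4; rewrite ler_expR.
nra.
Qed.

Lemma sum_subsets (I : finType) (f : I -> R) :
  \sum_(A : {set I}) \prod_(i in A) f i = \prod_i (1 + f i).
Proof.
under [RHS]eq_bigr do rewrite addrC.
by rewrite bigA_distr; apply: eq_bigr => A _; rewrite [LHS]big_mkcond.
Qed.

Variables (I : finType) (pr : I -> nat) (w : I -> R) (J : nat).
Hypothesis J0 : (0 < J)%N.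
Hypothesis pr_ge : forall i, (7 <= pr i)%N.
Hypothesis pr_lt : forall i, (pr i < 2 ^ J)%N.
Hypothesis w_ge0 : forall i, 0 <= w i.
Hypothesis w_le : forall i, w i <= 3 / (pr i)%:R.
Hypothesis sum_log : \sum_i ln (pr i)%:R / (pr i)%:R <= J%:R * (4 * ln 2) :> R.
Let g i := w i / (1 - w i).

(** The complete sum, over all sets, is the product of the [1 + g i], that is of
    the [1 / (1 - w i)], and exceeds the exponential of the sum of the [w i].
    The sets with [modulus A > Q] are weighted by [(modulus A / Q) ^ d] with
    [d = 1 / ln (2 ^ J)]; the weights multiply the product by at most
    [exp 96] and divide it by [Q ^ d = exp 97], so that these sets carry at
    most half of the sum. *)
Lemma rankin_lower_bound : 2^-1 * expR (\sum_i w i) <=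
  \sum_(A : {set I} | (modulus pr A <= 2 ^ (97 * J))%N) \prod_(i in A) g i.
Proof.
have w_half i : w i <= 2^-1.
  apply: le_trans (w_le i) _; rewrite ler_pdivrMr ?ltr0n; last by have := pr_ge i; lia.
  have : 7 <= (pr i)%:R :> R by rewrite (ler_nat R 7).
  lra.
have g0 i : 0 <= g i by rewrite divr_ge0 ?w_ge0 //; have := w_half i; lra.
(* [w i <= 3 / p], and [1 - w i >= 1 / 2]. *)
have gle i : g i <= 6 / (pr i)%:R.
  have h := w_half i; rewrite /g ler_pdivrMr; last by lra.
  have := w_le i; have : 0 <= (pr i)%:R^-1 :> R by rewrite invr_ge0.
  move: ((pr i)%:R^-1) => y y0 h2; have := w_ge0 i; nra.
have ln2 : 0 < ln 2 :> R by rewrite ln_gt0 // ltr1n.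
have JR : 0 < J%:R :> R by rewrite ltr0n.
pose d : R := (J%:R * ln 2)^-1.
have d0 : 0 < d by rewrite invr_gt0 mulr_gt0.
pose e i := expR (d * ln (pr i)%:R).
have ple i : 0 <= d * ln (pr i)%:R <= 1.
  rewrite mulr_ge0 ?(ltW d0) ?ln_ge0 ?ler1n //=; last by have := pr_ge i; lia.
  rewrite mulrC ler_pdivrMr ?mulr_gt0 // mul1r -ln_exp2n.
  rewrite ler_ln ?posrE ?ltr0n ?expn_gt0 //; last by have := pr_ge i; lia.
  by rewrite ler_nat ltnW.
pose P := \prod_i (1 + g i).
have P0 : 0 < P by apply: prodr_gt0 => i _; have := g0 i; lra.
set Q := (2 ^ (97 * J))%N.
have gA0 A : 0 <= \prod_(i in A) g i by apply: prodr_ge0.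
have lnQ : d * ln Q%:R = 97%:R :> R.
  by rewrite /Q ln_exp2n natrM -mulrA mulrCA /d mulVf ?mulr1 // mulf_neq0 // gt_eqF.
have tail : \sum_(A : {set I} | ~~ (modulus pr A <= Q)%N) \prod_(i in A) g i <= 2^-1 * P.
  have t1 : \sum_(A : {set I} | ~~ (modulus pr A <= Q)%N) \prod_(i in A) g i <=
     \sum_(A : {set I}) \prod_(i in A) (g i * e i) * expR (- (97%:R)).
    rewrite big_mkcond; apply: ler_sum => A _ /=.
    have ee : \prod_(i in A) e i = expR (d * ln (modulus pr A)%:R).
      have [] : (0 < \prod_(i in A) pr i)%N /\ \prod_(i in A) e i = expR (d * ln (\prod_(i in A) pr i)%N%:R); last by [].
      elim/big_rec2: _ => [|i x y iA [x0 ->]]; first by rewrite ln1 mulr0 expR0.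
      have p0 : (0 < pr i)%N by have := pr_ge i; lia.
      rewrite muln_gt0 x0 p0; split=> //.
      by rewrite natrM lnM ?posrE ?ltr0n // mulrDr expRD.
    have gp : 0 <= \prod_(i in A) (g i * e i) by apply: prodr_ge0 => i _; rewrite mulr_ge0 // expR_ge0.
    case: ifP => [|_]; last by rewrite mulr_ge0 // expR_ge0.
    rewrite -ltnNge => QA. rewrite [X in _ <= X * _]big_split /= -mulrA ler_peMr // ee -expRD.
    rewrite -[X in X <= _]expR0 ler_expR -lnQ subr_ge0 ler_wpM2l ?(ltW d0) //.
    by rewrite ler_ln ?posrE ?ltr0n ?expn_gt0 //; [rewrite ler_nat ltnW | lia].
  apply: le_trans t1 _; rewrite -mulr_suml sum_subsets.
  (* Here [e i <= 1 + 4 d ln p] and [g i <= 6 / p], and [sum_log] supplies the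
     factor [4] in [96 = 6 * 4 * 4]. *)
  have t2 : \prod_i (1 + g i * e i) <= P * expR 96.
    apply: (@le_trans _ _ (\prod_i ((1 + g i) * expR (g i * (4 * (d * ln (pr i)%:R)))))).
      apply: ler_prod => i _; have -> /= : 0 <= 1 + g i * e i by apply: addr_ge0 => //; apply: mulr_ge0 (g0 i) (expR_ge0 _).
      have h1 := expR_le_lin (ple i); have h2 := g0 i.
      have := expR_ge1Dx (g i * (4 * (d * ln (pr i)%:R))).
      have /andP[h3 _] := ple i; rewrite -/(e i) in h1.
      move: (e i) (d * ln (pr i)%:R) h1 h3 => ei x h1 h3; move: (expR (g i * (4 * x))) => E h4. move: (g i) h2 h4 => gi h2 h4.
      have h5 := ler_wpM2l h2 h1.
      have : 0 <= gi * (gi * (4 * x)) by rewrite !mulr_ge0.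
      have : (1 + gi) * (1 + gi * (4 * x)) <= (1 + gi) * E by rewrite ler_wpM2l // addr_ge0.
      nra.
    rewrite [X in X <= _]big_split /= -/P ler_pM2l // -expR_sum ler_expR.
    apply: (@le_trans _ _ (\sum_i (24 * d) * (ln (pr i)%:R / (pr i)%:R))).
      apply: ler_sum => i _; have /andP[h3 _] := ple i.
      have := ler_wpM2r h3 (gle i); lra.
    rewrite -mulr_sumr; have d1 : 0 <= 24 * d by rewrite mulr_ge0 // ltW.
    have := ler_wpM2l d1 sum_log.
    have -> : 24 * d * (J%:R * (4 * ln 2)) = 96 :> R.
      by rewrite /d; field; rewrite !gt_eqF.
    by [].
  apply: (@le_trans _ _ (P * expR 96 * expR (- (97%:R)))).
    by rewrite ler_wpM2r // expR_ge0.
  rewrite -mulrA -expRD mulrC ler_pM2r //.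
  have -> : 96 + - (97%:R) = - (1) :> R by lra.
  rewrite expRN lef_pV2 ?posrE ?expR_gt0 //.
  by case/andP: expR1_bounds.
have PL : P = \sum_(A : {set I} | (modulus pr A <= Q)%N) \prod_(i in A) g i +
   \sum_(A : {set I} | ~~ (modulus pr A <= Q)%N) \prod_(i in A) g i.
  by rewrite /P -sum_subsets (bigID (fun A : {set I} => (modulus pr A <= Q)%N)).
have eP : expR (\sum_i w i) <= P.
  rewrite expR_sum; apply: ler_prod => i _; rewrite expR_ge0 /=.
  have h := w_half i; have -> : 1 + g i = (1 - w i)^-1.
    by rewrite /g; field; rewrite gt_eqF //; lra.
  rewrite -[expR _]invrK lef_pV2 ?posrE ?invr_gt0 ?expR_gt0 //; last by lra.
  by rewrite -expRN; have := expR_ge1Dx (- w i); lra.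
lra.
Qed.

End Rankin.

(** * A local obstruction and its density *)

Definition int_soluble (l : nat) (a b c : int) : Prop :=
  exists x y z : int, [|| x != 0, y != 0 | z != 0] /\ a * x ^+ l + b * y ^+ l + c * z ^+ l = 0.

(** Infinite descent: a common factor [p] of the coordinates is divided out. *)
Lemma int_soluble_prim l a b c p : prime p -> (0 < l)%N -> int_soluble l a b c ->
  exists x y z : int, ~~ [&& (p %| x)%Z, (p %| y)%Z & (p %| z)%Z] /\
     a * x ^+ l + b * y ^+ l + c * z ^+ l = 0.
Proof.
move=> pp l0 [x [y [z [nz e]]]].
have [N] := ubnP (`|x| + `|y| + `|z|)%N; elim: N x y z nz e => // N IH x y z nz e hN.
have [/and3P[/dvdzP[x' ex] /dvdzP[y' ey] /dvdzP[z' ez]]|h] := boolP [&& (p %| x)%Z, (p %| y)%Z & (p %| z)%Z]; last first.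
  by exists x, y, z.
have p1 := prime_gt1 pp.
apply: (IH x' y' z').
- move: nz; rewrite ex ey ez !mulf_eq0 !negb_or.
  by case/or3P=> /andP[-> _]; rewrite ?orbT.
- have : p%:Z ^+ l * (a * x' ^+ l + b * y' ^+ l + c * z' ^+ l) = 0.
    by rewrite -e ex ey ez !exprMn; ring.
  by move/eqP; rewrite mulf_eq0 expf_eq0 l0 /= => /orP[/eqP|/eqP//]; lia.
- by move: hN nz; rewrite ex ey ez !abszM; nia.
Qed.

Section Obstruction.
Variables (l p : nat).
Hypothesis pp : prime p.
Local Notation e := (p.-1 %/ l)%N.

Lemma Fp_fermat (x : 'F_p) : x != 0 -> x ^+ p.-1 = 1.
Proof.
move=> x0; apply: (mulfI x0); rewrite mulr1 -exprS prednK ?prime_gt0 //.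
by rewrite -[X in _ ^+ X](card_Fp pp) expf_card.
Qed.

Lemma Fp_intr_eq0 (x : int) : ((x%:~R : 'F_p) == 0) = (p %| x)%Z.
Proof.
have aux (k : nat) : ((k%:R : 'F_p) == 0) = (p %| k)%N by rewrite -(dvdn_pcharf (pchar_Fp pp)).
rewrite dvdzE /=; case: (intP x) => [|k|k]; first by rewrite mulr0z eqxx dvdn0.
  by rewrite -pmulrn aux.
by rewrite mulrNz oppr_eq0 -pmulrn aux abszN.
Qed.

(** For [p = 1] modulo [l] and units [b], [c] the last condition says that
    [- b / c] is not an [l]-th power modulo [p], by Euler's criterion. *)
Definition nonpower (b c : int) : bool :=
  [&& (b%:~R : 'F_p) != 0, (c%:~R : 'F_p) != 0 & (b%:~R : 'F_p) ^+ e != (- (c%:~R)) ^+ e].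

Definition exactly (a : int) : bool := (p %| a)%Z && ~~ ((p ^ 2)%N %| a)%Z.

Definition obstructed1 (a b c : int) : bool := exactly a && nonpower b c.

Definition obstructed (a b c : int) : bool := [|| obstructed1 a b c, obstructed1 b c a | obstructed1 c a b].

Lemma Fp_intrD (a k : int) : ((a + (p ^ 2)%N%:Z * k)%:~R : 'F_p) = a%:~R.
Proof.
rewrite rmorphD rmorphM /=; have -> : ((p ^ 2)%N%:Z%:~R : 'F_p) = 0.
  by apply/eqP; rewrite Fp_intr_eq0 dvdzE /= dvdn_exp.
by rewrite mul0r addr0.
Qed.

Lemma obstructed1D1 a b c k : obstructed1 (a + (p ^ 2)%N%:Z * k) b c = obstructed1 a b c.
Proof.
rewrite /obstructed1 /exactly; congr (_ && ~~ _ && _); last by rewrite rpredDr // dvdz_mulr.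
by rewrite rpredDr // dvdz_mulr // dvdzE /= dvdn_exp.
Qed.

Lemma obstructed1D2 a b c k : obstructed1 a (b + (p ^ 2)%N%:Z * k) c = obstructed1 a b c.
Proof. by rewrite /obstructed1 /nonpower Fp_intrD. Qed.

Lemma obstructed1D3 a b c k : obstructed1 a b (c + (p ^ 2)%N%:Z * k) = obstructed1 a b c.
Proof. by rewrite /obstructed1 /nonpower Fp_intrD. Qed.

Lemma obstructed_periodic (h : nat) (R : realFieldType) (u w : R) :
  periodic3 (p ^ 2) (fun x y z : nat =>
    if obstructed (x%:Z - h%:Z) (y%:Z - h%:Z) (z%:Z - h%:Z) then u else w).
Proof.
move=> x y z; have E t : (t %% p ^ 2)%N%:Z - h%:Z = (t%:Z - h%:Z) + (p ^ 2)%N%:Z * - (t %/ p ^ 2)%N%:Z.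
  by have := divn_eq t (p ^ 2); lia.
by split; rewrite E /obstructed ?(obstructed1D1, obstructed1D2, obstructed1D3).
Qed.

Variable R : realFieldType.

Definition obstructed1_count : R := boxsum (p ^ 2) (p ^ 2) (p ^ 2)
  (fun x y z : nat => (obstructed1 x y z)%:R).

Lemma sum_exactly : \sum_(x < p ^ 2) (exactly (x : nat))%:R = p.-1%:R :> R.
Proof.
have p0 := prime_gt0 pp.
have -> : \sum_(x < p ^ 2) (exactly (x : nat))%:R =
   \sum_(x < p ^ 2) ((p %| x)%N%:R - ((x : nat) == 0%N)%:R) :> R.
  apply: eq_bigr => x _; rewrite /exactly !dvdzE /=.
  have -> : (p ^ 2 %| x)%N = ((x : nat) == 0%N).
    by case: posnP => [->|x0]; rewrite ?dvdn0 // gtnNdvd.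
  case: eqP => [->|_]; first by rewrite dvdn0 subrr.
  by rewrite andbT subr0.
rewrite sumrB sum_eq0n ?expn_gt0 ?p0 // -mulnn.
rewrite (@sum_periodic R p p (fun x => (p %| x)%N%:R)) => [|x]; last by rewrite /dvdn modn_mod.
have -> : \sum_(x < p) (p %| x)%N%:R = \sum_(x < p) ((x : nat) == 0%N)%:R :> R.
  apply: eq_bigr => x _; congr (nat_of_bool _)%:R.
  by case: posnP => [->|x0]; rewrite ?dvdn0 // gtnNdvd.
by rewrite sum_eq0n // mulr1 -subn1 natrB.
Qed.

Lemma nonpower_per (b c : nat) :
  nonpower (b %% p)%N c = nonpower b c /\ nonpower b (c %% p)%N = nonpower b c.
Proof.
have E (t : nat) : ((t %% p)%N%:Z%:~R : 'F_p) = t%:Z%:~R.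
  rewrite -!pmulrn [in RHS](divn_eq t p) natrD natrM.
  by rewrite (_ : p%:R = 0 :> 'F_p) ?mulr0 ?add0r //; apply: pcharf0; exact: pchar_Fp.
by rewrite /nonpower !E.
Qed.

Definition nonpower_count : R := \sum_(y < p) \sum_(z < p) (nonpower (y : nat) (z : nat))%:R.

Lemma obstructed1_countE : obstructed1_count = p.-1%:R * (p ^ 2)%:R * nonpower_count.
Proof.
rewrite /obstructed1_count /boxsum.
have -> : p.-1%:R * (p ^ 2)%:R * nonpower_count = \sum_(x < p ^ 2) (exactly (x : nat))%:R * ((p ^ 2)%:R * nonpower_count).
  by rewrite -mulr_suml sum_exactly mulrA.
apply: eq_bigr => x _; rewrite /obstructed1.
have -> : (p ^ 2)%:R * nonpower_count = \sum_(y < p ^ 2) \sum_(z < p ^ 2) (nonpower (y : nat) (z : nat))%:R.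
  rewrite -mulnn natrM -mulrA /nonpower_count mulr_sumr.
  rewrite (@sum_periodic R p p (fun y => \sum_(z < p * p) (nonpower y (z : nat))%:R)); last first.
    by move=> y; apply: eq_bigr => z _; rewrite (nonpower_per y z).1.
  congr (_ * _); apply: eq_bigr => y _.
  rewrite (@sum_periodic R p p (fun z => (nonpower (y : nat) z)%:R)) // => z.
  by rewrite (nonpower_per y z).2.
rewrite mulr_sumr; apply: eq_bigr => y _; rewrite mulr_sumr; apply: eq_bigr => z _.
by case: (exactly _); rewrite ?mul1r ?mul0r.
Qed.

Lemma nonpower_count_le : nonpower_count <= (p ^ 2)%:R.
Proof.
rewrite -mulnn natrM /nonpower_count; apply: (@le_trans _ _ (\sum_(y < p) p%:R)); last first.
  by rewrite sumr_const card_ord mulr_natl.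
apply: ler_sum => y _; apply: (@le_trans _ _ (\sum_(z < p) 1)); last by rewrite sumr_const card_ord.
by apply: ler_sum => z _; rewrite lern1 leq_b1.
Qed.

(** The three ways of being obstructed exclude one another, whence the factor
    [3]. *)
Definition density : R := 3 * obstructed1_count / (p ^ 6)%:R.

Lemma boxsum_obstructed (h : nat) : boxsum (p ^ 2) (p ^ 2) (p ^ 2)
   (fun x y z : nat => (obstructed (x%:Z - h%:Z) (y%:Z - h%:Z) (z%:Z - h%:Z))%:R) = (p ^ 6)%:R * density.
Proof.
have -> : (p ^ 6)%:R * density = 3 * obstructed1_count.
  by rewrite /density mulrC divfK // pnatr_eq0 -lt0n expn_gt0 prime_gt0.
pose f a b c : R := (obstructed a b c)%:R.
have e1 : (p ^ 2)%N%:Z = (p ^ 2)%N%:Z * 1 by rewrite mulr1.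
rewrite /boxsum.
rewrite (@sum_shift R (p ^ 2) (fun x => \sum_(y < p ^ 2) \sum_(z < p ^ 2) f x (y%:Z - h%:Z) (z%:Z - h%:Z))); last first.
  by move=> a; do 2!apply: eq_bigr => ? _; rewrite /f /obstructed e1 ?(obstructed1D1, obstructed1D2, obstructed1D3).
under eq_bigr => x _.
  rewrite (@sum_shift R (p ^ 2) (fun y => \sum_(z < p ^ 2) f x y (z%:Z - h%:Z))); last first.
    by move=> a; apply: eq_bigr => ? _; rewrite /f /obstructed e1 ?(obstructed1D1, obstructed1D2, obstructed1D3).
  under eq_bigr => y _.
    rewrite (@sum_shift R (p ^ 2) (fun z => f x y z)); last first.
      by move=> a; rewrite /f /obstructed e1 ?(obstructed1D1, obstructed1D2, obstructed1D3).
    over.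
  over.
have fE a b c : f a b c = (obstructed1 a b c)%:R + (obstructed1 b c a)%:R + (obstructed1 c a b)%:R.
  rewrite /f /obstructed /obstructed1 /exactly /nonpower !Fp_intr_eq0.
  case: (p %| a)%Z; case: (p %| b)%Z; case: (p %| c)%Z; rewrite /= ?andbF /= ?orbF ?addr0 ?add0r //.
under eq_bigr do under eq_bigr do under eq_bigr do rewrite fE.
under eq_bigr do under eq_bigr do rewrite !big_split /=.
under eq_bigr do rewrite !big_split /=.
rewrite !big_split /=.
have -> : 3 * obstructed1_count = obstructed1_count + obstructed1_count + obstructed1_count by ring.
congr (_ + _ + _); rewrite /obstructed1_count /boxsum.
  rewrite exchange_big /=; apply: eq_bigr => y _.
  by rewrite exchange_big.
under eq_bigr do rewrite exchange_big /=.
by rewrite exchange_big.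
Qed.

Lemma density_le : density <= 3 / p%:R.
Proof.
have p0 : 0 < p%:R :> R by rewrite ltr0n prime_gt0.
have pE : p.-1%:R = p%:R - 1 :> R by rewrite -subn1 natrB ?prime_gt0.
have p1 : 0 <= p%:R - 1 :> R by rewrite subr_ge0 ler1n prime_gt0.
rewrite /density obstructed1_countE pE !natrX -mulrA ler_wpM2l //.
have := nonpower_count_le; rewrite natrX => h.
rewrite ler_pdivrMr ?exprn_gt0 //.
have -> : p%:R^-1 * p%:R ^+ 6 = p%:R * p%:R ^+ 2 * p%:R ^+ 2 :> R by field; rewrite gt_eqF.
have pc0 : 0 <= nonpower_count by apply: sumr_ge0 => y _; apply: sumr_ge0.
apply: ler_pM => //; first by rewrite mulr_ge0 ?exprn_ge0 ?(ltW p0).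
by rewrite ler_wpM2r ?exprn_ge0 ?(ltW p0) // lerBlDr lerDl.
Qed.

Lemma density_ge0 : 0 <= density.
Proof.
rewrite /density mulr_ge0 ?invr_ge0 // mulr_ge0 //.
by do 3!apply: sumr_ge0 => ? _.
Qed.

Hypothesis lpr : prime l.
Hypothesis pl : (p %% l == 1)%N.

Lemma exponent_dvd : (l %| p.-1)%N.
Proof. by rewrite -subn1 -eqn_mod_dvd ?prime_gt0 // (eqP pl) modn_small // prime_gt1. Qed.

Lemma mul_exponent : (l * e)%N = p.-1.
Proof. by rewrite mulnC divnK // exponent_dvd. Qed.

Lemma exponent_gt0 : (0 < e)%N.
Proof. by rewrite divn_gt0 ?prime_gt0 // dvdn_leq ?exponent_dvd //; have := prime_gt1 pp; lia. Qed.

(** Modulo [p] the form becomes [b y^l + c z^l], and Fermat's little theorem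
    shows that [y] and [z] vanish modulo [p].  Modulo [p^2] it remains
    [a x^l = 0] with [a] divisible by [p] only once, so [x] vanishes modulo
    [p] as well, against primitivity. *)
Lemma obstructed1_insoluble a b c : obstructed1 a b c -> ~ int_soluble l a b c.
Proof.
move=> /andP[/andP[pa npa] /and3P[b0 c0 bc]] /(int_soluble_prim pp (prime_gt0 lpr)).
move=> [x [y [z [nd eq0]]]].
have l2 := prime_gt1 lpr.
have eF : (b%:~R : 'F_p) * y%:~R ^+ l = - c%:~R * z%:~R ^+ l.
  have := congr1 (intr : int -> 'F_p) eq0; rewrite !rmorphD !rmorphM !rmorphXn /=.
  move: pa; rewrite -Fp_intr_eq0 => /eqP ->; rewrite mul0r add0r mulNr => /eqP.
  by rewrite addr_eq0 => /eqP.
have pz : (p %| z)%Z.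
  rewrite -Fp_intr_eq0; apply: contraNT bc => z0.
  have zl : (z%:~R : 'F_p) ^+ l ^+ e = 1 by rewrite -exprM mul_exponent Fp_fermat.
  have y0 : (y%:~R : 'F_p) != 0.
    apply: contraNneq z0 => y0; move/eqP: eF; rewrite y0 expr0n gtn_eqF ?prime_gt0 // mulr0 eq_sym.
    by rewrite mulf_eq0 oppr_eq0 (negPf c0) expf_eq0 => /andP[].
  have yl : (y%:~R : 'F_p) ^+ l ^+ e = 1 by rewrite -exprM mul_exponent Fp_fermat.
  have := congr1 (fun t => t ^+ e) eF; rewrite !exprMn zl yl !mulr1 => ->.
  by [].
have py : (p %| y)%Z.
  move: pz; rewrite -!Fp_intr_eq0 => /eqP z0; move/eqP: eF.
  by rewrite z0 expr0n gtn_eqF ?prime_gt0 // mulr0 mulf_eq0 (negPf b0) expf_eq0 => /andP[].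
have d2 t : (p %| t)%Z -> ((p ^ 2)%N %| t ^+ l)%Z.
  move=> /dvdzP[t' ->]; rewrite exprMn; apply: dvdz_mull.
  rewrite -(subnKC l2) exprD; apply: dvdz_mulr.
  by rewrite -mulnn PoszM expr2.
have ax : ((p ^ 2)%N %| a * x ^+ l)%Z.
  have -> : a * x ^+ l = - (b * y ^+ l + c * z ^+ l).
    by apply/eqP; rewrite -subr_eq0 opprK addrA eq0.
  by rewrite rpredN rpredD // dvdz_mull // d2.
have px : (p %| x)%Z.
  apply: contraNT npa => npx.
  have cop : coprimez (p ^ 2)%N (x ^+ l).
    rewrite coprimezE abszX /=.
    by rewrite coprime_pexpl // coprime_pexpr ?prime_gt0 // prime_coprime.
  by move: ax; rewrite Gauss_dvdzl.
by move: nd; rewrite px py pz.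
Qed.

Lemma obstructed_insoluble a b c : obstructed a b c -> ~ int_soluble l a b c.
Proof.
case/or3P => /obstructed1_insoluble h [x [y [z [nz eq0]]]]; apply: h.
- by exists x, y, z.
- exists y, z, x; split; first by case/or3P: nz => ->; rewrite ?orbT.
  by rewrite -eq0; ring.
- exists z, x, y; split; first by case/or3P: nz => ->; rewrite ?orbT.
  by rewrite -eq0; ring.
Qed.

(** A polynomial of degree [e] has at most [e] roots. *)
Lemma card_pow_eq (c : 'F_p) : (#|[set y : 'I_p | ((y : nat)%:R : 'F_p) ^+ e == c]| <= e)%N.
Proof.
set D := [set y | _].
pose q : {poly 'F_p} := 'X^e - c%:P.
have sq : size q = e.+1 by rewrite size_XnsubC // exponent_gt0.
pose f (y : 'I_p) : 'F_p := (y : nat)%:R.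
have finj : injective f.
  move=> y z /eqP; rewrite /f -val_eqE /= !val_Fp_nat // !modn_small ?ltn_ord //.
  by move=> /eqP/val_inj.
have := @max_poly_roots _ q [seq f y | y in D].
rewrite -size_poly_eq0 sq size_map -cardE ltnS; apply => //.
  by apply/allP => x /mapP[y]; rewrite mem_enum inE => /eqP h ->; rewrite /root !hornerE /f h subrr.
by rewrite map_inj_uniq ?enum_uniq.
Qed.

Lemma nonpower_count_ge : p.-1%:R * (p.-1%:R - e%:R) <= nonpower_count.
Proof.
have p0 := prime_gt0 pp.
have nz (t : 'I_p) : (((t : nat)%:Z%:~R : 'F_p) != 0) = (t != 0%N :> nat).
  rewrite Fp_intr_eq0 dvdzE /=; congr (~~ _); case: (posnP t) => [->|t0]; first by rewrite dvdn0.
  by rewrite gtnNdvd.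
have s1 : \sum_(t < p) ((t : nat) != 0%N)%:R = p.-1%:R :> R.
  have : \sum_(t < p) ((t : nat) != 0%N)%:R = \sum_(t < p) (1 - ((t : nat) == 0%N)%:R) :> R.
    by apply: eq_bigr => t _; case: eqP => _; rewrite ?subrr ?subr0.
  by rewrite sumrB sum_eq0n // sumr_const card_ord => ->; rewrite -subn1 natrB.
rewrite /nonpower_count exchange_big /= -{1}s1 mulr_suml; apply: ler_sum => z _.
case: (boolP ((z : nat) != 0%N)) => z0; last first.
  by rewrite mul0r; apply: sumr_ge0 => y _.
rewrite mul1r -s1.
have c1 : \sum_(y < p) (((y : nat)%:R : 'F_p) ^+ e == (- ((z : nat)%:Z%:~R)) ^+ e)%:R <= e%:R :> R.
  rewrite -natr_sum ler_nat; apply: leq_trans (card_pow_eq ((- ((z : nat)%:Z%:~R)) ^+ e)).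
  by rewrite -sum1dep_card [X in (_ <= X)%N]big_mkcond /=; apply: leq_sum => y _; case: eqP.
apply: le_trans (lerB (lexx _) c1) _; rewrite -sumrB; apply: ler_sum => y _.
rewrite /nonpower !nz z0 -[(y : nat)%:Z%:~R]pmulrn.
by case: eqP => _; case: eqP => _ //=; rewrite ?subr0 ?subrr ?sub0r ?lerN10.
Qed.

Lemma density_ge : 3 * (1 - l%:R^-1) * (p%:R^-1 - 3 / p%:R ^+ 2) <= density.
Proof.
have p0 : 0 < p%:R :> R by rewrite ltr0n prime_gt0.
have l0 : 0 < l%:R :> R by rewrite ltr0n prime_gt0.
have pE : p.-1%:R = p%:R - 1 :> R by rewrite -subn1 natrB ?prime_gt0.
have eE : e%:R = (p%:R - 1) / l%:R :> R.
  by apply: (mulIf (lt0r_neq0 l0)); rewrite divfK ?(lt0r_neq0 l0) // -natrM mulnC mul_exponent.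
have p1 : 0 <= p%:R - 1 :> R by rewrite subr_ge0 ler1n prime_gt0.
have l1 : 0 <= 1 - l%:R^-1 :> R by rewrite subr_ge0 invf_le1 // ler1n prime_gt0.
rewrite /density obstructed1_countE pE natrX.
apply: (@le_trans _ _ (3 * ((p%:R - 1) * p%:R ^+ 2 * ((p%:R - 1) * ((p%:R - 1) - (p%:R - 1) / l%:R))) / p%:R ^+ 6)); last first.
  rewrite natrX ler_wpM2r ?invr_ge0 ?exprn_ge0 ?(ltW p0) // ler_wpM2l // ler_wpM2l ?mulr_ge0 ?exprn_ge0 ?(ltW p0) //.
  by have := nonpower_count_ge; rewrite pE eE.
have -> : 3 * ((p%:R - 1) * p%:R ^+ 2 * ((p%:R - 1) * ((p%:R - 1) - (p%:R - 1) / l%:R))) / p%:R ^+ 6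
   = 3 * (1 - l%:R^-1) * ((p%:R - 1) ^+ 3 / p%:R ^+ 4) :> R.
  by move: (p%:R : R) (l%:R : R) p0 l0 => u w u0 w0; field; rewrite !gt_eqF.
rewrite ler_wpM2l ?mulr_ge0 //.
move: (p%:R : R) p0 p1 => u u0 u1.
have -> : u^-1 - 3 / u ^+ 2 = (u ^+ 3 - 3 * u ^+ 2) / u ^+ 4 by field; rewrite gt_eqF.
rewrite ler_wpM2r ?invr_ge0 ?exprn_ge0 ?(ltW u0) //; nra.
Qed.

End Obstruction.

(** * The forms of prime degree *)

Section PrimeDegree.
Variable R : realType.
Variable m : nat.
Local Notation n := m.+1.
Local Notation l := m.+2.
Hypothesis lpr : prime l.

Section SievePrimes.
Variable J : nat.
Hypothesis J0 : (0 < J)%N.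

(** From [7] on, the density [3 / p] of the excluded classes is below one half. *)
Definition is_sieve_prime (p : 'I_(2 ^ J)) : bool := [&& prime p, (p %% l == 1)%N & (7 <= p)%N].

Definition sieve_index := {p : 'I_(2 ^ J) | is_sieve_prime p}.

Definition sieve_prime (i : sieve_index) : nat := val (val i).

Lemma sieve_prime_inj : injective sieve_prime.
Proof. by move=> i j /val_inj/val_inj. Qed.

Lemma sieve_primeP i : prime (sieve_prime i). Proof. by have /and3P[] := valP i. Qed.

Lemma sieve_prime_mod i : (sieve_prime i %% l == 1)%N. Proof. by have /and3P[] := valP i. Qed.

Lemma sieve_prime_ge i : (7 <= sieve_prime i)%N. Proof. by have /and3P[] := valP i. Qed.

Lemma sieve_prime_lt i : (sieve_prime i < 2 ^ J)%N. Proof. exact: ltn_ord. Qed.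

Lemma sum_sieve_index (F : nat -> R) : \sum_(i : sieve_index) F (sieve_prime i) =
  \sum_(1 <= p < 2 ^ J | prime p) (if (p %% l == 1)%N && (7 <= p)%N then F p else 0).
Proof.
rewrite -(big_sub (fun p : 'I_(2 ^ J) => is_sieve_prime p) (fun p => F p)).
have -> : \sum_(1 <= p < 2 ^ J | prime p) (if (p %% l == 1)%N && (7 <= p)%N then F p else 0) =
  \sum_(0 <= p < 2 ^ J | prime p) (if (p %% l == 1)%N && (7 <= p)%N then F p else 0).
  by rewrite [RHS]big_ltn_cond ?expn_gt0.
by rewrite big_mkord -big_mkcondr /=; apply: eq_bigl => p; rewrite /is_sieve_prime.
Qed.

Definition sieve_density (i : sieve_index) : R := density l (sieve_prime i) R.

Lemma sieve_density_ge0 i : 0 <= sieve_density i.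
Proof. exact: density_ge0. Qed.

Lemma sieve_density_le i : sieve_density i <= 3 / (sieve_prime i)%:R.
Proof. by apply: density_le; exact: sieve_primeP. Qed.

Lemma sum_log_sieve_index : \sum_(i : sieve_index) ln (sieve_prime i)%:R / (sieve_prime i)%:R <= J%:R * (4 * ln 2) :> R.
Proof.
rewrite (sum_sieve_index (fun p => ln p%:R / p%:R)).
apply: (@le_trans _ _ (\sum_(1 <= p < 2 ^ J | prime p) ln p%:R / p%:R)).
  apply: ler_sum => p pp; case: ifP => // _.
  by rewrite divr_ge0 // ln_ge0 // ler1n prime_gt0.
rewrite big_blocks -[J in J%:R]card_ord -sum1_card natr_sum mulr_suml; apply: ler_sum => k _.
have k2 : 0 < 2 ^+ k :> R by rewrite exprn_gt0.
rewrite mul1r -(ler_pM2l k2); apply: le_trans (sum_ln_block R k).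
rewrite mulr_sumr big_nat_cond [leRHS]big_nat_cond; apply: ler_sum => p /andP[/andP[kp _] pp].
rewrite mulrCA ler_piMr ?ln_ge0 ?ler1n ?prime_gt0 //.
by rewrite ler_pdivrMr ?ltr0n ?prime_gt0 // mul1r -natrX ler_nat.
Qed.

(** Both the second-order term [3 / p ^ 2] of the density and the omission of
    the primes below [7] are covered by subtracting [7 / p ^ 2] for every
    [p]; the sum of [1 / p ^ 2] is at most [2]. *)
Lemma sum_sieve_density_ge : 3 * (1 - l%:R^-1) * (\sum_(k < J) inv_block R m k - 14) <= \sum_(i : sieve_index) sieve_density i.
Proof.
have l1 : 0 <= 3 * (1 - l%:R^-1) :> R by rewrite mulr_ge0 // subr_ge0 invf_le1 ?ltr0n // ler1n.
apply: (@le_trans _ _ (\sum_(i : sieve_index) 3 * (1 - l%:R^-1) * ((sieve_prime i)%:R^-1 - 3 / (sieve_prime i)%:R ^+ 2))); last first.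
  by apply: ler_sum => i _; apply: density_ge => //; [exact: sieve_primeP|exact: sieve_prime_mod].
rewrite -mulr_sumr ler_wpM2l //.
rewrite (sum_sieve_index (fun p => p%:R^-1 - 3 / p%:R ^+ 2)).
have -> : \sum_(k < J) inv_block R m k = \sum_(1 <= p < 2 ^ J | prime p) (if (p %% l == 1)%N then p%:R^-1 else 0).
  by rewrite big_blocks; apply: eq_bigr => k _; rewrite /inv_block big_mkcondr.
have sq : \sum_(1 <= p < 2 ^ J | prime p) p%:R ^- 2 <= 2 :> R.
  rewrite big_blocks; apply: le_trans (@geom_le2 R 2^-1 J _); last by rewrite invr_ge0 ler0n lexx.
  apply: ler_sum => k _.
  apply: (@le_trans _ _ (\sum_(2 ^ k <= p < 2 ^ k.+1) (2 ^+ k) ^- 2)).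
    rewrite big_mkcond big_nat_cond [leRHS]big_nat_cond; apply: ler_sum => p /andP[/andP[kp _] _].
    case: ifP => pp; last by rewrite invr_ge0 !exprn_ge0.
    rewrite lef_pV2 ?posrE ?exprn_gt0 ?ltr0n ?prime_gt0 // lerXn2r ?nnegrE ?exprn_ge0 //.
    by rewrite -natrX ler_nat.
  rewrite sumr_const_nat (_ : 2 ^ k.+1 - 2 ^ k = 2 ^ k)%N; last by rewrite expnS mul2n -addnn addnK.
  rewrite -[_ *+ (2 ^ k)]mulr_natr natrX exprVn expr2 invfM -mulrA mulVf ?mulr1 //.
apply: (@le_trans _ _ (\sum_(1 <= p < 2 ^ J | prime p) ((if (p %% l == 1)%N then p%:R^-1 else 0) - 7 * p%:R ^- 2))).
  by rewrite sumrB -mulr_sumr; lra.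
apply: ler_sum => p pp; have p0 : 0 < p%:R :> R by rewrite ltr0n prime_gt0.
have q0 : 0 <= p%:R ^- 2 :> R by rewrite invr_ge0 exprn_ge0 // ltW.
case: ifP => /= pl; last by rewrite sub0r oppr_le0 mulr_ge0.
have [p7|p7] := boolP (7 <= p)%N; first by rewrite lerD2l lerN2 ler_wpM2r // ler_nat.
rewrite subr_le0 expr2 invfM mulrA ler_peMl ?invr_ge0 ?(ltW p0) //.
by rewrite ler_pdivlMr // mul1r (ler_nat R _ 7); move: p7; rewrite -ltnNge; exact: ltnW.
Qed.

(** The level of the sieve is [Q = 2 ^ (97 J)], and [582 = 6 * 97]. *)
Lemma soluble_count_sieve (h N : nat) : (2 ^ (582 * J) <= N)%N ->
  boxsum N N N (fun x y z => (`[< int_soluble l (x%:Z - h%:Z) (y%:Z - h%:Z) (z%:Z - h%:Z) >])%:R)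
   * (2^-1 * expR (\sum_(i : sieve_index) sieve_density i)) <= 4 * N%:R ^+ 3 :> R.
Proof.
move=> JN.
have dh i : sieve_density i <= 2^-1.
  apply: le_trans (sieve_density_le i) _; rewrite ler_pdivrMr ?ltr0n ?prime_gt0 ?sieve_primeP //.
  have : 7 <= (sieve_prime i)%:R :> R by rewrite (ler_nat R 7) sieve_prime_ge.
  lra.
pose g i := sieve_density i / (1 - sieve_density i).
have d0 := sieve_density_ge0.
have g0 i : 0 <= g i by rewrite divr_ge0 // subr_ge0; have := dh i; lra.
have g1 i : g i <= 1 by have := dh i => h1; rewrite ler_pdivrMr ?mul1r; lra.
pose O i (x y z : nat) := obstructed l (sieve_prime i) (x%:Z - h%:Z) (y%:Z - h%:Z) (z%:Z - h%:Z).
(* With [w] the density of [O], the value [w / (1 - w)] off [O] makes the mean of [v]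
   zero, and the mean of its square is [w / (1 - w)] again. *)
pose v i x y z : R := if O i x y z then -1 else g i.
have vper i : periodic3 (sieve_prime i ^ 2) (v i) by apply: obstructed_periodic; exact: sieve_primeP.
have v1 i x y z : `|v i x y z| <= 1.
  by rewrite /v; case: ifP => _; rewrite ?normrN1 // ger0_norm.
have bO i : boxsum (sieve_prime i ^ 2) (sieve_prime i ^ 2) (sieve_prime i ^ 2) (fun x y z => (O i x y z)%:R) = (sieve_prime i ^ 6)%:R * sieve_density i.
  by rewrite /O boxsum_obstructed //; exact: sieve_primeP.
have q6 i : (sieve_prime i ^ 2)%:R ^+ 3 = (sieve_prime i ^ 6)%:R :> R by rewrite -natrX -expnM.
have nd i : 1 - sieve_density i != 0 by rewrite gt_eqF // subr_gt0; have := dh i; lra.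
have vmean i : boxsum (sieve_prime i ^ 2) (sieve_prime i ^ 2) (sieve_prime i ^ 2) (v i) = 0.
  by rewrite boxsum_if bO q6 /g; field; exact: nd.
have vsq i : boxsum (sieve_prime i ^ 2) (sieve_prime i ^ 2) (sieve_prime i ^ 2) (fun x y z => v i x y z ^+ 2) = (sieve_prime i ^ 6)%:R * g i.
  rewrite (@eq_boxsum _ _ (fun x y z => if O i x y z then 1 else g i ^+ 2)); last first.
    by move=> x y z; rewrite /v; case: ifP => _; rewrite ?sqrrN ?expr1n.
  by rewrite boxsum_if bO q6 /g; field; exact: nd.
pose sol x y z := `[< int_soluble l (x%:Z - h%:Z) (y%:Z - h%:Z) (z%:Z - h%:Z) >].
have hsol x y z i : sol x y z -> v i x y z = g i.
  move=> /asboolP s; rewrite /v; case: ifP => // hO.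
  by case: (obstructed_insoluble (sieve_primeP i) lpr (sieve_prime_mod i) hO s).
have Q6 : ((2 ^ (97 * J)) ^ 6 <= N)%N by rewrite -expnM mulnAC.
have := @sieve_bound R sieve_index sieve_prime sieve_prime_inj sieve_primeP v g vper v1 vmean vsq g0 sol N (2 ^ (97 * J)) hsol.
rewrite expn_gt0 => /(_ isT Q6); apply: le_trans.
rewrite ler_wpM2l //; first by do 3!apply: sumr_ge0 => ? _.
by apply: rankin_lower_bound => //; [exact: sieve_prime_ge|exact: sieve_prime_lt|exact: sieve_density_le|exact: sum_log_sieve_index].
Qed.

End SievePrimes.

Lemma soluble_count_prime : exists C : R, 0 < C /\ forall (J h N : nat), (2 ^ (582 * J.+1) <= N)%N ->
  boxsum N N N (fun x y z => (`[< int_soluble l (x%:Z - h%:Z) (y%:Z - h%:Z) (z%:Z - h%:Z) >])%:R)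
   * J.+1%:R `^ (3 / l%:R) <= C * N%:R ^+ 3 :> R.
Proof.
have [C hC] := sum_inv_primes R lpr.
pose k0 : R := 3 * (1 - l%:R^-1).
have l0 : 0 < l%:R :> R by rewrite ltr0n.
have k00 : 0 <= k0 by rewrite mulr_ge0 // subr_ge0 invf_le1 // ler1n.
pose E := expR (k0 * (C + 14)).
exists (8 * E); split; first by rewrite mulr_gt0 // expR_gt0.
move=> J h N JN; have := soluble_count_sieve (ltn0Sn J) h JN.
set S := boxsum _ _ _ _ => hS.
have S0 : 0 <= S by do 3!apply: sumr_ge0 => ? _.
have E0 : 0 < E := expR_gt0 _.
have hd : J.+1%:R `^ (3 / l%:R) <= E * expR (\sum_(i : sieve_index J.+1) sieve_density i).
  rewrite /powR gt_eqF ?ltr0n // -expRD ler_expR.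
  have := sum_sieve_density_ge J.+1; have := ler_wpM2l k00 (hC J); rewrite -/k0.
  have -> : 3 / l%:R * ln J.+1%:R = k0 * (ln J.+1%:R / n%:R).
    rewrite /k0 -[l%:R]natr1; have n0 : 0 < n%:R :> R by rewrite ltr0n.
    have n1 : n%:R + 1 != 0 :> R by rewrite gt_eqF // addr_gt0.
    move: (n%:R : R) (ln J.+1%:R) (lt0r_neq0 n0) n1 => x y x0 x1.
    by field; rewrite x0 x1.
  move: (\sum_(i : sieve_index J.+1) sieve_density i) (\sum_(k < J.+1) _) (ln J.+1%:R / n%:R) => a b c; lra.
have := ler_wpM2l S0 hd; have := ler_wpM2r (ltW E0) hS; lra.
Qed.

End PrimeDegree.

(** * Reduction to a prime degree *)

Lemma soluble_prime_factor (d l : nat) (a : 'rV[int]_3) : (0 < d)%N -> (l %| d)%N ->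
  diag_soluble d a -> int_soluble l (a 0 0) (a 0 1) (a 0 (inord 2)).
Proof.
move=> d0 /dvdnP[k dk] [x x0 ex].
have k0 : (0 < k)%N by case: k dk d0 => // ->; rewrite mul0n.
pose y i : rat := x 0 i ^+ k.
have y0 : exists i, y i != 0.
  have /rV0Pn[i xi] := x0; exists i.
  by rewrite /y expf_eq0 k0.
pose i2 : 'I_3 := inord 2.
(* Common denominator of the [k]-th powers of the coordinates. *)
pose D : int := denq (y 0) * denq (y 1) * denq (y i2).
have D0 : D%:~R != 0 :> rat by rewrite intr_eq0 !mulf_neq0 // denq_neq0.
pose Y0 : int := numq (y 0) * denq (y 1) * denq (y i2).
pose Y1 : int := numq (y 1) * denq (y 0) * denq (y i2).
pose Y2 : int := numq (y i2) * denq (y 0) * denq (y 1).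
have nd (q : rat) : (numq q)%:~R = q * (denq q)%:~R :> rat by rewrite numqE.
have E0 : Y0%:~R = y 0 * D%:~R :> rat by rewrite /Y0 /D !rmorphM /= nd; ring.
have E1 : Y1%:~R = y 1 * D%:~R :> rat by rewrite /Y1 /D !rmorphM /= nd; ring.
have E2 : Y2%:~R = y i2 * D%:~R :> rat by rewrite /Y2 /D !rmorphM /= nd; ring.
exists Y0, Y1, Y2; split.
  have [i yi] := y0; rewrite -!(intr_eq0 rat) E0 E1 E2 !mulf_eq0 (negPf D0) !orbF.
  case: i yi => [[|[|[|//]]] hi] yi.
  - by rewrite (_ : 0 = Ordinal hi) ?yi //; exact: val_inj.
  - by rewrite (_ : 1 = Ordinal hi) ?yi ?orbT //; exact: val_inj.
  - by rewrite (_ : i2 = Ordinal hi) ?yi ?orbT //; apply: val_inj; rewrite /= inordK.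
apply: (@intr_inj rat); rewrite !rmorphD !rmorphM !rmorphXn /= E0 E1 E2 !exprMn.
move: ex; rewrite !big_ord_recl big_ord0 addr0.
have -> : lift ord0 ord0 = 1 :> 'I_3 by apply: val_inj.
have -> : lift ord0 (lift ord0 ord0) = i2 :> 'I_3 by apply: val_inj; rewrite /= inordK.
rewrite dk !exprM -/(y _) -/(y 1) -/(y i2) => ex.
transitivity (((a 0 0)%:~R * y 0 ^+ l + ((a 0 1)%:~R * y 1 ^+ l + (a 0 i2)%:~R * y i2 ^+ l)) * D%:~R ^+ l).
  by rewrite /i2; ring.
by rewrite ex mul0r.
Qed.

(** The numbers [1, ..., pdiv d - 1] are coprime to [d], and [d - 1] is one
    more such number. *)
Lemma totient_ge_pdiv d : (1 < d)%N -> (pdiv d < d)%N -> (pdiv d <= totient d)%N.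
Proof.
move=> d1 ld; set l := pdiv d in ld *.
have l1 : (1 < l)%N by apply: prime_gt1; exact: pdiv_prime.
rewrite totient_count_coprime.
rewrite (bigD1_seq d.-1) ?iota_uniq ?mem_index_iota //=; last by lia.
have -> : coprime d d.-1 by rewrite -{1}(prednK (ltnW d1)) coprimeSn.
have -> : l = (1 + l.-1)%N by lia.
rewrite leq_add2l.
apply: (@leq_trans (\sum_(1 <= i < l) 1)%N); first by rewrite sum_nat_const_nat muln1; lia.
rewrite [X in (_ <= X)%N]big_mkcond /= [X in (_ <= X)%N](big_cat_nat (n := 1)) //=; last by lia.
apply: leq_trans (leq_addl _ _).
rewrite [X in (_ <= X)%N](big_cat_nat (n := l)) //=; [|lia|exact: ltnW].
apply: leq_trans (leq_addr _ _).
rewrite big_nat [X in (_ <= X)%N]big_nat; apply: leq_sum => i /andP[i1 il].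
rewrite ifT; last by apply/eqP; lia.
suff -> : coprime d i by [].
rewrite /coprime; apply/negPn/negP => g1.
have g0 : (0 < gcdn d i)%N by rewrite gcdn_gt0 i1 orbT.
have : (pdiv (gcdn d i) < l)%N.
  apply: leq_ltn_trans il; apply: leq_trans (pdiv_leq g0) _.
  by rewrite dvdn_leq // dvdn_gcdr.
rewrite ltnNge pdiv_min_dvd //; first by apply: prime_gt1; apply: pdiv_prime; lia.
by apply: dvdn_trans (pdiv_dvd _) (dvdn_gcdl _ _).
Qed.

(** Equality holds for [d] prime. *)
Lemma psi_le (R : realType) d : (1 < d)%N -> psi R d <= 3 / (pdiv d)%:R.
Proof.
move=> d1; set l := pdiv d.
have lpr : prime l by apply: pdiv_prime.
have l0 : 0 < l%:R :> R by rewrite ltr0n prime_gt0.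
have d0 : 0 < d%:R :> R by rewrite ltr0n ltnW.
have t0 : 0 < (totient d)%:R :> R by rewrite ltr0n totient_gt0 ltnW.
rewrite /psi -mulrA ler_wpM2l // mulrC ler_pdivrMr // mulrC ler_pdivlMr //.
have [ld|dl] := ltnP l d.
  have : l%:R <= (totient d)%:R :> R by rewrite ler_nat totient_ge_pdiv.
  apply: le_trans; rewrite ler_piMl ?(ltW l0) // lerBlDr lerDl invr_ge0 ltW //.
have dE : d = l by apply/eqP; rewrite eqn_leq dl dvdn_leq ?pdiv_dvd // ltnW.
rewrite dE totient_prime // mulrBl mul1r mulVf ?gt_eqF //.
by rewrite -subn1 natrB // prime_gt0.
Qed.

Lemma psi_ge0 (R : realType) d : (0 < d)%N -> 0 <= psi R d.
Proof.
move=> d0; rewrite /psi mulr_ge0 ?divr_ge0 // subr_ge0 invf_le1 ?ltr0n // ler1n //.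
Qed.

(** Shifts the box to natural coordinates and weakens solubility to degree [l]. *)
Lemma Nsol_le (R : realType) (d l : nat) (H : R) (h := Num.truncn H) (N := (2 * h).+1) :
  1 < H -> (0 < d)%N -> (l %| d)%N ->
  (Nsol d H)%:R <= boxsum N N N
    (fun x y z => (`[< int_soluble l (x%:Z - h%:Z) (y%:Z - h%:Z) (z%:Z - h%:Z) >])%:R) :> R.
Proof.
move=> H1 d0 ld.
pose sol (t : 'I_N * 'I_N * 'I_N) : bool :=
  `[< int_soluble l ((t.1.1 : nat)%:Z - h%:Z) ((t.1.2 : nat)%:Z - h%:Z) ((t.2 : nat)%:Z - h%:Z) >].
have -> : boxsum N N N
    (fun x y z => (`[< int_soluble l (x%:Z - h%:Z) (y%:Z - h%:Z) (z%:Z - h%:Z) >])%:R) = #|[set t | sol t]|%:R :> R.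
  rewrite /boxsum -sum1dep_card natr_sum [RHS]big_mkcond /=.
  rewrite pair_bigA /= pair_bigA /=; apply: eq_bigr => t _.
  by rewrite /sol; case: asboolP.
rewrite ler_nat /Nsol cardfE.
set F := fset_set _.
have Fin (a : F) : soluble_in_box d H (val a).
  have := valP a; rewrite /F in_fset_set; [exact: set_mem|exact: finite_soluble_in_box].
have bnd (a : F) i : (`|(val a) 0%R i| <= h)%N.
  have [/(_ i) b _] := Fin a.
  by rewrite /h truncn_ge_nat ?(le_trans ler01 (ltW H1)) // natr_absz intr_norm.
pose g (a : F) : 'I_N * 'I_N * 'I_N :=
  (inord `|((val a) 0 0 + h%:Z)%R|, inord `|((val a) 0 1 + h%:Z)%R|, inord `|((val a) 0 (inord 2) + h%:Z)%R|).
have gE (a : F) i : (inord `|((val a) 0 i + h%:Z)%R| : 'I_N)%:Z - h%:Z = (val a) 0 i.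
  by have := bnd a i => hb; rewrite inordK; lia.
have ginj : injective g.
  move=> a b [e0 e1 e2]; apply: val_inj; apply/rowP => i.
  suff : (inord `|((val a) 0 i + h%:Z)%R| : 'I_N) = inord `|((val b) 0 i + h%:Z)%R|.
    by move=> /(congr1 (fun t : 'I_N => t%:Z - h%:Z)); rewrite !gE.
  case: i => [[|[|[|//]]] hi].
  - by rewrite (_ : Ordinal hi = 0) //; apply: val_inj.
  - by rewrite (_ : Ordinal hi = 1) //; apply: val_inj.
  - by rewrite (_ : Ordinal hi = inord 2) //; apply: val_inj; rewrite /= inordK.
rewrite -(card_codom ginj); apply: subset_leq_card; apply/fintype.subsetP => t /codomP[a ->].
rewrite inE /sol /g /= !gE; apply/asboolP.
by have [_ /(soluble_prime_factor d0 ld)] := Fin a.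
Qed.

Theorem theorem1 (R : realType) (d : nat) (hd : (0 < d)%N) :
  exists c : R, 0 < c /\
    forall H : R, 1 < H ->
      (Nsol d H)%:R <= c * (H ^+ 3 / ln H `^ psi R d).
Proof.
have N3 (H : R) : 1 < H -> (2 * Num.truncn H).+1%:R ^+ 3 <= 27 * H ^+ 3.
  move=> H1; have H0 : 0 <= H by rewrite ltW // (lt_trans ltr01).
  have -> : 27 * H ^+ 3 = (3 * H) ^+ 3 by ring.
  rewrite lerXn2r ?nnegrE ?mulr_ge0 //.
  have : (Num.truncn H)%:R <= H by rewrite truncn_le.
  rewrite -natr1 natrM; lra.
have triv (H : R) : 1 < H -> (Nsol d H)%:R <= 27 * H ^+ 3.
  move=> H1; apply: le_trans (Nsol_le H1 hd (dvdnn d)) _.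
  by apply: le_trans (boxsum_le_cube _ _ _) _; exact: N3.
have [d1|d1] := leqP d 1.
  exists 27; split=> // H H1; apply: le_trans (triv H H1) _.
  have -> : psi R d = 0 by rewrite (_ : d = 1%N) /psi ?invr1 ?subrr ?mulr0 //; lia.
  by rewrite powRr0 invr1 mulr1.
set l := pdiv d; have lpr : prime l by apply: pdiv_prime.
have ld : (l %| d)%N by apply: pdiv_dvd.
have [m lE] : exists m, l = m.+2 by exists l.-2; have := prime_gt1 lpr; lia.
have [K [K0 [C [C0 hC]]]] : exists K : nat, (0 < K)%N /\ exists C : R, 0 < C /\
   forall J h N : nat, (2 ^ (K * J.+1) <= N)%N ->
  boxsum N N N (fun x y z => (`[< int_soluble m.+2 (x%:Z - h%:Z) (y%:Z - h%:Z) (z%:Z - h%:Z) >])%:R)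
   * J.+1%:R `^ (3 / m.+2%:R) <= C * N%:R ^+ 3 :> R.
  by exists 582%N; split=> //; apply: soluble_count_prime; rewrite -lE.
set ps := psi R d; have ps0 : 0 <= ps by apply: psi_ge0.
have psl : ps <= 3 / m.+2%:R by rewrite -lE; exact: psi_le.
have KR : 0 < K%:R :> R by rewrite ltr0n.
(* [log H <= K (J + 1) <= 2 K J] when [J > 0], hence the factor [2 K]. *)
pose B : R := (2 * K%:R) `^ ps.
have B0 : 0 < B by rewrite powR_gt0 // mulr_gt0.
(* The factor [27] comes from [N <= 3 H]. *)
exists (27 * (C + 1) * B); split; first by rewrite !mulr_gt0 // ltr_wpDr.
move=> H H1; have lnH : 0 < ln H by rewrite ln_gt0.
have H0 : 0 < H := lt_trans ltr01 H1.
have P0 : 0 < ln H `^ ps by rewrite powR_gt0.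
have H30 : 0 <= H ^+ 3 by rewrite exprn_ge0 // ltW.
rewrite mulrA ler_pdivlMr //.
set h := Num.truncn H; pose N := (2 * h).+1.
have HN : H <= N%:R.
  apply: le_trans (ltW (truncnS_gt H)) _; by rewrite ler_nat ltnS leq_pmull.
(* The largest [J] with [2 ^ (K J) <= N]. *)
pose J := (trunc_log 2 N %/ K)%N.
have lnJ : ln H <= K%:R * J.+1%:R.
  have NK : (N <= 2 ^ (K * J.+1))%N.
    apply: leq_trans (ltnW (trunc_log_ltn N (isT : 1 < 2)%N)) _.
    by rewrite leq_exp2l // mulnC ltn_ceil.
  apply: (@le_trans _ _ (ln (2 ^ (K * J.+1))%N%:R)).
    by rewrite ler_ln ?posrE ?ltr0n ?expn_gt0 // (le_trans HN) // ler_nat.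
  rewrite ln_exp2n natrM ler_piMr ?mulr_ge0 //.
  by have -> : 2 = 1 + 1 :> R; [lra|apply: le_ln1Dx; lra].
(* If [J = 0], then [H] is bounded and the trivial bound is enough. *)
have [J0|J0] := posnP J.
  have h1 : ln H `^ ps <= B.
    apply: (ge0_ler_powR ps0); rewrite ?nnegrE ?(ltW lnH) ?mulr_ge0 //.
    by apply: le_trans lnJ _; rewrite J0 mulr1 ler_peMl ?(ltW KR) // ler1n.
  apply: (@le_trans _ _ (27 * H ^+ 3 * B)).
    by apply: ler_pM => //; [exact: powR_ge0|exact: triv].
  have : 0 <= C * (H ^+ 3 * B) by rewrite !mulr_ge0 // ltW.
  lra.
have hN := Nsol_le H1 hd ld.
rewrite -/h -/N lE in hN.
have JN : (2 ^ (K * J.-1.+1) <= N)%N.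
  rewrite prednK //; apply: leq_trans (@trunc_logP 2 N isT isT).
  by rewrite leq_exp2l // mulnC leq_divM.
have := hC J.-1 h N JN; rewrite prednK //; set S := boxsum _ _ _ _ in hN * => hS.
have S0 : 0 <= S by do 3!apply: sumr_ge0 => ? _.
have JR : 1 <= J%:R :> R by rewrite ler1n.
have lnB : ln H `^ ps <= B * J%:R `^ (3 / m.+2%:R).
  apply: (@le_trans _ _ (B * J%:R `^ ps)); last first.
    by rewrite ler_wpM2l ?(ltW B0) // ler_powR.
  rewrite -powRM ?mulr_ge0 //.
  apply: (ge0_ler_powR ps0); rewrite ?nnegrE ?(ltW lnH) ?mulr_ge0 //.
  apply: le_trans lnJ _; rewrite -natr1.
  have := ler_wpM2l (ltW KR) JR; lra.
apply: (@le_trans _ _ (S * (B * J%:R `^ (3 / m.+2%:R)))).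
  by apply: ler_pM => //; exact: powR_ge0.
have hS2 := ler_wpM2l (ltW B0) hS.
have hS3 : B * (C * N%:R ^+ 3) <= B * (C * (27 * H ^+ 3)).
  by rewrite !ler_wpM2l ?(ltW B0) ?(ltW C0) //; exact: N3.
have : 0 <= B * H ^+ 3 by rewrite mulr_ge0 // ltW.
lra.
Qed.
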